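(* Let $p\ge2$ be an integer, $h>0$, and $0<\beta<\beta_p$, where $\beta_p>0$ is defined by $8p^2\beta_p^2\exp(16\beta_p^2p)=\frac12$. Let $Y$ be a standard Gaussian random variable, let $q\in[0,1]$ be the (unique) solution of $q=\mathbf E\big[\tanh^2\big(\beta(\frac p2)^{1/2}q^{\frac{p-1}{2}}Y+h\big)\big]$, and set $\hat q_4=\mathbf E\big[\tanh^4\big(\beta(\frac p2)^{1/2}q^{\frac{p-1}{2}}Y+h\big)\big]$. Let $$\Delta_{p-1}=R_{1,3}^{p-1}-R_{1,4}^{p-1}-R_{2,3}^{p-1}+R_{2,4}^{p-1}.$$ Then there is a constant $K$, not depending on $N$, such that for all $N\ge p$ $$\left|\nu\big(\Delta_{p-1}^2\big)-\frac{4(p-1)^2q^{2(p-2)}(1-2q+\hat q_4)}{N\Big(1-\frac{p(p-1)}{2}q^{p-2}(1-2q+\hat q_4)\beta^2\Big)}\right|\le\frac{K}{N^{3/2}} .$$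
   Context: $p$-spin model with external field. Let $\Sigma_N=\{-1,1\}^N$, $A_N^p=\{(i_1,\dots,i_p)\in\mathbb N^p:1\le i_1<\dots<i_p\le N\}$, $u_N=\big(\frac{p!}{2N^{p-1}}\big)^{1/2}$, and let $\{g_{i_1,\dots,i_p}:(i_1,\dots,i_p)\in A_N^p\}$ be independent standard Gaussian random variables (the disorder). The Hamiltonian is $$-H_{N,\beta,h}(\sigma)=\beta u_N\sum_{(i_1,\dots,i_p)\in A_N^p}g_{i_1,\dots,i_p}\sigma_{i_1}\cdots\sigma_{i_p}+h\sum_{i=1}^N\sigma_i,\quad \sigma\in\Sigma_N,$$ and $Z_N=\sum_{\sigma\in\Sigma_N}\exp(-H_{N,\beta,h}(\sigma))$. For $f:\Sigma_N^n\to\mathbb R$, $$\langle f\rangle=Z_N^{-n}\sum_{(\sigma^1,\dots,\sigma^n)\in\Sigma_N^n}f(\sigma^1,\dots,\sigma^n)\exp\Big(-\sum_{l\le n}H_{N,\beta,h}(\sigma^l)\Big),\qquad \nu(f)=\mathbf E\langle f\rangle,$$ with $\mathbf E$ the expectation over the disorder. For replicas $\sigma^l,\sigma^{l'}$ the overlap is $R_{l,l'}=\frac1N\sum_{i=1}^N\sigma_i^l\sigma_i^{l'}$. *)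

(* Defs.v *)
From mathcomp Require Import all_boot all_order all_algebra.
From mathcomp Require Import all_classical all_reals all_analysis.

Set Implicit Arguments.
Unset Strict Implicit.
Unset Printing Implicit Defensive.

Import Order.TTheory GRing.Theory Num.Theory.
Import numFieldNormedType.Exports.

Local Open Scope classical_set_scope.
Local Open Scope ring_scope.

Definition tanh (R : realType) (x : R) : R :=
  (expR x - expR (- x)) / (expR x + expR (- x)).

(* The two laws are compared on Borel sets only: both sides are total functions
   on all sets, and their values on non-measurable sets are meaningless. *)
Definition std_gaussian d (T : measurableType d) (R : realType)
    (P : probability T R) (X : {RV P >-> R}) : Prop :=
  forall B : set R, measurable B -> distribution P X B = normal_prob 0 1 B.

Definition mutually_independent d (T : measurableType d) (R : realType)
    (P : probability T R) (I : finType) (X : I -> {RV P >-> R}) : Prop :=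
  forall (J : {set I}) (B : I -> set R), (forall i, measurable (B i)) ->
    P (\bigcap_(i in [set` J]) (X i @^-1` B i)) =
    (\prod_(i in J) P (X i @^-1` B i))%E.

(* Elements of {-1,1}^N are encoded by booleans; coordinate i of s is the real
   number [spin R s i] = (-1) ^+ (s i). *)
Definition config (N : nat) := {ffun 'I_N -> bool}.

Definition spin (R : realType) (N : nat) (s : config N) (i : 'I_N) : R :=
  (-1) ^+ (s i).

(* A_N^p: strictly increasing p-tuples of indices, here in {0, ..., N-1}. *)
Definition multi_index (p N : nat) : finType :=
  {t : p.-tuple 'I_N | sorted ltn (map val t)}.

Section PSpin.
Variables (R : realType) (p N : nat).
Implicit Types (beta h : R) (g : multi_index p N -> R).

Definition u_coef : R := Num.sqrt (p`!%:R / (2 * N%:R ^+ p.-1)).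

(* [hamiltonian] is H itself, not -H. *)
Definition hamiltonian beta h g (s : config N) : R :=
  - (beta * u_coef *
       (\sum_(t : multi_index p N) g t * \prod_(k < p) spin R s (tnth (val t) k))
     + h * \sum_(i < N) spin R s i).

Definition partition_function beta h g : R :=
  \sum_(s : config N) expR (- hamiltonian beta h g s).

Definition replicas (n : nat) := {ffun 'I_n -> config N}.

Definition gibbs beta h g (n : nat) (f : replicas n -> R) : R :=
  (partition_function beta h g ^+ n)^-1 *
  \sum_(s : replicas n) f s * expR (- \sum_(l < n) hamiltonian beta h g (s l)).

Definition nu beta h d (T : measurableType d) (P : probability T R)
    (g : multi_index p N -> {RV P >-> R}) (n : nat) (f : replicas n -> R) : \bar R :=
  'E_P[fun w => gibbs beta h (fun t => g t w) f].

Definition overlap (n : nat) (s : replicas n) (l l' : 'I_n) : R :=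
  N%:R^-1 * \sum_(i < N) spin R (s l) i * spin R (s l') i.

(* r1, ..., r4 are the replicas numbered 1, ..., 4: indices 0, ..., 3 of 'I_4. *)
Definition Delta (m : nat) (s : replicas 4) : R :=
  let r1 : 'I_4 := @Ordinal 4 0 isT in
  let r2 : 'I_4 := @Ordinal 4 1 isT in
  let r3 : 'I_4 := @Ordinal 4 2 isT in
  let r4 : 'I_4 := @Ordinal 4 3 isT in
  overlap s r1 r3 ^+ m - overlap s r1 r4 ^+ m
  - overlap s r2 r3 ^+ m + overlap s r2 r4 ^+ m.

End PSpin.

(* Main.v *)
(* The cavity method, run separately at every site i. The couplings containing i are
   switched off along a path t in [0, 1] and replaced by a Gaussian field of variance
   beta^2 (p/2) q^(p-1) acting on the spin at i. Gaussian integration by parts gives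
   nu_t' f as an average of f against kernels between replicas, and these kernels are
   of the order of R^(p-1) - q^(p-1), where R is the overlap without the site i. At
   t = 0 the spins at i are independent of the rest, with mean tanh of a Gaussian field.

   (R - q)^4 is (R - q)^3 times an average over sites of (agreement of the spins - q);
   at t = 0 the fixed-point equation for q kills the second factor, and for small beta
   the cost of moving to t = 0 is absorbed, so that nu((R - q)^4) = O(1/N^2). Let
   D = R_13 - R_14 - R_23 + R_24 and let E_i be the same expression for the spins at i,
   so that D is the average of the E_i. To second order along the path,
   nu(D E_i) = 4 w / N + w c nu(D^2) + O(N^(-3/2)), where w = 1 - 2q + q4 and
   c = beta^2 (p/2) (p-1) q^(p-2): the term 4 w / N is the contribution of the site i to
   D, and w c nu(D^2) is the first derivative at t = 0. Averaging over i gives a linear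
   equation for nu(D^2), and Delta_{p-1} is (p-1) q^(p-2) D up to O(|R - q|^2). *)

From HB Require Import structures.
Require Import Defs.
From mathcomp Require Import all_boot all_order all_algebra.
From mathcomp Require Import all_classical all_reals all_analysis.
From mathcomp Require Import measurable_realfun ring lra.

Set Implicit Arguments.
Unset Strict Implicit.
Unset Printing Implicit Defensive.

Import Order.TTheory GRing.Theory Num.Theory.
Import numFieldNormedType.Exports.

Local Open Scope classical_set_scope.
Local Open Scope ring_scope.

(** * Gaussian integration by parts *)

(** The paths of different sites share their endpoint [t = 1], so estimates made at single sites can
    simply be summed. The kernel of a replica with itself is of order one, not small; it is a
    constant, however, and the charges on the diagonal add up to zero, so only pairs of distinct
    replicas matter. The smallness of [beta] enters once. With [n] replicas the off-diagonal charges
    have total mass [2 n^2 + n], that is 10 for the two replicas of the fourth moment; the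
    difference (agreement - q) is at most 2; the kernel has slope [kappa1 <= beta^2 p^2 / 2];
    returning from time [t] to time 1 costs [growth = expR (10 beta^2 p)]. The equation for [beta_p]
    gives [20 kappa1 growth <= 5/8], and the margin below 1 pays for passing between the overlaps
    with and without the site. Mixed differences make the equation for the second moment close on
    itself: at [t = 0] the spin factor [E] is centred against anything that ignores the site, and it
    correlates only with pairs made of one of the replicas 1, 2 and one of 3, 4. The first
    derivative therefore involves [D] again and no other overlap moment. *)

Section gaussian_integrals.
Context {R : realType}.
Local Notation gauss := (normal_prob 0 1 : probability (measurableTypeR R) R).
Local Notation pdf := (normal_pdf (0 : R) 1).
Local Notation mu := (@lebesgue_measure R).

Local Lemma pdfE (x : R) : pdf x = normal_peak 1 * expR (- x ^+ 2 / 2).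
Proof. by rewrite normal_pdfE ?oner_neq0// /normal_fun subr0 expr1n. Qed.

(** A Radon-Nikodym derivative is determined only up to null sets; it agrees with the explicit
    density because both have integral [gauss E] over every measurable [E]. *)
Local Lemma ae_eq_gauss_density :
  ae_eq mu setT (Radon_Nikodym_SigmaFinite.f gauss mu) (EFin \o pdf).
Proof.
have dom : gauss `<< mu by exact: normal_prob_dominates.
apply: integral_ae_eq => //.
- exact: Radon_Nikodym_SigmaFinite.f_integrable.
- by apply/measurable_EFinP; exact: measurable_normal_pdf.
- by move=> E _ mE; rewrite -Radon_Nikodym_SigmaFinite.f_integral.
Qed.

Lemma ge0_integral_gauss (f : R -> R) : (forall x, 0 <= f x) ->
  measurable_fun setT f ->
  (\int[gauss]_x (f x)%:E = \int[mu]_x (f x * pdf x)%:E)%E.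
Proof.
move=> f0 mf; have dom : gauss `<< mu by exact: normal_prob_dominates.
have mEf : measurable_fun [set: measurableTypeR R] (EFin \o f) by exact/measurable_EFinP.
have Ef0 x : (0 <= (EFin \o f) x)%E by rewrite lee_fin.
rewrite -(@Radon_Nikodym_SigmaFinite.change_of_variables _ _ _ gauss mu dom
  (EFin \o f) setT Ef0 measurableT mEf).
apply: ae_eq_integral => //.
- apply: emeasurable_funM => //.
  exact: measurable_int (Radon_Nikodym_SigmaFinite.f_integrable dom).
- apply/measurable_EFinP; apply: measurable_funM => //.
  exact: measurable_normal_pdf.
- under [X in ae_eq _ _ _ X]eq_fun do rewrite EFinM.
  by apply: ae_eqe_mul2l; exact: ae_eq_gauss_density.
Qed.

Lemma integral_gauss (f : R -> R) : gauss.-integrable setT (EFin \o f) ->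
  (\int[gauss]_x (f x)%:E = \int[mu]_x (f x * pdf x)%:E)%E.
Proof.
move=> intf; have dom : gauss `<< mu by exact: normal_prob_dominates.
rewrite -(@Radon_Nikodym_change_of_variables _ _ _ gauss mu dom
  (EFin \o f) setT measurableT intf).
have mf := measurable_int _ intf.
apply: ae_eq_integral => //.
- apply: emeasurable_funM => //.
- under eq_fun do rewrite EFinM.
  apply: emeasurable_funM => //; apply/measurable_EFinP.
  exact: measurable_normal_pdf.
- under [X in ae_eq _ _ _ X]eq_fun do rewrite EFinM.
  apply: ae_eqe_mul2l; apply: ae_eq_trans ae_eq_gauss_density.
  by apply: ae_eq_sym; exact: ae_eq_Radon_Nikodym_SigmaFinite.
Qed.

(** Since [|x| <= 1 + x^2/4 <= expR (x^2/4)], the integrand is at most a constant times the normal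
    density of variance 2; [c] is the ratio of the two normalising peaks. *)
Lemma integrable_norm_pdf : mu.-integrable setT (fun x : R => (`|x| * pdf x)%:E).
Proof.
pose c := normal_peak (1 : R) / normal_peak (Num.sqrt 2 : R).
have s2 : Num.sqrt 2 != 0 :> R by rewrite gt_eqF// sqrtr_gt0.
have p2 : 0 < normal_peak (Num.sqrt 2 : R) by apply: normal_peak_gt0.
have p1 : 0 < normal_peak (1 : R) by apply: normal_peak_gt0; rewrite oner_neq0.
apply: (le_integrable measurableT _ _
  (integrableZl measurableT c (integrable_normal_pdf 0 (Num.sqrt (2 : R))))).
  apply/measurable_EFinP; apply: measurable_funM => //.
  exact: measurable_normal_pdf.
move=> x _; rewrite /= normrM ger0_norm ?normr_id ?normr_ge0 //.
rewrite (ger0_norm (normal_pdf_ge0 _ _ _)) pdfE lee_fin.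
rewrite [leRHS]ger0_norm; last by rewrite mulr_ge0 ?normal_pdf_ge0// divr_ge0 ?ltW.
rewrite normal_pdfE// /normal_fun subr0 sqr_sqrtr// /c [leRHS]mulrA divfK ?gt_eqF//.
rewrite mulrCA (ler_wpM2l (ltW p1))//.
have -> : - x ^+ 2 / 2 = - x ^+ 2 / (2 *+ 2) - x ^+ 2 / (2 *+ 2) :> R.
  by rewrite -mulr_natr; field.
rewrite expRD mulrCA -[leRHS]mulr1 ler_wpM2l ?expR_ge0//.
rewrite expRN ler_pdivrMr ?expR_gt0// mul1r.
apply: le_trans (expR_ge1Dx _).
have -> : x ^+ 2 / (2 *+ 2) = `|x| ^+ 2 / 4.
  by rewrite real_normK ?num_real// -mulr_natr; congr (_ / _); ring.
by have := sqr_ge0 (`|x| - 2); rewrite sqrrB; lra.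
Qed.

Lemma integrable_gauss_id : gauss.-integrable setT (EFin \o (@idfun R)).
Proof.
apply/integrableP; split; first by apply/measurable_EFinP; exact: measurable_id.
rewrite [ltLHS](_ : _ = \int[gauss]_x (`|x|%R)%:E)%E; last by [].
rewrite (@ge0_integral_gauss (fun x => `|x|))//.
have /integrableP[_] := integrable_norm_pdf.
apply: le_lt_trans; rewrite le_eqVlt; apply/orP; left; apply/eqP.
apply: eq_integral => x _; by rewrite /= normrM normr_id (ger0_norm (normal_pdf_ge0 _ _ _)).
Qed.

Lemma bounded_integrable d (T : measurableType d) (P : probability T R)
    (F : T -> R) (C : R) : measurable_fun setT F -> (forall w, `|F w| <= C) ->
  P.-integrable setT (EFin \o F).
Proof.
move=> mF FC; apply: (@le_integrable _ _ _ _ _ _ _ (cst C%:E)) => //.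
- exact/measurable_EFinP.
- by move=> x _; rewrite /= lee_fin (le_trans (FC x)) ?ler_norm.
- by apply: finite_measure_integrable_cst.
Qed.

Local Lemma is_derive_pdf (x : R) : is_derive x 1 pdf (- x * pdf x).
Proof.
rewrite (_ : pdf = fun x => normal_peak 1 * expR (- x ^+ 2 / 2)); last first.
  by apply/funext => y; rewrite pdfE.
apply: is_derive_eq; rewrite /GRing.scale/=; lra.
Qed.

(** Against the density, the integrand is minus the derivative of [G * pdf]. Over symmetric
    intervals only boundary values remain, and these tend to zero because [G] is bounded. *)
Lemma gauss_stein (G g : R -> R) (C : R) :
  (forall x : R, is_derive x 1 G (g x)) -> continuous g ->
  (forall x, `|G x| <= C) -> (forall x, `|g x| <= C) ->
  (\int[gauss]_y (y * G y - g y)%:E = 0)%E.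
Proof.
move=> dG cg GC gC.
have mG : measurable_fun [set: R] G.
  by apply: continuous_measurable_fun => x; apply/differentiable_continuous/derivable1_diffP.
have mg : measurable_fun [set: R] g by exact: continuous_measurable_fun.
have mpdf : measurable_fun [set: R] pdf by exact: measurable_normal_pdf.
have C0 : 0 <= C by apply: le_trans (GC 0).
have iyG : gauss.-integrable setT (EFin \o (fun y => y * G y)).
  apply: (le_integrable measurableT _ _ (integrableZl measurableT C integrable_gauss_id)).
    by apply/measurable_EFinP; apply: measurable_funM.
  move=> x _; rewrite /= lee_fin !normrM (ger0_norm C0) mulrC.
  by rewrite ler_wpM2r.
have ig : gauss.-integrable setT (EFin \o g) by apply: (@bounded_integrable _ (measurableTypeR R) gauss g C).
rewrite integral_gauss; last first.
  rewrite (_ : _ \o _ = (fun y => (y * G y)%:E - (g y)%:E)%E)//.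
  exact: integrableB.
pose k x := g x * pdf x - x * G x * pdf x.
pose H x := G x * pdf x.
have dH (x : R) : is_derive x 1 H (k x).
  have := is_derive_pdf x; have := dG x => d1 d2.
  by apply: is_derive_eq; rewrite /k /GRing.scale/=; lra.
have mk : measurable_fun [set: R] k.
  by apply: measurable_funB; repeat apply: measurable_funM.
have ipdf : mu.-integrable setT (EFin \o pdf) by exact: integrable_normal_pdf.
have igp : mu.-integrable setT (EFin \o (fun x => g x * pdf x)).
  apply: (le_integrable measurableT _ _ (integrableZl measurableT C ipdf)).
    by apply/measurable_EFinP; apply: measurable_funM.
  by move=> x _; rewrite /= lee_fin !normrM (ger0_norm C0) ler_wpM2r.
have ixGp : mu.-integrable setT (EFin \o (fun x => x * G x * pdf x)).
  apply: (le_integrable measurableT _ _ (integrableZl measurableT C integrable_norm_pdf)).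
    by apply/measurable_EFinP; apply: measurable_funM => //; apply: measurable_funM.
  move=> x _; rewrite /= lee_fin !normrM normr_id (ger0_norm C0) mulrA (mulrC C).
  by rewrite ler_wpM2r// ler_wpM2l.
have kE : EFin \o k = (fun x => (g x * pdf x)%:E - (x * G x * pdf x)%:E)%E by [].
have intk : mu.-integrable setT (EFin \o k) by rewrite kE; exact: integrableB.
have cH : continuous H.
  by move=> x; apply/differentiable_continuous/derivable1_diffP.
have ck : continuous k.
  have cG : continuous G.
    by move=> x; apply/differentiable_continuous/derivable1_diffP.
  have cpdf : continuous pdf by apply: continuous_normal_pdf; rewrite oner_neq0.
  move=> x; apply: cvgB; first by apply: cvgM; [exact: cg|exact: cpdf].
  by apply: cvgM; [apply: cvgM; [exact: cvg_id|exact: cG]|exact: cpdf].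
pose I n : set R := [set` `[- (n.+1%:R : R), n.+1%:R]].
have intn n : (\int[mu]_(x in I n) (k x)%:E =
    (H n.+1%:R - H (- n.+1%:R))%:E)%E.
  rewrite EFinB; apply: (@continuous_FTC2 R k H).
  - by rewrite -subr_gt0 opprK addr_gt0// ltr0n.
  - exact: continuous_subspaceT.
  - split; first by move=> x _.
    + exact/cvg_at_right_filter/cH.
    + exact/cvg_at_left_filter/cH.
  - by move=> x _; rewrite derive1E; apply: derive_val.
have cvg1 : (H n.+1%:R - H (- n.+1%:R)) @[n --> \oo] --> 0.
  pose c := 4 * C * normal_peak 1.
  have p0 : 0 <= normal_peak 1 :> R by exact: normal_peak_ge0.
  have cv : (c * (n.+1%:R)^-1) @[n --> \oo] --> 0.
    by rewrite -(mulr0 c); apply: cvgM; [exact: cvg_cst|exact: cvg_harmonic].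
  apply: norm_cvg0; apply: (squeeze_cvgr _ (@cvg_cst _ _ _ _ _) cv).
  near=> n; rewrite normr_ge0/= (le_trans (ler_normB _ _))//.
  have bd (x : R) : x ^+ 2 = n.+1%:R ^+ 2 -> `|H x| <= 2 * C * normal_peak 1 / n.+1%:R.
    move=> xn; rewrite normrM (ger0_norm (normal_pdf_ge0 _ _ _)) pdfE xn.
    have := GC x => GCx.
    (* A decay of order [1/n] is enough, and it follows from [1 + x <= expR x]. *)
    have e1 : expR (- n.+1%:R ^+ 2 / 2) <= 2 / n.+1%:R :> R.
      rewrite mulNr expRN ler_pdivlMr ?ltr0n// mulrC ler_pdivrMr ?expR_gt0//.
      rewrite -ler_pdivrMl// (le_trans _ (expR_ge1Dx _))//.
      by move: (n.+1%:R : R) => m; have := sqr_ge0 (m - 1); nra.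
    rewrite (_ : 2 * C * _ / _ = C * (normal_peak 1 * (2 / n.+1%:R))); last by ring.
    by apply: ler_pM => //; [rewrite mulr_ge0// expR_ge0|rewrite ler_wpM2l].
  rewrite (_ : c / _ = 2 * C * normal_peak 1 / n.+1%:R + 2 * C * normal_peak 1 / n.+1%:R).
    by rewrite lerD// bd// sqrrN.
  by rewrite /c; ring.
have cvg2 : (\int[mu]_(x in I n) (k x)%:E)%E @[n --> \oo]
    --> (\int[mu]_x (k x)%:E)%E.
  under eq_fun do rewrite integral_mkcond.
  have mEk := measurable_int _ intk.
  have mI n : measurable (I n) by exact: measurable_itv.
  have [] // := @dominated_convergence _ _ _ mu setT measurableT
    (fun n => (EFin \o k) \_ (I n)) (EFin \o k) (abse \o (EFin \o k)).
  - by move=> n; apply: (measurable_restrictT _ (mI n)).1; exact: (measurable_funS measurableT).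
  - apply: aeW => x _; apply: cvg_near_cst; near=> n.
    rewrite /patch mem_set// /I/= in_itv/= -ler_norml.
    near: n; have [N _ HN] := @nbhs_infty_gtr R `|x|.
    by exists N => // n /= Nn; rewrite (le_trans (ltW (HN n Nn)))// ler_nat.
  - exact: integrable_abse.
  - apply: aeW => x n _; rewrite /patch; case: ifP => _; first exact: lexx.
    by rewrite /= normr0 lee_fin.
have intk0 : (\int[mu]_x (k x)%:E = 0)%E.
  apply: (cvg_unique _ cvg2) => //.
  rewrite (_ : (fun n => _) = (fun n => (H n.+1%:R - H (- n.+1%:R))%:E)); last first.
    by apply/funext => n; rewrite intn.
  by apply: cvg_EFin; [exact: nearW|exact: cvg1].
transitivity (\int[mu]_y ((-1)%:E * (k y)%:E))%E.
  by apply: eq_integral => y _; rewrite -EFinM; congr EFin; rewrite /k; ring.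
by rewrite integralZl// intk0 mule0.
Unshelve. all: by end_near. Qed.

End gaussian_integrals.

(** * Laws of finite Gaussian families *)

Definition rectangles {R : realType} {J : finType} : set (set (J -> R)) :=
  [set A | exists2 B : J -> set R, (forall j, measurable (B j)) &
     A = [set x | forall j, B j (x j)]].

Notation cyl R J := (g_sigma_algebraType (@rectangles R J)).

Section cylinders.
Context {R : realType} {J : finType}.
Local Notation cyl := (cyl R J).

Lemma measurable_cyl d (T : measurableType d) (f : T -> cyl) :
  (forall j, measurable_fun setT (fun w => f w j)) -> measurable_fun setT f.
Proof.
move=> mf; have H := @measurability _ _ T cyl setT f rectangles; apply: H => //.
move=> _ [_ [B mB ->] <-].
rewrite setTI (_ : f @^-1` _ = \bigcap_(j in setT) ((fun w => f w j) @^-1` B j)).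
  apply: fin_bigcap_measurable => [|j _]; first exact: finite_finset.
  by rewrite -[X in measurable X]setTI; exact: mf.
by apply/seteqP; split => [w /= fB j _|w /= fB j]; exact: fB.
Qed.

Lemma measurable_coord (j : J) : measurable_fun setT (fun x : cyl => x j).
Proof.
move=> _ A mA; rewrite setTI; apply: sub_sigma_algebra.
exists (fun k => if k == j then A else setT).
  by move=> k; case: ifP.
apply/seteqP; split => [x /= Ax k|x /= /(_ j)]; last by rewrite eqxx.
by case: ifP => // /eqP ->.
Qed.

Lemma rectangles_setI : setI_closed (@rectangles R J).
Proof.
move=> _ _ [B mB ->] [C mC ->]; exists (fun j => B j `&` C j).
  by move=> j; exact: measurableI.
apply/seteqP; split => [x [/= h1 h2] j|x /= h]; first by split.
by split => j; have [] := h j.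
Qed.

Section eq_law.
Context d1 d2 (T1 : measurableType d1) (T2 : measurableType d2).
Context (P1 : probability T1 R) (P2 : probability T2 R).
Variables (f1 : T1 -> cyl) (f2 : T2 -> cyl).
Hypotheses (mf1 : measurable_fun setT f1) (mf2 : measurable_fun setT f2).
Hypothesis f12 : forall A, rectangles A -> P1 (f1 @^-1` A) = P2 (f2 @^-1` A).

Let f1' : {mfun T1 >-> cyl} := HB.pack f1 (isMeasurableFun.Build _ _ _ _ f1 mf1).
Let f2' : {mfun T2 >-> cyl} := HB.pack f2 (isMeasurableFun.Build _ _ _ _ f2 mf2).

(** Full rectangles are stable under intersection and generate the sigma-algebra of [cyl], so two
    laws that agree on them agree everywhere. Resampling a coordinate is thereby reduced to a
    computation on rectangles. *)
Lemma eq_law A : measurable A -> distribution P1 f1' A = distribution P2 f2' A.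
Proof.
have rT : rectangles ([set: J -> R]) by exists (fun=> setT) => //; apply/seteqP; split.
have cvT : \bigcup_(k in [set: nat]) [set: J -> R] = setT.
  by apply/seteqP; split => // x _; exists 0%N.
have m12 A' : rectangles A' -> distribution P1 f1' A' = distribution P2 f2' A' by exact: f12.
have fin (k : nat) : (distribution P1 f1' setT < +oo)%E by rewrite probability_setT ltry.
exact: (@measure_unique _ R cyl rectangles (fun=> setT) erefl rectangles_setI
  (fun=> rT) cvT _ _ m12 fin).
Qed.

Lemma eq_law_integrable (F : cyl -> \bar R) : measurable_fun setT F ->
  P1.-integrable setT (F \o f1) -> P2.-integrable setT (F \o f2).
Proof.
move=> mF /integrableP[_ i1]; apply/integrableP; split; first exact: measurableT_comp.
apply: le_lt_trans i1; rewrite le_eqVlt; apply/orP; left; apply/eqP.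
have mF' : measurable_fun setT (abse \o F) by exact: measurableT_comp.
have F0 : {in setT, forall y, (0 <= (abse \o F) y)%E} by move=> y _; exact: abse_ge0.
have := ge0_integral_pushforward mf1 P1 measurableT mF' F0.
have := ge0_integral_pushforward mf2 P2 measurableT mF' F0.
rewrite !preimage_setT => <- <-.
apply: (@eq_measure_integral _ _ _ _ (distribution P1 f1') (distribution P2 f2')).
by move=> A mA _; apply: esym; exact: eq_law.
Qed.

Lemma eq_law_integral (F : cyl -> \bar R) : measurable_fun setT F ->
  P1.-integrable setT (F \o f1) ->
  (\int[P1]_w F (f1 w) = \int[P2]_w F (f2 w))%E.
Proof.
move=> mF iF1; have iF2 := eq_law_integrable mF iF1.
have := integral_pushforward mf1 mF iF1 measurableT; rewrite preimage_setT => <-.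
have := integral_pushforward mf2 mF iF2 measurableT; rewrite preimage_setT => <-.
apply: (@eq_measure_integral _ _ _ _ (distribution P2 f2') (distribution P1 f1')).
by move=> A mA _; exact: eq_law.
Qed.

End eq_law.
End cylinders.

Definition upd {R : realType} {J : finType} (x : J -> R) (j : J) (y : R) : J -> R :=
  fun k => if k == j then y else x k.

Section iid_gaussian.
Context {R : realType}.
Local Notation gauss := (normal_prob 0 1 : probability (measurableTypeR R) R).

Lemma gauss_law_integrable d (T : measurableType d) (P : probability T R)
    (f : T -> measurableTypeR R) : measurable_fun setT f ->
  (forall A, measurable A -> P (f @^-1` A) = gauss A) ->
  P.-integrable setT (EFin \o f).
Proof.
move=> mf lawf; pose f' : {mfun T >-> measurableTypeR R} :=
  HB.pack f (isMeasurableFun.Build _ _ _ _ f mf).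
have /integrableP[_ gid] := @integrable_gauss_id R.
apply/integrableP; split; first exact/measurable_EFinP.
apply: le_lt_trans gid; rewrite le_eqVlt; apply/orP; left; apply/eqP.
have mF' : measurable_fun [set: measurableTypeR R] (abse \o (EFin \o @idfun R)).
  by apply: measurableT_comp => //; apply/measurable_EFinP; exact: measurable_id.
have F0 : {in [set: measurableTypeR R], forall y, (0 <= (abse \o (EFin \o @idfun R)) y)%E}.
  by move=> y _; exact: abse_ge0.
have := ge0_integral_pushforward mf P measurableT mF' F0.
rewrite preimage_setT => <-.
apply: (@eq_measure_integral _ _ _ _ gauss (distribution P f')).
by move=> A mA _; exact: lawf.
Qed.

(** Independence and Gaussian marginals are stated together as a product formula on full rectangles,
    the pi-system on which laws are compared; a marginal is read off by taking [setT] in the other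
    coordinates. *)
Definition iid_gaussian d (T : measurableType d) (P : probability T R) (J : finType)
    (xi : T -> cyl R J) :=
  (forall j, measurable_fun setT (fun w => xi w j)) /\
  (forall B : J -> set R, (forall j, measurable (B j)) ->
     P [set w | forall j, B j (xi w j)] = (\prod_j gauss (B j))%E).

Context d (T : measurableType d) (P : probability T R) (J : finType).
Variable xi : T -> cyl R J.
Hypothesis xiG : iid_gaussian P xi.

Lemma measurable_iid : measurable_fun setT xi.
Proof. by apply: measurable_cyl; exact: xiG.1. Qed.

Lemma measurable_resample (j : J) :
  measurable_fun setT
    (fun z : T * measurableTypeR R => upd (xi z.1) j z.2 : cyl R J).
Proof.
apply: measurable_cyl => k; rewrite /upd; case: (k == j); first exact: measurable_snd.
exact: (measurableT_comp (xiG.1 k) measurable_fst).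
Qed.

(** The coordinate [j] is first freed by replacing [B j] with [setT]; its factor [gauss (B j)] then
    comes back from the independent copy. *)
Lemma resample_law (j : J) A : rectangles A ->
  P (xi @^-1` A) = (P \x gauss)%E
    ((fun z : T * measurableTypeR R => upd (xi z.1) j z.2 : cyl R J) @^-1` A).
Proof.
move=> [B mB ->].
rewrite [LHS](xiG.2 B mB).
pose B' k := if k == j then setT else B k.
have mB' k : measurable (B' k) by rewrite /B'; case: ifP.
rewrite (_ : _ @^-1` _ = [set w | forall k, B' k (xi w k)] `*` B j); last first.
  apply/seteqP; split => [[w y] /= h|[w y] /= [h hj] k].
    split; last by have := h j; rewrite /upd eqxx.
    by move=> k; rewrite /B'; case: eqP => // /eqP kj; have := h k; rewrite /upd (negbTE kj).
  by rewrite /upd; case: eqP => [->//|/eqP kj]; have := h k; rewrite /B' (negbTE kj).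
have mA : measurable ([set x | forall k, B' k (x k)] : set (cyl R J)).
  by apply: sub_sigma_algebra; exists B'.
have mA' : measurable [set w | forall k, B' k (xi w k)].
  by have := measurable_iid measurableT mA; rewrite setTI.
have -> := @product_measure1E _ _ _ _ R P gauss _ _ mA' (mB j).
transitivity ((\prod_k gauss (B' k)) * gauss (B j))%E; last first.
  by congr (_ * _)%E; exact: esym (xiG.2 B' mB').
have BT : B' j = setT by rewrite /B' eqxx.
rewrite (bigD1 j)//= [in RHS](bigD1 j)//= BT probability_setT mul1e.
rewrite muleC; congr (_ * _)%E.
by apply: eq_bigr => k kj; rewrite /B' (negbTE kj).
Qed.

Lemma iid_coord_integrable (j : J) : P.-integrable setT (EFin \o (fun w => xi w j)).
Proof.
apply: (gauss_law_integrable (xiG.1 j)) => A mA.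
rewrite (_ : _ @^-1` _ = [set w | forall k, (if k == j then A else setT) (xi w k)]).
  have mA' k : measurable (if k == j then A else setT) by case: ifP.
  rewrite [LHS](xiG.2 _ mA') (bigD1 j)//= eqxx big1 ?mule1// => k /negbTE ->.
  exact: probability_setT.
apply/seteqP; split => [w /= Aw k|w /= /(_ j)]; last by rewrite eqxx.
by case: eqP => // ->.
Qed.

(* Integration by parts on the coordinate [j]: resampling it independently of the
   others does not change the law, so one-dimensional Stein applies for fixed [w]. *)
Lemma iid_stein (j : J) (F dF : (J -> R) -> R) (C : R) :
  measurable_fun setT (F : cyl R J -> R) -> measurable_fun setT (dF : cyl R J -> R) ->
  (forall x (y : R), is_derive y 1 (fun y => F (upd x j y)) (dF (upd x j y))) ->
  (forall x, continuous (fun y : R => dF (upd x j y))) ->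
  (forall x, `|F x| <= C) -> (forall x, `|dF x| <= C) ->
  \int[P]_w (xi w j * F (xi w)) = \int[P]_w dF (xi w).
Proof.
move=> mF mdF DF cdF FC dFC.
have C0 : 0 <= C by apply: le_trans (FC (fun=> 0)).
have mxi : measurable_fun setT xi := measurable_iid.
have iF : P.-integrable setT (EFin \o (fun w => xi w j * F (xi w))).
  apply: (le_integrable measurableT _ _ (integrableZl measurableT C (iid_coord_integrable j))).
    apply/measurable_EFinP; apply: measurable_funM; first exact: xiG.1.
    exact: (measurableT_comp mF mxi).
  move=> w _; rewrite /= lee_fin !normrM mulrC (ger0_norm C0).
  by rewrite ler_wpM2r.
have idF : P.-integrable setT (EFin \o (fun w => dF (xi w))).
  by apply: (bounded_integrable P (measurableT_comp mdF mxi) (C := C)) => w; exact: dFC.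
pose H (x : cyl R J) := x j * F x - dF x.
have mH : measurable_fun setT (EFin \o H).
  apply/measurable_EFinP; apply: measurable_funB => //.
  by apply: measurable_funM => //; exact: measurable_coord.
have iH : P.-integrable setT ((EFin \o H) \o xi).
  rewrite (_ : _ \o _ = (fun w => (xi w j * F (xi w))%:E - (dF (xi w))%:E)%E)//.
  exact: integrableB.
have iH2 := eq_law_integrable mxi (measurable_resample j) (resample_law j) mH iH.
have := eq_law_integral mxi (measurable_resample j) (resample_law j) mH iH.
rewrite -(integral12_prod_meas1 iH2) /= => e.
apply/eqP; rewrite -subr_eq0; apply/eqP; rewrite -RintegralB//.
rewrite /Rintegral e (_ : 0 = fine 0%E)//; congr fine.
rewrite -[RHS](integral0 P setT); apply: eq_integral => w _.
rewrite /fubini_F /=.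
rewrite -[RHS](gauss_stein (DF (xi w)) (cdF (xi w)) (fun y => FC _) (fun y => dFC _)).
by apply: eq_integral => y _; rewrite /H {1}/upd eqxx.
Qed.

End iid_gaussian.

(** * Gibbs averages of replicas *)

Section restriction.
Context {R : realType} {S L L' : finType}.
Variables (iota : L -> L') (iota_inj : injective iota).

Definition restr (s : {ffun L' -> S}) : {ffun L -> S} := [ffun l => s (iota l)].

(** Fixing the restriction [u] constrains each coordinate separately: those in the image of [iota]
    are determined, consistently by injectivity, and the others run freely. Distributivity then
    factors the sum. *)
Lemma sum_restr (f : {ffun L -> S} -> R) (G : L' -> S -> R) :
  \sum_s f (restr s) * \prod_l G l (s l) =
  (\sum_u f u * \prod_l G (iota l) (u l)) *
  \prod_(l | l \notin codom iota) \sum_x G l x.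
Proof.
rewrite (partition_big restr predT)//= mulr_suml; apply: eq_bigr => u _.
pose Q l' := [pred x | [forall l, (iota l == l') ==> (x == u l)]].
rewrite (eq_bigl (fun s => s \in family Q)); last first.
  move=> s; apply/eqP/familyP => [e l'|Qs].
    by rewrite inE /= -e; apply/forallP => l; apply/implyP => /eqP <-; rewrite ffunE.
  apply/ffunP => l; rewrite ffunE; apply/eqP.
  by have /forallP/(_ l) := Qs (iota l); rewrite eqxx.
rewrite (eq_bigr (fun s : {ffun L' -> S} => f u * \prod_l G l (s l))); last first.
  move=> s /familyP Qs; congr (f _ * _).
  apply/ffunP => l; rewrite ffunE; apply/eqP.
  by have /forallP/(_ l) := Qs (iota l); rewrite eqxx.
rewrite -mulr_sumr -mulrA; congr (_ * _).
rewrite -bigA_distr_big_dep (bigID (fun l => l \in codom iota))/=; congr (_ * _).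
  rewrite (eq_bigl (fun l => l \in [set iota l | l in [set: L]]))%SET; last first.
    move=> l; apply/codomP/imsetP => [[k ->]|[k _ ->]]; last by exists k.
    by exists k; rewrite ?inE.
  rewrite big_imset/=; last by move=> x y _ _; exact: iota_inj.
  apply: eq_big => [l|l _]; first by rewrite inE.
  rewrite (big_pred1 (u l))// => x; rewrite /=; apply/forallP/eqP => [/(_ l)|-> k].
    by rewrite eqxx => /eqP.
  by apply/implyP => /eqP/iota_inj ->.
apply: eq_bigr => l' l'N; apply: eq_bigl => x; apply/forallP => l.
by apply/implyP => /eqP e; move: l'N; rewrite -e codom_f.
Qed.

End restriction.

Section gibbs_average.
Context {R : realType} {S : finType}.
Implicit Types (X A : S -> R).

Definition log_partition X : R := ln (\sum_x expR (X x)).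

(** The Gibbs weight is kept as one exponential of [X - ln Z] rather than a quotient, so that a
    product over replicas is again a single exponential, easy to differentiate and to measure. *)
Definition weight X (s : S) : R := expR (X s - log_partition X).

Definition avg (L : finType) X (f : {ffun L -> S} -> R) : R :=
  \sum_s f s * \prod_l weight X (s l).

Variable (s0 : S).

Lemma partition_gt0 X : 0 < \sum_x expR (X x).
Proof.
rewrite (bigD1 s0)//= ltr_pwDl ?expR_gt0//.
by apply: sumr_ge0 => x _; exact: expR_ge0.
Qed.

Lemma weightE X s : weight X s = expR (X s) / \sum_x expR (X x).
Proof. by rewrite /weight expRD expRN lnK// posrE partition_gt0. Qed.

Lemma weight_ge0 X s : 0 <= weight X s. Proof. exact: expR_ge0. Qed.

Lemma sum_weight X : \sum_s weight X s = 1.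
Proof.
under eq_bigr do rewrite weightE.
by rewrite -mulr_suml divff// gt_eqF// partition_gt0.
Qed.

Lemma prod_weightE (L : finType) X (s : {ffun L -> S}) :
  \prod_l weight X (s l) = expR (\sum_l X (s l) - #|L|%:R * log_partition X).
Proof.
by rewrite -expR_sum sumrB sumr_const mulr_natl.
Qed.

Lemma avg_gibbsE (L : finType) X (f : {ffun L -> S} -> R) :
  avg X f = (\sum_x expR (X x)) ^- #|L| * \sum_s f s * expR (\sum_l X (s l)).
Proof.
rewrite /avg mulr_sumr; apply: eq_bigr => s _; rewrite prod_weightE mulrCA.
congr (_ * _); rewrite expRB mulrC; congr (_ * _).
by rewrite expRM_natl lnK// posrE partition_gt0.
Qed.

Section linearity.
Context {L : finType}.
Implicit Types f g : {ffun L -> S} -> R.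

Lemma avgD X f g : avg X (fun s => f s + g s) = avg X f + avg X g.
Proof. by rewrite /avg -big_split; apply: eq_bigr => s _; rewrite mulrDl. Qed.

Lemma avgZ X c f : avg X (fun s => c * f s) = c * avg X f.
Proof. by rewrite /avg mulr_sumr; apply: eq_bigr => s _; rewrite mulrA. Qed.

Lemma avgB X f g : avg X (fun s => f s - g s) = avg X f - avg X g.
Proof. by rewrite /avg -sumrB; apply: eq_bigr => s _; rewrite mulrBl. Qed.

Lemma avg_sum X (I : finType) (f : I -> {ffun L -> S} -> R) :
  avg X (fun s => \sum_i f i s) = \sum_i avg X (f i).
Proof.
by rewrite /avg exchange_big; apply: eq_bigr => s _; rewrite mulr_suml.
Qed.

Lemma avg_le X f g : (forall s, f s <= g s) -> avg X f <= avg X g.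
Proof.
move=> fg; apply: ler_sum => s _; rewrite ler_wpM2r//.
by apply: prodr_ge0 => l _; exact: weight_ge0.
Qed.

Lemma avg_cst X c : avg X (fun _ : {ffun L -> S} => c) = c.
Proof.
rewrite /avg -mulr_sumr -(bigA_distr_bigA (fun=> weight X)) big1 ?mulr1// => l _.
exact: sum_weight.
Qed.

Lemma avg_norm X f C : (forall s, `|f s| <= C) -> `|avg X f| <= C.
Proof.
move=> fC; rewrite ler_norml -[- C](avg_cst X) -[C in _ && (_ <= C)](avg_cst X).
by apply/andP; split; apply: avg_le => s; have := fC s; rewrite ler_norml => /andP[].
Qed.

End linearity.

Lemma avg_restr (L L' : finType) (iota : L -> L') X (f : {ffun L -> S} -> R) :
  injective iota -> avg X (fun s => f (restr iota s)) = avg X f.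
Proof.
move=> iota_inj; rewrite /avg (sum_restr iota_inj f (fun=> weight X)).
by rewrite [X in _ * X]big1 ?mulr1// => l _; exact: sum_weight.
Qed.

(** The derivative of a Gibbs average in the direction [A]. Differentiating the normalisation
    subtracts [#|L|] times the mean of [A]; this mean is realised by a fresh replica [None], so that
    the derivative is again an average of a function of replicas. *)
Definition tilt (L : finType) A (f : {ffun L -> S} -> R) (s : {ffun option L -> S}) : R :=
  f (restr Some s) * (\sum_l A (s (Some l)) - #|L|%:R * A (s None)).

Lemma avg_tilt (L : finType) A X (f : {ffun L -> S} -> R) :
  avg X (tilt A f) = \sum_s (f s * \prod_l weight X (s l)) *
     (\sum_l A (s l) - #|L|%:R * \sum_x A x * weight X x).
Proof.
have someI : injective (@Some L) by move=> ? ? [].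
transitivity (avg X (fun s : {ffun option L -> S} =>
    (fun u => f u * \sum_l A (u l)) (restr Some s)) -
  #|L|%:R * avg X (fun s : {ffun option L -> S} => f (restr Some s) * A (s None))).
  rewrite -avgZ -avgB; apply: eq_bigr => s _; congr (_ * _).
  rewrite /tilt mulrBr; congr (_ * _ - _); last by rewrite mulrCA.
  by apply: eq_bigr => l _; rewrite ffunE.
rewrite (avg_restr X (fun u => f u * \sum_l A (u l)) someI).
pose G (o : option L) x := if o is Some _ then weight X x else A x * weight X x.
have -> : avg X (fun s : {ffun option L -> S} => f (restr Some s) * A (s None)) =
    \sum_s f (restr Some s) * \prod_l G l (s l).
  apply: eq_bigr => s _; rewrite -mulrA; congr (_ * _).
  by rewrite (bigD1 None)//= [in RHS](bigD1 None)//= mulrA; congr (_ * _);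
    apply: eq_bigr => -[].
rewrite (sum_restr someI) (big_pred1 None); last first.
  move=> o; apply/idP/eqP => [|->]; last by apply/negP => /codomP[].
  by case: o => // l; rewrite codom_f.
rewrite /G /avg mulr_suml mulr_sumr -sumrB.
apply: eq_bigr => s _; rewrite mulrBr; congr (_ - _); last by ring.
by rewrite -!mulrA; congr (_ * _); rewrite mulrC.
Qed.

End gibbs_average.

Lemma is_derive_bigsum (R : realType) (I : Type) (r : seq I) (F : I -> R -> R)
    (dF : I -> R) (t : R) : (forall i, is_derive t 1 (F i) (dF i)) ->
  is_derive t 1 (fun x => \sum_(i <- r) F i x) (\sum_(i <- r) dF i).
Proof.
move=> DF; elim: r => [|i r IH].
  rewrite big_nil.
  have -> : (fun x => \sum_(i <- [::]) F i x) = cst 0.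
    by apply/funext => x; rewrite big_nil.
  exact: is_derive_cst.
rewrite big_cons.
have -> : (fun x => \sum_(j <- i :: r) F j x) = F i + (fun x => \sum_(j <- r) F j x).
  by apply/funext => x; rewrite big_cons.
exact: is_deriveD.
Qed.

Lemma continuous_bigsum (R : realType) (I : Type) (r : seq I) (F : I -> R -> R) (t : R) :
  (forall i, {for t, continuous (F i)}) ->
  {for t, continuous (fun x => \sum_(i <- r) F i x)}.
Proof.
move=> cF; elim: r => [|i r IH].
  have -> : (fun x => \sum_(i <- [::]) F i x) = cst 0.
    by apply/funext => x; rewrite big_nil.
  exact: cst_continuous.
have -> : (fun x => \sum_(j <- i :: r) F j x) = (fun x => F i x + \sum_(j <- r) F j x).
  by apply/funext => x; rewrite big_cons.
by apply: continuousD; [exact: cF|exact: IH].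
Qed.

Section avg_analysis.
Context {R : realType} {S L : finType} (s0 : S).
Implicit Types (f : {ffun L -> S} -> R).

Lemma avgE X f : avg X f =
  \sum_s f s * expR (\sum_l X (s l) - #|L|%:R * ln (\sum_x expR (X x))) :> R.
Proof. by apply: eq_bigr => s _; rewrite prod_weightE. Qed.

Lemma is_derive_avg (X : R -> S -> R) (dX : S -> R) (t : R) f :
  (forall s, is_derive t 1 (X ^~ s) (dX s)) ->
  is_derive t 1 (fun x => avg (X x) f) (avg (X t) (tilt dX f)).
Proof.
move=> DX; rewrite (avg_tilt s0).
have -> : (fun x => avg (X x) f) = (fun x => \sum_s f s *
    expR (\sum_l X x (s l) - #|L|%:R * ln (\sum_y expR (X x y)))).
  by apply/funext => x; exact: avgE.
pose Z x := \sum_y expR (X x y).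
have DZ : is_derive t 1 Z (\sum_y dX y * expR (X t y)).
  apply: is_derive_bigsum => y; have := DX y => DXy.
  by apply: is_derive_eq; rewrite /GRing.scale/= mulrC.
have Z0 : 0 < Z t by exact: partition_gt0.
have DlnZ : is_derive t 1 (fun x => ln (Z x)) (\sum_x dX x * weight (X t) x).
  have Dln := is_derive1_ln Z0.
  have := is_derive1_comp Dln DZ => D; apply: (is_derive_eq D).
  rewrite /GRing.scale/= mulrC mulr_suml; apply: eq_bigr => y _.
  by rewrite (weightE s0) mulrA.
apply: is_derive_bigsum => s.
have Dsum : is_derive t 1 (fun x => \sum_l X x (s l)) (\sum_l dX (s l)).
  by apply: is_derive_bigsum => l; exact: DX.
apply: is_derive_eq.
rewrite /GRing.scale/= prod_weightE /log_partition -/(Z t); ring.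
Qed.

Lemma continuous_avg (X : R -> S -> R) (t : R) f :
  (forall s, {for t, continuous (X ^~ s)}) ->
  {for t, continuous (fun x => avg (X x) f)}.
Proof.
move=> cX; have -> : (fun x => avg (X x) f) = (fun x => \sum_s f s *
    expR (\sum_l X x (s l) - #|L|%:R * ln (\sum_y expR (X x y)))).
  by apply/funext => x; exact: avgE.
apply: continuous_bigsum => s; apply: continuousM; first exact: cst_continuous.
apply: continuous_comp; last exact: continuous_expR.
apply: continuousB; first by apply: continuous_bigsum => l; exact: cX.
apply: continuousM; first exact: cst_continuous.
apply: continuous_comp; last by apply: continuous_ln; exact: partition_gt0.
apply: continuous_bigsum => y; apply: continuous_comp; first exact: cX.
exact: continuous_expR.
Qed.

Lemma measurable_avg d (T : measurableType d) (X : T -> S -> R) f :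
  (forall s, measurable_fun setT (X ^~ s)) ->
  measurable_fun setT (fun w => avg (X w) f).
Proof.
move=> mX; have -> : (fun x => avg (X x) f) = (fun x => \sum_s f s *
    expR (\sum_l X x (s l) - #|L|%:R * ln (\sum_y expR (X x y)))).
  by apply/funext => x; exact: avgE.
apply: measurable_sum => s; apply: measurable_funM => //.
apply: measurableT_comp => //; apply: measurable_funB.
  by apply: measurable_sum => l; exact: mX.
apply: measurable_funM => //; apply: measurableT_comp => //.
by apply: measurable_sum => y; exact: measurableT_comp.
Qed.

End avg_analysis.

Lemma finfun_bounded (R : realType) (I : finType) (f : I -> R) (i : I) :
  `|f i| <= \sum_j `|f j|.
Proof. by rewrite (bigD1 i)//= lerDl sumr_ge0. Qed.

Section Rintegral_bigsum.
Context {R : realType} d (T : measurableType d) (P : probability T R) (I : Type).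
Variable (F : I -> T -> R).
Hypothesis intF : forall i, P.-integrable setT (EFin \o F i).

Lemma integrable_bigsum (r : seq I) :
  P.-integrable setT (EFin \o (fun w => \sum_(i <- r) F i w)).
Proof.
elim: r => [|i r IH].
  rewrite (_ : _ \o _ = cst 0%E); first exact: integrable0.
  by apply/funext => w; rewrite /= big_nil.
rewrite (_ : _ \o _ = (fun w => (F i w)%:E + (\sum_(i <- r) F i w)%:E)%E).
  by apply: integrableD => //; exact: intF.
by apply/funext => w; rewrite /= big_cons.
Qed.

Lemma Rintegral_bigsum (r : seq I) :
  \int[P]_w (\sum_(i <- r) F i w) = \sum_(i <- r) \int[P]_w F i w.
Proof.
elim: r => [|i r IH].
  rewrite big_nil; under eq_Rintegral do rewrite big_nil.
  by rewrite Rintegral_cst// mul0r.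
rewrite big_cons -IH -RintegralD//; last exact: integrable_bigsum.
by apply: eq_Rintegral => w _; rewrite big_cons.
Qed.

End Rintegral_bigsum.

Section tilt_linear.
Context {R : realType} {S L : finType} (s0 : S).
Implicit Types (f : {ffun L -> S} -> R).

Lemma avg_tilt_sum (J : finType) (X : S -> R) (b : J -> R) (A : J -> S -> R) f :
  avg X (tilt (fun s => \sum_j b j * A j s) f) = \sum_j b j * avg X (tilt (A j) f).
Proof.
rewrite -[RHS](eq_bigr _ (fun j _ => avgZ X (b j) (tilt (A j) f))) -avg_sum.
apply: eq_bigr => s _; congr (_ * _).
rewrite /tilt.
have -> : \sum_j b j * (f (restr Some s) *
    (\sum_l A j (s (Some l)) - #|L|%:R * A j (s None))) = f (restr Some s) *
    \sum_j b j * (\sum_l A j (s (Some l)) - #|L|%:R * A j (s None)).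
  by rewrite mulr_sumr; apply: eq_bigr => j _; ring.
congr (_ * _); under [RHS]eq_bigr do rewrite mulrBr.
rewrite sumrB; congr (_ - _).
  by rewrite exchange_big; apply: eq_bigr => j _; rewrite mulr_sumr.
by rewrite mulr_sumr; apply: eq_bigr => j _; ring.
Qed.

Lemma avg_tiltZ (X : S -> R) (b : R) (A : S -> R) f :
  avg X (tilt (fun s => b * A s) f) = b * avg X (tilt A f).
Proof.
rewrite -avgZ; apply: eq_bigr => s _; congr (_ * _).
by rewrite /tilt -mulr_sumr; ring.
Qed.

End tilt_linear.

(** * Interpolation along a path of Gaussian fields *)

Section interpolation.
Context {R : realType} d (T : measurableType d) (Q : probability T R).
Context (J : finType) (xi : T -> cyl R J) (xiG : iid_gaussian Q xi).
Context (S : finType) (s0 : S) (A : J -> S -> R) (B : S -> R).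

(* The variable [xi j] is kept fixed, switched on or switched off along the path
   according to [dir j]. *)
Variable dir : J -> option bool.

(** Square roots make the variances [t] and [1 - t] linear in time, which leaves the generator below
    without explicit dependence on [t]. *)
Definition coef (t : R) (j : J) : R :=
  if dir j is Some b then Num.sqrt (if b then t else 1 - t) else 1.

Definition path_field (t : R) (x : J -> R) (s : S) : R :=
  \sum_j x j * (coef t j * A j s) + B s.

Definition nu_path (t : R) (L : finType) (f : {ffun L -> S} -> R) : R :=
  \int[Q]_w avg (path_field t (xi w)) f.

Definition dir_sign (j : J) : R := if dir j is Some b then (-1) ^+ ~~ b else 0.

Definition dcoef (t : R) (j : J) : R := dir_sign j / (2 * coef t j).

Lemma is_derive_coef (t : R) j : 0 < t < 1 -> is_derive t 1 (coef ^~ j) (dcoef t j).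
Proof.
case/andP => t0 t1; rewrite /dcoef /dir_sign /coef; case: (dir j) => [[]|].
- by have D := is_derive1_sqrt t0; apply: (is_derive_eq D); rewrite /= expr0 mul1r.
- have t1' : 0 < 1 - t by rewrite subr_gt0.
  have D := is_derive1_sqrt t1'.
  have D1 : is_derive t 1 (fun x : R => 1 - x) (- 1).
    by apply: is_derive_eq; rewrite add0r mul1r.
  have D2 := @is_derive1_comp R Num.sqrt (fun x => 1 - x) t _ _ D D1; apply: (is_derive_eq D2).
  by rewrite /GRing.scale/= expr1 mulN1r mulrN1.
- by rewrite mul0r; exact: is_derive_cst.
Qed.

Lemma continuous_coef j : continuous (coef ^~ j).
Proof.
move=> t; rewrite /coef; case: (dir j) => [[]|].
- exact: sqrt_continuous.
- apply: (@continuous_comp _ _ _ (fun x : R => 1 - x) Num.sqrt); last exact: sqrt_continuous.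
  by apply: continuousB; [exact: cst_continuous|exact: cvg_id].
- exact: cst_continuous.
Qed.

(** The factor [coef] produced by integration by parts cancels the singular [1 / coef] of the
    derivative, leaving a constant. *)
Lemma coef_dcoef t j : 0 < t < 1 -> coef t j * dcoef t j = dir_sign j / 2.
Proof.
case/andP => t0 t1; rewrite /dcoef; have : coef t j != 0.
  rewrite /coef; case: (dir j) => [[]|]; rewrite ?oner_neq0// gt_eqF// sqrtr_gt0//.
  by rewrite subr_gt0.
by move=> c0; field.
Qed.

Lemma measurable_path_field t s : measurable_fun setT (fun x : cyl R J => path_field t x s).
Proof.
apply: measurable_funD => //; apply: measurable_sum => j.
by apply: measurable_funM => //; exact: measurable_coord.
Qed.

Lemma measurable_avg_path t (L : finType) (f : {ffun L -> S} -> R) :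
  measurable_fun setT (fun x : cyl R J => avg (path_field t x) f).
Proof. apply: (@measurable_avg _ _ _ _ (cyl R J) (path_field t)) => s.
exact: measurable_path_field. Qed.

Lemma measurable_avg_xi t (L : finType) (f : {ffun L -> S} -> R) :
  measurable_fun setT (fun w => avg (path_field t (xi w)) f).
Proof. exact: (measurableT_comp (measurable_avg_path t f) (measurable_iid xiG)). Qed.

Lemma avg_bound X (L : finType) (f : {ffun L -> S} -> R) :
  `|avg X f| <= \sum_s `|f s|.
Proof. by apply: (avg_norm s0) => s; exact: finfun_bounded. Qed.

Lemma integrable_avg_path t (L : finType) (f : {ffun L -> S} -> R) :
  Q.-integrable setT (EFin \o (fun w => avg (path_field t (xi w)) f)).
Proof.
by apply: (bounded_integrable Q (measurable_avg_xi t f)) => w; exact: avg_bound.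
Qed.

Lemma integrable_xi_avg t j (L : finType) (f : {ffun L -> S} -> R) :
  Q.-integrable setT (EFin \o (fun w => xi w j * avg (path_field t (xi w)) f)).
Proof.
apply: (le_integrable measurableT _ _
  (integrableZl measurableT (\sum_s `|f s|) (iid_coord_integrable xiG j))).
  apply/measurable_EFinP; apply: measurable_funM; first exact: xiG.1.
  exact: measurable_avg_xi.
move=> w _; rewrite /= lee_fin !normrM mulrC.
by rewrite ler_wpM2r// (le_trans (avg_bound _ _))// ler_norm.
Qed.

Lemma is_derive_avg_upd t j x (y : R) (M : finType) (g : {ffun M -> S} -> R) :
  is_derive y 1 (fun y => avg (path_field t (upd x j y)) g)
    (coef t j * avg (path_field t (upd x j y)) (tilt (A j) g)).
Proof.
rewrite -avg_tiltZ; apply: (is_derive_avg s0) => s.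
have D1 : is_derive y 1 (fun y => \sum_k upd x j y k * (coef t k * A k s))
    (\sum_k (k == j)%:R * (coef t k * A k s)).
  apply: is_derive_bigsum => k; rewrite /upd; case: (k == j).
    by apply: is_derive_eq; rewrite /GRing.scale/=; ring.
  by apply: is_derive_eq; rewrite mul0r.
rewrite (bigD1 j)//= eqxx mul1r big1 in D1; last first.
  by move=> k /negbTE ->; rewrite mul0r.
by apply: is_derive_eq; rewrite !addr0.
Qed.

Lemma nu_path_stein t j (L : finType) (f : {ffun L -> S} -> R) :
  \int[Q]_w (xi w j * avg (path_field t (xi w)) f) =
  coef t j * nu_path t (tilt (A j) f).
Proof.
rewrite /nu_path -RintegralZl//; last exact: integrable_avg_path.
pose C : R := \sum_s `|f s| + \sum_s `|coef t j * tilt (A j) f s|.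
apply: (iid_stein xiG (j := j) (F := fun x => avg (path_field t x) f)
  (dF := fun x => coef t j * avg (path_field t x) (tilt (A j) f)) (C := C)).
- exact: measurable_avg_path.
- by apply: measurable_funM => //; exact: measurable_avg_path.
- by move=> x y; exact: is_derive_avg_upd.
- move=> x y; apply: continuousM; first exact: cst_continuous.
  have D := is_derive_avg_upd t j x y (tilt (A j) f).
  exact/differentiable_continuous/derivable1_diffP.
- by move=> x; apply: le_trans (avg_bound _ _) _; rewrite lerDl sumr_ge0.
- move=> x; rewrite -avgZ; apply: le_trans (avg_bound _ _) _.
  by rewrite lerDr sumr_ge0.
Qed.

Lemma is_derive_path_field (t : R) x s : 0 < t < 1 ->
  is_derive t 1 (fun u => path_field u x s) (\sum_j (dcoef t j * x j) * A j s).
Proof.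
move=> t01; have D1 : is_derive t 1 (fun u => \sum_j x j * (coef u j * A j s))
    (\sum_j (dcoef t j * x j) * A j s).
  apply: is_derive_bigsum => j; have D := is_derive_coef j t01.
  by apply: is_derive_eq; rewrite /GRing.scale/=; ring.
by apply: is_derive_eq; rewrite addr0.
Qed.

(** The derivative of the square root blows up at the ends of the path, so the bound is stated away
    from them. *)
Lemma dcoef_bound (u v t : R) j : 0 < u -> v < 1 -> u < t < v ->
  `|dcoef t j| <= (Num.sqrt u)^-1 + (Num.sqrt (1 - v))^-1.
Proof.
move=> u0 v1 /andP[ut tv]; have su : 0 < Num.sqrt u by rewrite sqrtr_gt0.
have sv : 0 < Num.sqrt (1 - v) by rewrite sqrtr_gt0 subr_gt0.
have bnd (x y : R) : 0 < x -> x <= y -> (2 * Num.sqrt y)^-1 <= (Num.sqrt x)^-1.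
  move=> x0 xy; have sx : 0 < Num.sqrt x by rewrite sqrtr_gt0.
  have sxy : Num.sqrt x <= Num.sqrt y by apply: ler_wsqrtr.
  by rewrite lef_pV2 ?posrE//; lra.
have nn (y : R) : 0 <= (2 * Num.sqrt y)^-1 by rewrite invr_ge0 mulr_ge0// sqrtr_ge0.
rewrite /dcoef /dir_sign /coef; case: (dir j) => [[]|].
- rewrite /= expr0 mul1r ger0_norm//; apply: le_trans (bnd u t u0 (ltW ut)) _.
  by rewrite lerDl invr_ge0 ltW.
- rewrite /= expr1 mulN1r normrN ger0_norm//.
  apply: le_trans (bnd (1 - v) (1 - t) _ _) _; [lra|lra|].
  by rewrite lerDr invr_ge0 ltW.
- by rewrite mul0r normr0 addr_ge0// invr_ge0 ltW.
Qed.

(** Differentiation under the integral brings down each [xi w j], and [nu_path_stein] trades it for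
    a second tilt by the same [A j]. *)
Lemma is_derive_nu_path (t : R) (L : finType) (f : {ffun L -> S} -> R) : 0 < t < 1 ->
  is_derive t 1 (fun u => nu_path u f)
    (\sum_j dir_sign j / 2 * nu_path t (tilt (A j) (tilt (A j) f))).
Proof.
move=> t01; have /andP[t0 t1] := t01.
(* An interval around [t] whose closure avoids 0 and 1, where [dcoef] is bounded. *)
pose u := t / 2; pose v := (1 + t) / 2.
have tuv : `]u, v[%classic t by rewrite /= in_itv/= /u /v; apply/andP; split; lra.
have uv01 x : `]u, v[%classic x -> 0 < x < 1.
  by rewrite /= in_itv/= /u /v => /andP[? ?]; apply/andP; split; lra.
pose c : R := (Num.sqrt u)^-1 + (Num.sqrt (1 - v))^-1.
pose F x w := avg (path_field x (xi w)) f.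
pose dF x w := \sum_j (dcoef x j * xi w j) * avg (path_field x (xi w)) (tilt (A j) f).
have DF (x : R) w : 0 < x < 1 -> is_derive x 1 (F ^~ w) (dF x w).
  move=> x01; rewrite /dF -avg_tilt_sum; apply: (is_derive_avg s0) => s.
  exact: is_derive_path_field.
pose C : R := \sum_j \sum_s `|tilt (A j) f s|.
(* The dominating function is linear in the [|xi w j|], since a tilted average is bounded by a
   constant. *)
pose G w := \sum_j (c * C) * `|xi w j|.
have c0 : 0 <= c by rewrite addr_ge0// invr_ge0 sqrtr_ge0.
have C0 : 0 <= C by rewrite sumr_ge0// => j _; rewrite sumr_ge0.
have G0 w : 0 <= G w by rewrite sumr_ge0// => j _; rewrite !mulr_ge0.
have intG : Q.-integrable setT (EFin \o G).
  apply: integrable_bigsum => j.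
  exact: (integrableZl measurableT (c * C) (integrable_abse (iid_coord_integrable xiG j))).
have bG x w : `]u, v[%classic x -> setT w -> `|partial1of2 F x w| <= G w.
  move=> xuv _; have x01 := uv01 x xuv; have D := DF x w x01.
  rewrite partial1of2E derive_val; apply: le_trans (ler_norm_sum _ _ _) _.
  apply: ler_sum => j _; rewrite normrM (normrM (dcoef x j)) mulrAC; apply: ler_pM => //.
    apply: ler_pM => //.
      apply: (@dcoef_bound u v); [rewrite /u; lra|rewrite /v; lra|].
      by move: xuv; rewrite /= in_itv.
    apply: le_trans (avg_bound _ _) _; rewrite /C (bigD1 j)//= lerDl.
    by rewrite sumr_ge0// => k _; rewrite sumr_ge0.
have intF x : `]u, v[%classic x -> Q.-integrable setT (EFin \o F x).
  by move=> _; exact: integrable_avg_path.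
have derF x w : `]u, v[%classic x -> setT w -> derivable (F ^~ w) x 1.
  by move=> xuv _; have D := DF x w (uv01 x xuv); exact: ex_derive.
have D1 := derivable_under_integral measurableT tuv intF derF G0 intG bG.
have D2 := differentiation_under_integral measurableT tuv intF derF G0 intG bG.
have -> : \sum_j dir_sign j / 2 * nu_path t (tilt (A j) (tilt (A j) f)) =
    derive1 (fun u => nu_path u f) t.
  rewrite [RHS]D2.
  transitivity (\int[Q]_w dF t w); last first.
    apply: eq_Rintegral => w _; have D := DF t w t01.
    by rewrite partial1of2E derive_val.
  rewrite /dF Rintegral_bigsum; last first.
    move=> j; rewrite (_ : _ \o _ = (fun w => (dcoef t j)%:E *
      (xi w j * avg (path_field t (xi w)) (tilt (A j) f))%:E)%E).
      by apply: integrableZl => //; exact: integrable_xi_avg.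
    by apply/funext => w; rewrite /= -EFinM mulrA.
  apply: eq_bigr => j _; rewrite -(coef_dcoef j t01).
  under eq_Rintegral do rewrite -mulrA.
  rewrite RintegralZl//; last exact: integrable_xi_avg.
  by rewrite nu_path_stein mulrA (mulrC (dcoef t j)).
by rewrite derive1E; exact/derivableP.
Qed.

End interpolation.

Section path_calculus.
Context {R : realType} d (T : measurableType d) (Q : probability T R).
Context (J : finType) (xi : T -> cyl R J) (xiG : iid_gaussian Q xi).
Context (S : finType) (s0 : S) (A : J -> S -> R) (B : S -> R).
Variable dir : J -> option bool.

Local Notation nu := (nu_path Q xi A B dir).

Section linearity.
Context {L : finType}.
Implicit Types f g : {ffun L -> S} -> R.

Lemma nuD t f g : nu t (fun s => f s + g s) = nu t f + nu t g.
Proof.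
rewrite /nu_path -RintegralD//; try exact: integrable_avg_path.
by apply: eq_Rintegral => w _; rewrite avgD.
Qed.

Lemma nuB t f g : nu t (fun s => f s - g s) = nu t f - nu t g.
Proof.
rewrite /nu_path -RintegralB//; try exact: integrable_avg_path.
by apply: eq_Rintegral => w _; rewrite avgB.
Qed.

Lemma nuZ t c f : nu t (fun s => c * f s) = c * nu t f.
Proof.
rewrite /nu_path -RintegralZl//; try exact: integrable_avg_path.
by apply: eq_Rintegral => w _; rewrite avgZ.
Qed.

Lemma nu_sum t (I : finType) (f : I -> {ffun L -> S} -> R) :
  nu t (fun s => \sum_i f i s) = \sum_i nu t (f i).
Proof.
rewrite /nu_path -Rintegral_bigsum; last by move=> i; exact: integrable_avg_path.
by apply: eq_Rintegral => w _; rewrite avg_sum.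
Qed.

Lemma nu_le t f g : (forall s, f s <= g s) -> nu t f <= nu t g.
Proof.
move=> fg; apply: le_Rintegral => //; try exact: integrable_avg_path.
by move=> w _; exact: avg_le.
Qed.

Lemma eq_nu t f g : (forall s, f s = g s) -> nu t f = nu t g.
Proof. by move=> /funext ->. Qed.

Lemma nu_cst t c : nu t (fun _ : {ffun L -> S} => c) = c.
Proof.
rewrite /nu_path; under eq_Rintegral do rewrite (avg_cst s0).
by rewrite Rintegral_cst// (_ : fine _ = 1) ?mulr1//= probability_setT.
Qed.

Lemma nu_ge0 t f : (forall s, 0 <= f s) -> 0 <= nu t f.
Proof. by move=> f0; rewrite -(nu_cst t 0); exact: nu_le. Qed.

Lemma nu_norm t f : `|nu t f| <= nu t (fun s => `|f s|).
Proof.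
rewrite ler_norml lerNl -mulN1r -nuZ; apply/andP; split; apply: nu_le => s.
  by rewrite mulN1r -normrN ler_norm.
exact: ler_norm.
Qed.

Lemma nu_norm_le t f g : (forall s, `|f s| <= g s) -> `|nu t f| <= nu t g.
Proof. by move=> fg; apply: le_trans (nu_norm t f) _; exact: nu_le. Qed.

(** The derivative is available only inside the unit interval, whereas the mean value theorem is
    applied up to its ends; continuity there is dominated convergence. *)
Lemma nu_continuous f : continuous (fun t : R => nu t f : R).
Proof.
move=> t.
pose F x w := avg (path_field A B dir x (xi w)) f.
apply: (@continuity_under_integral _ _ _ Q F setT measurableT (t - 1) (t + 1) _ _
  (cst (\sum_s `|f s|))).
- by move=> x _; exact: integrable_avg_path.
- apply: aeW => w _ x _; apply: (continuous_avg s0) => s.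
  apply: continuousD; last exact: cst_continuous.
  apply: continuous_bigsum => j; apply: continuousM; first exact: cst_continuous.
  by apply: continuousM; [exact: continuous_coef|exact: cst_continuous].
- exact: finite_measure_integrable_cst.
- by move=> x _; apply: aeW => w _; exact: avg_bound.
- by rewrite inE/= in_itv/=; apply/andP; split; lra.
Qed.

End linearity.

Lemma nu_restr t (L L' : finType) (iota : L -> L') (f : {ffun L -> S} -> R) :
  injective iota -> nu t (fun s => f (restr iota s)) = nu t f.
Proof.
by move=> iI; apply: eq_Rintegral => w _; rewrite (avg_restr s0).
Qed.

(** The time derivative of the covariance of the path field between [s] and [s']: the squared
    coefficient of [xi j] is [t], [1 - t] or 1, with derivative [dir_sign]. *)
Definition kernel (s s' : S) : R := \sum_j dir_sign dir j * (A j s * A j s').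

Section generator.
Context {L : finType}.
Implicit Types f : {ffun L -> S} -> R.
Local Notation n := (#|L|%:R : R).

(* Two successive integrations by parts add two fresh replicas, [Some None] and then
   [None]; the charges are the coefficients with which each replica enters. *)
Definition left_charge (o : option (option L)) : R :=
  match o with Some (Some _) => 1 | Some None => - n | None => 0 end.

Definition right_charge (o : option (option L)) : R :=
  match o with Some _ => 1 | None => - (n + 1) end.

Definition charge2 (o o' : option (option L)) : R := left_charge o * right_charge o' / 2.

Definition base f (s : {ffun option (option L) -> S}) : R :=
  f (restr Some (restr Some s)).

Definition generator f (s : {ffun option (option L) -> S}) : R :=
  base f s * \sum_o \sum_o' charge2 o o' * kernel (s o) (s o').

Lemma sum_option (I : finType) (F : option I -> R) :
  \sum_o F o = F None + \sum_i F (Some i).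
Proof.
rewrite (bigD1 None)//=; congr (_ + _).
rewrite (reindex_omap Some id)/=; last by case.
by apply: eq_bigl => i; rewrite eqxx.
Qed.

(** Two tilts multiply [f] by two linear forms in the values of [A j] on the replicas; the
    coefficients of these forms are the charges. *)
Lemma tilt_tilt j f s : tilt (A j) (tilt (A j) f) s =
  base f s * \sum_o \sum_o' left_charge o * right_charge o' * (A j (s o) * A j (s o')).
Proof.
rewrite /tilt -mulrA; congr (_ * _).
pose a := \sum_o left_charge o * A j (s o).
pose b := \sum_o right_charge o * A j (s o).
transitivity (a * b).
  congr (_ * _).
    rewrite /a !sum_option/= mul0r add0r [RHS]addrC mulNr; congr (_ - _).
    - by apply: eq_bigr => l _; rewrite mul1r ffunE.
    - by rewrite ffunE.
  rewrite /b [RHS]sum_option/= card_option -natr1 [RHS]addrC mulNr; congr (_ - _).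
  by apply: eq_bigr => l _; rewrite mul1r.
rewrite /a /b mulr_suml; apply: eq_bigr => o _; rewrite mulr_sumr.
by apply: eq_bigr => o' _; ring.
Qed.

Lemma nu_derive (t : R) f : 0 < t < 1 ->
  is_derive t 1 (fun u => nu u f) (nu t (generator f)).
Proof.
move=> t01; have D := is_derive_nu_path xiG s0 A B dir f t01.
apply: (is_derive_eq D).
rewrite -[LHS](eq_bigr _ (fun j _ => nuZ t (dir_sign dir j / 2) (tilt (A j) (tilt (A j) f)))).
rewrite -nu_sum; apply: eq_nu => s.
under eq_bigr do rewrite tilt_tilt mulrCA.
rewrite -mulr_sumr; congr (_ * _).
under eq_bigr do rewrite mulr_sumr.
rewrite exchange_big; apply: eq_bigr => o _.
under eq_bigr do rewrite mulr_sumr.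
rewrite exchange_big; apply: eq_bigr => o' _.
by rewrite /kernel mulr_sumr; apply: eq_bigr => j _; rewrite /charge2; ring.
Qed.

Lemma sum_left_charge : \sum_o `|left_charge o| = 2 * n.
Proof.
rewrite !sum_option/= normr0 add0r normrN ger0_norm ?ler0n//.
by rewrite (eq_bigr (fun=> 1)) => [|l _]; rewrite ?normr1// sumr_const mulr_natl mulr2n.
Qed.

Lemma sum_right_charge : \sum_o `|right_charge o| = 2 * (n + 1).
Proof.
rewrite sum_option/= normrN ger0_norm ?addr_ge0 ?ler0n//.
rewrite (eq_bigr (fun=> 1)) => [|l _]; rewrite ?normr1// sumr_const card_option.
by rewrite -[_ *+ _.+1]natr1; ring.
Qed.

(** The [n] original replicas contribute 1/2 each, the first fresh one [- n / 2], and the second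
    nothing since its left charge is zero. *)
Lemma sum_charge2_diag : \sum_o charge2 o o = 0.
Proof.
rewrite !sum_option/= /charge2/= !mul0r add0r mulr1.
rewrite (eq_bigr (fun=> 2^-1)) => [|l _]; last by rewrite !mul1r.
have -> : \sum_(l : L) 2^-1 = n / 2 by rewrite sumr_const -[LHS]mulr_natl.
by lra.
Qed.

(** The two charge vectors have masses [2 n] and [2 (n + 1)]; half their product, minus the mass [n]
    carried by the diagonal, is [2 n^2 + n]. This yields the factors 10, 36 and 78 for two, four and
    six replicas. *)
Lemma sum_charge2 : \sum_o \sum_(o' | o' != o) `|charge2 o o'| = 2 * n ^+ 2 + n.
Proof.
have e1 : \sum_o \sum_o' `|charge2 o o'| = 2 * n * (n + 1).
  transitivity ((\sum_o `|left_charge o|) * (\sum_o `|right_charge o|) / 2).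
    rewrite mulr_suml mulr_suml; apply: eq_bigr => o _.
    rewrite mulr_sumr mulr_suml; apply: eq_bigr => o' _.
    by rewrite /charge2 !normrM (ger0_norm (_ : 0 <= 2^-1)).
  by rewrite sum_left_charge sum_right_charge; field.
have e2 : \sum_o `|charge2 o o| = n.
  rewrite !sum_option/= /charge2/= !mul0r normr0 add0r mulr1.
  rewrite (eq_bigr (fun=> 2^-1)) => [|l _]; last by rewrite !mul1r ger0_norm.
  have -> : \sum_(l : L) 2^-1 = n / 2 by rewrite sumr_const -[LHS]mulr_natl.
  by rewrite mulNr normrN ger0_norm ?mulr_ge0 ?ler0n ?invr_ge0//; field.
have : \sum_o \sum_o' `|charge2 o o'| =
    \sum_o `|charge2 o o| + \sum_o \sum_(o' | o' != o) `|charge2 o o'|.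
  by rewrite -big_split; apply: eq_bigr => o _; rewrite (bigD1 o).
rewrite e1 e2 => e; apply: (addrI n); rewrite -e; ring.
Qed.

Hypothesis kernel_diag : forall s s', kernel s s = kernel s' s'.

(** The kernel of a replica with itself is of order one and cannot be treated as an error; being
    constant, it is removed by the neutrality of the diagonal charges. *)
Lemma generatorE f s : generator f s =
  base f s * \sum_o \sum_(o' | o' != o) charge2 o o' * kernel (s o) (s o').
Proof.
rewrite /generator; congr (_ * _).
transitivity (\sum_o charge2 o o * kernel s0 s0 +
    \sum_o \sum_(o' | o' != o) charge2 o o' * kernel (s o) (s o')).
  rewrite -big_split; apply: eq_bigr => o _; rewrite (bigD1 o)//=; congr (_ + _).
  by congr (_ * _); exact: kernel_diag.
by rewrite -mulr_suml sum_charge2_diag mul0r add0r.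
Qed.

Lemma generator_norm f s : `|generator f s| <=
  `|base f s| * \sum_o \sum_(o' | o' != o) `|charge2 o o'| * `|kernel (s o) (s o')|.
Proof.
rewrite generatorE normrM ler_wpM2l//.
apply: le_trans (ler_norm_sum _ _ _) _; apply: ler_sum => o _.
apply: le_trans (ler_norm_sum _ _ _) _; apply: ler_sum => o' _.
by rewrite normrM.
Qed.

Lemma nu_generator_bound t f (b : R) :
  (forall o o', o' != o ->
    nu t (fun s => `|base f s| * `|kernel (s o) (s o')|) <= b) ->
  `|nu t (generator f)| <= (2 * n ^+ 2 + n) * b.
Proof.
move=> fb; apply: le_trans (nu_norm_le t (generator_norm f)) _.
rewrite -sum_charge2 mulr_suml.
have -> : nu t (fun s => `|base f s| * \sum_o \sum_(o' | o' != o)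
    `|charge2 o o'| * `|kernel (s o) (s o')|) =
  \sum_o \sum_(o' | o' != o) `|charge2 o o'| * nu t (fun s => `|base f s| * `|kernel (s o) (s o')|).
  transitivity (nu t (fun s => \sum_o \sum_o' (o' != o)%:R * `|charge2 o o'| *
      (`|base f s| * `|kernel (s o) (s o')|))).
    apply: eq_nu => s; rewrite mulr_sumr; apply: eq_bigr => o _.
    rewrite mulr_sumr [LHS]big_mkcond; apply: eq_bigr => o' _.
    by case: (o' != o); rewrite ?mul0r// mul1r; ring.
  rewrite nu_sum; apply: eq_bigr => o _; rewrite nu_sum [RHS]big_mkcond.
  by apply: eq_bigr => o' _; rewrite nuZ; case: (o' != o); rewrite ?mul0r ?mul1r.
apply: ler_sum => o _; rewrite mulr_suml; apply: ler_sum => o' oo'.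
by rewrite ler_wpM2l// fb.
Qed.

Lemma nu_mvt f (b : R) :
  (forall t o o', 0 < t < 1 -> o' != o ->
    nu t (fun s => `|base f s| * `|kernel (s o) (s o')|) <= b) ->
  forall t : R, 0 <= t <= 1 -> `|nu t f - nu 0 f| <= (2 * n ^+ 2 + n) * b.
Proof.
move=> fb t /andP[t0 t1].
have Dnu (x : R) : x \in `]0, t[ -> is_derive x 1 (fun u => nu u f) (nu x (generator f)).
  by rewrite in_itv/= => /andP[x0 xt]; apply: nu_derive; rewrite x0 (lt_le_trans xt).
have Cnu : {within `[0, t], continuous (fun u => nu u f)}.
  exact/continuous_subspaceT/nu_continuous.
(* At [t = 0] nothing moves, but the bound must still be shown nonnegative; this is read off the
   hypothesis at time 1/2. *)
move: t0; rewrite le_eqVlt => /predU1P[<-|t0].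
  rewrite subrr normr0; apply: mulr_ge0; first by rewrite addr_ge0 ?mulr_ge0.
  have h0 : 0 < (2^-1 : R) < 1 by apply/andP; split; lra.
  apply: le_trans (fb _ None (Some None) h0 isT).
  by apply: nu_ge0 => s; rewrite mulr_ge0.
have [c ct ->] := MVT t0 Dnu Cnu.
move: ct; rewrite in_itv/= subr0 => /andP[c0 ct].
have c01 : 0 < c < 1 by rewrite c0 (lt_le_trans ct).
have gb := nu_generator_bound (fun o o' => @fb c o o' c01).
rewrite normrM (ger0_norm (ltW t0)); apply: le_trans gb.
by rewrite ler_piMr.
Qed.

(** For nonnegative [f] the averaged generator is at least [- K * nu u f], so
    [expR (K * u) * nu u f] is nondecreasing. The comparison is with time 1 because the moments
    known there, those of the Gibbs measure, have to control the whole path. *)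
Lemma nu_gronwall f (M : R) : (forall s, 0 <= f s) ->
  (forall s s', `|kernel s s'| <= M) ->
  forall t : R, 0 <= t <= 1 -> nu t f <= expR ((2 * n ^+ 2 + n) * M) * nu 1 f.
Proof.
move=> f0 kM t /andP[t0 t1]; set K := (2 * n ^+ 2 + n) * M.
have M0 : 0 <= M by apply: le_trans (kM s0 s0).
have K0 : 0 <= K by rewrite mulr_ge0// addr_ge0 ?mulr_ge0.
have nf0 u : 0 <= nu u f by exact: nu_ge0.
have lower u : 0 < u < 1 -> - (K * nu u f) <= nu u (generator f).
  move=> u01; rewrite lerNl; apply: le_trans (ler_norm _) _; rewrite normrN /K -mulrA.
  apply: nu_generator_bound => o o' _.
  apply: (@le_trans _ _ (nu u (fun s => M * base f s))).
    apply: nu_le => s; have b0 : 0 <= base f s by exact: f0.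
    by rewrite mulrC (ger0_norm b0) ler_wpM2r.
  rewrite nuZ ler_wpM2l//.
  have someI (I : Type) : injective (@Some I) by move=> ? ? [].
  rewrite -[leRHS](nu_restr u f (someI _)).
  by rewrite -[leRHS](nu_restr u (fun s => f (restr Some s)) (someI _)).
pose G (u : R) : R := expR (K * u) * nu u f.
have cG : continuous G.
  move=> v; apply: cvgM; last exact: nu_continuous.
  apply: (@continuous_comp _ _ _ (fun u : R => K * u) expR); last exact: continuous_expR.
  by apply: cvgM; [exact: cvg_cst|exact: cvg_id].
have DG (u : R) : 0 < u < 1 ->
    is_derive u 1 G (expR (K * u) * (K * nu u f + nu u (generator f))).
  move=> u01; have D := nu_derive f u01; rewrite /G.
  by apply: is_derive_eq; rewrite /GRing.scale/=; ring.
have dG (u : R) : u \in `]0, 1[ -> derivable G u 1.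
  by rewrite in_itv/= => u01; have D := DG u u01; exact: ex_derive.
have dG0 (u : R) : u \in `]0, 1[ -> 0 <= derive1 G u.
  rewrite in_itv/= => u01; have D := DG u u01.
  rewrite derive1E derive_val mulr_ge0 ?expR_ge0//.
  by have := lower u u01; lra.
have ndG := ger0_derive1_le_cc dG dG0 (continuous_subspaceT cG).
have G01 : G t <= G 1 by apply: ndG; rewrite // in_itv/= ?t0 ?t1 ?ler01 ?lexx.
move: G01; rewrite /G mulr1; apply: le_trans.
by rewrite ler_peMl// -expR0 ler_expR mulr_ge0.
Qed.

End generator.

End path_calculus.

Section second_order.
Context {R : realType} d (T : measurableType d) (Q : probability T R).
Context (J : finType) (xi : T -> cyl R J) (xiG : iid_gaussian Q xi).
Context (S : finType) (s0 : S) (A : J -> S -> R) (B : S -> R).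
Variable dir : J -> option bool.
Hypothesis kernel_diag : forall s s', kernel A dir s s = kernel A dir s' s'.
Local Notation nu := (nu_path Q xi A B dir).
Local Notation gen := (@generator R J S A dir _).

(** The mean value theorem turns the increment of [f] into the average of [gen f] at an intermediate
    time, and [nu_mvt] applied to [gen f] brings it back to time 0. Each generator adds two replicas
    and one kernel, hence the two kernels in the hypothesis. *)
Lemma nu_second_order (L : finType) (f : {ffun L -> S} -> R) (b : R) :
  (forall (t : R) (o1 o1' : option (option L)) (o o' : option (option (option (option L)))),
    0 < t < 1 -> o1' != o1 -> o' != o ->
    nu t (fun s => `|base (base f) s| *
      `|kernel A dir (s (Some (Some o1))) (s (Some (Some o1')))| * `|kernel A dir (s o) (s o')|) <= b) ->
  `|nu 1 f - nu 0 f - nu 0 (gen f)| <=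
    (2 * #|{: option (option L)}|%:R ^+ 2 + #|{: option (option L)}|%:R) * ((2 * #|L|%:R ^+ 2 + #|L|%:R) * b).
Proof.
move=> fb.
have Dnu (x : R) : x \in `]0, 1[ -> is_derive x 1 (fun u => nu u f) (nu x (gen f)).
  by rewrite in_itv/= => x01; exact: (nu_derive xiG s0).
have Cnu : {within `[0, 1], continuous (fun u => nu u f)}.
  by apply: continuous_subspaceT; exact: (nu_continuous xiG s0).
have [c c01 ->] := MVT ltr01 Dnu Cnu.
move: c01; rewrite in_itv/= subr0 mulr1 => /andP[c0 c1].
apply: (nu_mvt xiG s0 kernel_diag) => [t o o' t01 oo'|]; last by rewrite !ltW.
pose G s (o1 o1' : option (option L)) : R := `|charge2 o1 o1'| *
  (`|base (base f) s| * `|kernel A dir (s (Some (Some o1))) (s (Some (Some o1')))| * `|kernel A dir (s o) (s o')|).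
apply: (@le_trans _ _ (nu t (fun s => \sum_o1 \sum_o1' (o1' != o1)%:R * G s o1 o1'))).
  apply: (nu_le xiG s0) => s.
  have := generator_norm s0 kernel_diag f (restr Some (restr Some s)).
  rewrite -/(base (gen f) s) => h.
  apply: le_trans (ler_wpM2r (normr_ge0 _) h) _.
  rewrite mulr_sumr mulr_suml; apply: ler_sum => o1 _.
  rewrite mulr_sumr mulr_suml [leLHS]big_mkcond; apply: ler_sum => o1' _.
  rewrite /G !ffunE /base; case: (o1' != o1); rewrite ?mul1r ?mul0r//.
  by rewrite le_eqVlt; apply/orP; left; apply/eqP; ring.
rewrite (nu_sum xiG s0) -(@sum_charge2 R L) mulr_suml; apply: ler_sum => o1 _.
rewrite (nu_sum xiG s0) mulr_suml [leRHS]big_mkcond; apply: ler_sum => o1' _.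
rewrite (nuZ xiG s0) /G (nuZ xiG s0).
case: (boolP (o1' != o1)) => oo1; last by rewrite mul0r.
by rewrite mul1r ler_wpM2l// fb.
Qed.

End second_order.

(** * Adjoining an independent Gaussian *)

Section extra_gaussian.
Context {R : realType}.
Local Notation gauss := (normal_prob 0 1 : probability (measurableTypeR R) R).

Lemma std_gaussian_integral d (T : measurableType d) (P : probability T R)
    (X : {RV P >-> R}) (F : R -> R) (C : R) : std_gaussian X ->
  measurable_fun setT F -> (forall x, `|F x| <= C) ->
  ('E_P[fun w => F (X w)])%E = (\int[gauss]_y F y)%:E.
Proof.
move=> gX mF FC; rewrite unlock.
have mX : measurable_fun [set: T] (X : T -> measurableTypeR R) by exact: (measurable_funP X).
pose X' : {mfun T >-> measurableTypeR R} :=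
  HB.pack (X : T -> measurableTypeR R) (isMeasurableFun.Build _ _ _ _ _ mX).
have iF : gauss.-integrable setT (EFin \o F) by exact: (bounded_integrable gauss mF FC).
have iFX : P.-integrable setT ((EFin \o F) \o X).
  by apply: (bounded_integrable P (F := F \o X) (C := C)) => [|w]; [exact: (measurableT_comp mF mX)|exact: FC].
rewrite /Rintegral fineK; last exact: integrable_fin_num.
have mEF : measurable_fun [set: measurableTypeR R] (EFin \o F) by exact/measurable_EFinP.
have := integral_pushforward mX mEF iFX measurableT; rewrite preimage_setT => <-.
apply: (@eq_measure_integral _ _ _ _ gauss (distribution P X')).
by move=> B mB _; exact: gX.
Qed.

Lemma iid_gaussian_of_independent d (T : measurableType d) (P : probability T R)
    (J : finType) (g : J -> {RV P >-> R}) :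
  (forall t, std_gaussian (g t)) -> mutually_independent g ->
  iid_gaussian P (fun w j => g j w : R).
Proof.
move=> gG indep; split; first by move=> j; exact: (measurable_funP (g j)).
move=> B mB; have := indep [set: J]%SET B mB.
rewrite (_ : \bigcap_(i in _) _ = [set w | forall j, B j (g j w)]); last first.
  apply/seteqP; split => [w /= gB j|w /= gB j _]; last exact: gB.
  by apply: (gB j); rewrite /= inE.
move=> ->; apply: eq_big => [j|j _]; first by rewrite inE.
exact: gG.
Qed.

Section extension.
Context d (T : measurableType d) (P : probability T R) (J : finType).
Variable xi : T -> cyl R J.
Hypothesis xiG : iid_gaussian P xi.

(** [None] indexes the Gaussian field that takes over at the cavity site; enlarging the probability
    space makes it independent of the disorder. *)
Definition extend_field (z : T * measurableTypeR R) : cyl R (option J) :=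
  fun o => if o is Some j then xi z.1 j else z.2.

Lemma iid_gaussian_extend : iid_gaussian (P \x gauss)%E extend_field.
Proof.
split=> [[j|]|B mB].
- exact: (measurableT_comp (xiG.1 j) measurable_fst).
- exact: measurable_snd.
rewrite (_ : [set _ | _] = [set w | forall j, B (Some j) (xi w j)] `*` B None); last first.
  apply/seteqP; split => [[w y] /= h|[w y] /= [h hN] [j|]]; [|exact: h|exact: hN].
  by split => [j|]; [exact: (h (Some j))|exact: (h None)].
have mA : measurable ([set x | forall k, B (Some k) (x k)] : set (cyl R J)).
  by apply: sub_sigma_algebra; exists (fun k => B (Some k)).
have mA' : measurable [set w | forall k, B (Some k) (xi w k)].
  by have := measurable_iid xiG measurableT mA; rewrite setTI.
apply: (etrans (@product_measure1E _ _ _ _ R P gauss _ _ mA' (mB None))).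
transitivity ((\prod_j gauss (B (Some j))) * gauss (B None))%E.
  by congr (_ * _)%E; exact: (xiG.2 (fun j => B (Some j))).
rewrite [RHS](bigD1 None)//= muleC; congr (_ * _)%E.
rewrite [RHS](reindex_omap Some id)/=; last by case.
by apply: eq_bigl => j; rewrite eqxx.
Qed.

Lemma Rintegral_prod (a : R -> R) (G : T -> R) (Ca CG : R) :
  measurable_fun setT a -> measurable_fun setT G ->
  (forall y, `|a y| <= Ca) -> (forall w, `|G w| <= CG) ->
  \int[(P \x gauss)%E]_z (a z.2 * G z.1) = (\int[gauss]_y a y) * (\int[P]_w G w).
Proof.
move=> ma mG aC GC.
have ia : gauss.-integrable setT (EFin \o a) by exact: (bounded_integrable gauss ma aC).
have iG : P.-integrable setT (EFin \o G) by exact: (bounded_integrable P mG GC).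
have m2 : measurable_fun [set: T * measurableTypeR R] (fun z => a z.2 * G z.1).
  apply: measurable_funM; first exact: (measurableT_comp ma measurable_snd).
  exact: (measurableT_comp mG measurable_fst).
have i2 : (P \x gauss)%E.-integrable setT (EFin \o (fun z => a z.2 * G z.1)).
  apply: (bounded_integrable (P \x gauss)%E m2 (C := Ca * CG)) => z.
  by rewrite normrM ler_pM.
rewrite {1}/Rintegral -(integral12_prod_meas1 i2).
have -> : fubini_F gauss (EFin \o (fun z : T * R => a z.2 * G z.1)) =
    (fun w => (\int[gauss]_y a y * G w)%:E).
  apply/funext => w; rewrite /fubini_F /=.
  under eq_integral do rewrite EFinM.
  rewrite integralZr// EFinM /Rintegral fineK//.
  exact: (integrable_fin_num).
rewrite -[LHS]/(\int[P]_w (\int[gauss]_y a y * G w)).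
by rewrite RintegralZl.
Qed.

Lemma Rintegral_fst (G : T -> R) (C : R) :
  measurable_fun setT G -> (forall w, `|G w| <= C) ->
  \int[(P \x gauss)%E]_z G z.1 = \int[P]_w G w.
Proof.
move=> mG GC.
have := @Rintegral_prod (cst 1) G 1 C (@measurable_cst _ _ _ _ _ _) mG _ GC.
rewrite Rintegral_cst// (_ : fine _ = 1) ?mulr1 ?mul1r; 
  last exact: (congr1 fine (@probability_setT _ _ _ gauss)).
move=> <-.
  by apply: eq_Rintegral => z _; rewrite mul1r.
by move=> y; rewrite normr1.
Qed.

End extension.

End extra_gaussian.

Lemma ffact_le_expn (N k : nat) : (N ^_ k <= N ^ k)%N.
Proof.
elim: k => [|k IH]; first by rewrite ffactn0.
by rewrite ffactnSr expnSr leq_mul// leq_subr.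
Qed.

(** The difference counts the non-injective maps from [k] points to [N] points; [k * k] is a
    generous bound for the number of pairs that may collide. *)
Lemma expn_le_ffact (N k : nat) : (N ^ k <= N ^_ k + k * k * N ^ k.-1)%N.
Proof.
elim: k => [|k IH]; first by rewrite ffactn0.
rewrite expnS ffactnSr; apply: (@leq_trans (N * (N ^_ k + k * k * N ^ k.-1)))%N.
  by rewrite leq_mul2l IH orbT.
have h1 : (N * N ^_ k <= N ^_ k * (N - k) + k * N ^ k)%N.
  have [Nk|kN] := ltnP N k; first by rewrite ffact_small// muln0.
  rewrite -{1}(subnK kN) mulnDl mulnC leq_add2l leq_mul2l.
  by rewrite ffact_le_expn orbT.
have h2 : (N * (k * k * N ^ k.-1) <= k * k * N ^ k)%N.
  by case: k {IH h1} => [|k]; rewrite ?muln0// mulnCA -expnS.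
rewrite mulnDr (leq_trans (leq_add h1 h2))//= -addnA leq_add2l -mulnDl.
by rewrite leq_mul2r; apply/orP; right; rewrite mulSn mulnS addnA leq_add2r leq_addl.
Qed.

(** * The cavity at one site *)

Section elementary_symmetric.
Context {R : realType} {N : nat}.
Implicit Types (y : 'I_N -> R) (A : {set 'I_N}).

(** Each set of [k] elements is the image of exactly [k!] injections. *)
Lemma sum_injective_ffun k y :
  \sum_(f : {ffun 'I_k -> 'I_N} | injectiveb f) \prod_j y (f j) =
  k`!%:R * \sum_(A : {set 'I_N} | #|A| == k) \prod_(x in A) y x.
Proof.
rewrite (partition_big (fun f : {ffun 'I_k -> 'I_N} => f @: [set: 'I_k]%SET) (fun A => #|A| == k)) /=; last first.
  by move=> f /injectiveP fI; rewrite card_imset// cardsT card_ord.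
rewrite mulr_sumr; apply: eq_bigr => A /eqP Ak.
rewrite (eq_bigr (fun=> \prod_(x in A) y x)); last first.
  move=> f /andP[/injectiveP fI /eqP <-]; rewrite big_imset/=; last by move=> ? ? _ _; exact: fI.
  by apply: eq_bigl => j; rewrite inE.
rewrite sumr_const mulr_natl; congr (_ *+ _).
have := card_inj_ffuns_on 'I_k (mem A); rewrite card_ord /= Ak ffactnn => <-.
apply: eq_card => f; rewrite !inE unfold_in; apply/andP/andP.
  move=> [fI /eqP <-]; split => //.
  by apply/ffun_onP => j; rewrite imset_f.
move=> [/ffun_onP fA fI]; split => //.
have /injectiveP fI' := fI.
rewrite eqEcard (card_imset _ fI') cardsT card_ord Ak leqnn andbT.
by apply/fintype.subsetP => _ /imsetP[j _ ->]; exact: fA.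
Qed.

Lemma elementary_symmetric_le k y : (forall x, `|y x| <= 1) ->
  `|k`!%:R * \sum_(A : {set 'I_N} | #|A| == k) \prod_(x in A) y x| <= N%:R ^+ k.
Proof.
move=> y1; rewrite -sum_injective_ffun; apply: le_trans (ler_norm_sum _ _ _) _.
apply: (@le_trans _ _ (\sum_(f : {ffun 'I_k -> 'I_N} | injectiveb f) 1)).
  apply: ler_sum => f _; rewrite normr_prod.
  by apply: prodr_ile1 => j _; rewrite normr_ge0 y1.
rewrite sumr_const -natrX ler_nat.
by apply: leq_trans (max_card _) _; rewrite card_ffun !card_ord.
Qed.

(** Expanding the power over all maps, the injective ones reproduce the symmetric sum exactly and
    the non-injective ones are of lower order in [N]. This is how the covariance of a Hamiltonian
    over strictly increasing tuples becomes a power of the overlap. *)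
Lemma elementary_symmetric_power k y : (forall x, `|y x| <= 1) ->
  `|k`!%:R * \sum_(A : {set 'I_N} | #|A| == k) \prod_(x in A) y x - (\sum_x y x) ^+ k|
    <= k%:R ^+ 2 * N%:R ^+ k.-1.
Proof.
move=> y1; rewrite -sum_injective_ffun.
have -> : (\sum_x y x) ^+ k = \sum_(f : {ffun 'I_k -> 'I_N}) \prod_j y (f j).
  by rewrite -(bigA_distr_bigA (fun=> y)) prodr_const card_ord.
rewrite [X in _ - X](bigID (fun f : {ffun 'I_k -> 'I_N} => injectiveb f))/= opprD addNKr normrN.
apply: le_trans (ler_norm_sum _ _ _) _.
apply: (@le_trans _ _ (\sum_(f : {ffun 'I_k -> 'I_N} | ~~ injectiveb f) 1)).
  apply: ler_sum => f _; rewrite normr_prod.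
  by apply: prodr_ile1 => j _; rewrite normr_ge0 y1.
rewrite sumr_const.
have e : (N ^ k = #|[set f : {ffun 'I_k -> 'I_N} | injectiveb f]%SET| +
    #|[pred f : {ffun 'I_k -> 'I_N} | ~~ injectiveb f]|)%N.
  transitivity #|{ffun 'I_k -> 'I_N}|; first by rewrite card_ffun !card_ord.
  rewrite -(cardC [pred f : {ffun 'I_k -> 'I_N} | injectiveb f]).
  by congr (_ + _)%N; apply: eq_card => f; rewrite !inE.
rewrite card_inj_ffuns !card_ord in e.
rewrite -!natrX -natrM ler_nat -mulnn.
by have := expn_le_ffact N k; rewrite e leq_add2l.
Qed.

(** A strictly increasing tuple is determined by its set of entries. That every [p]-subset arises is
    obtained by comparing cardinalities. *)
Lemma sum_multi_index p (F : {set 'I_N} -> R) :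
  \sum_(t : multi_index p N) F [set x in val (val t)]%SET =
  \sum_(A : {set 'I_N} | #|A| == p) F A.
Proof.
pose Phi (t : multi_index p N) : {set 'I_N} := [set x in val (val t)]%SET.
have sorted_val (t : multi_index p N) : sorted ltn (map val (val (val t))) by exact: valP t.
have uniq_val (t : multi_index p N) : uniq (val (val t)).
  by apply: (@map_uniq _ _ val); apply: sorted_uniq (sorted_val t); [exact: ltn_trans|exact: ltnn].
have Phi_inj : injective Phi.
  move=> t t' tt'; do 2 apply: val_inj; apply: (inj_map val_inj).
  apply: (irr_sorted_eq ltn_trans ltnn) => // x.
  have mem_eq : val (val t) =i val (val t').
    by move=> z; have /setP/(_ z) := tt'; rewrite !inE.
  by apply/mapP/mapP => -[z zt ->]; exists z; rewrite // ?mem_eq // -mem_eq.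
transitivity (\sum_(A in Phi @: [set: multi_index p N]%SET) F A).
  rewrite big_imset/=; last by move=> ? ? _ _; exact: Phi_inj.
  by apply: eq_bigl => t; rewrite inE.
apply: eq_bigl => A.
have sub : Phi @: [set: multi_index p N]%SET \subset [set A : {set 'I_N} | #|A| == p]%SET.
  apply/fintype.subsetP => _ /imsetP[t _ ->]; rewrite inE /Phi cardsE.
  by have /card_uniqP -> := uniq_val t; rewrite size_tuple.
have /eqP -> : Phi @: [set: multi_index p N]%SET == [set A : {set 'I_N} | #|A| == p]%SET.
  rewrite eqEcard sub card_draws card_ord card_imset// cardsT -card_ltn_sorted_tuples.
  by rewrite card_sig; apply: subset_leq_card; apply/fintype.subsetP => t; rewrite !inE.
by rewrite inE.
Qed.

Lemma prod_multi_index p (t : multi_index p N) y :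
  \prod_(k < p) y (tnth (val t) k) = \prod_(x in [set x in val (val t)]%SET) y x.
Proof.
have uniq_t : uniq (val (val t)).
  apply: (@map_uniq _ _ val); apply: sorted_uniq (valP t); [exact: ltn_trans|exact: ltnn].
transitivity (\prod_(x <- val (val t)) y x); first by rewrite big_tuple.
rewrite big_uniq//; apply: eq_bigl => x; by rewrite inE.
Qed.

End elementary_symmetric.

Section spins.
Context {R : realType} {N : nat}.
Implicit Types (s : config N) (x : 'I_N).
Local Notation spin := (spin R).

Lemma spin_sqr s x : spin s x * spin s x = 1.
Proof. by rewrite /Defs.spin -expr2 sqrr_sign. Qed.

Lemma norm_spin s x : `|spin s x| = 1.
Proof. by rewrite /Defs.spin normrX normrN1 expr1n. Qed.

Definition agree s s' x : R := spin s x * spin s' x.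

Lemma norm_agree s s' x : `|agree s s' x| = 1.
Proof. by rewrite /agree normrM !norm_spin mulr1. Qed.

Lemma agreeC s s' x : agree s s' x = agree s' s x.
Proof. exact: mulrC. Qed.

Lemma agree_diag s x : agree s s x = 1.
Proof. exact: spin_sqr. Qed.

(** Normalised by [N] although it sums [N - 1] terms, so that the full overlap differs from it by
    exactly one site term. *)
Definition cavity_overlap (i : 'I_N) s s' : R := N%:R^-1 * \sum_(x | x != i) agree s s' x.

Definition full_overlap s s' : R := N%:R^-1 * \sum_x agree s s' x.

Hypothesis N_gt0 : (0 < N)%N.

Lemma full_overlapE i s s' : full_overlap s s' = cavity_overlap i s s' + agree s s' i / N%:R.
Proof. by rewrite /full_overlap (bigD1 i)//= addrC mulrDr (mulrC _ (agree _ _ _)). Qed.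

Lemma norm_sum_agree (P : pred 'I_N) s s' : `|\sum_(x | P x) agree s s' x| <= N%:R.
Proof.
apply: le_trans (ler_norm_sum _ _ _) _.
rewrite (eq_bigr (fun=> 1)) => [|x _]; last exact: norm_agree.
by rewrite sumr_const ler_nat -[leqRHS]card_ord max_card.
Qed.

Lemma norm_cavity_overlap i s s' : `|cavity_overlap i s s'| <= 1.
Proof.
have N0 : 0 < N%:R :> R by rewrite ltr0n.
by rewrite normrM ger0_norm ?invr_ge0 ?ler0n// ler_pdivrMl// mulr1 norm_sum_agree.
Qed.

Lemma norm_full_overlap s s' : `|full_overlap s s'| <= 1.
Proof.
have N0 : 0 < N%:R :> R by rewrite ltr0n.
by rewrite normrM ger0_norm ?invr_ge0 ?ler0n// ler_pdivrMl// mulr1 norm_sum_agree.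
Qed.

End spins.

Section powers.
Context {R : realFieldType}.
Implicit Types (r q : R).

Lemma norm_expr_le1 r k : `|r| <= 1 -> `|r ^+ k| <= 1.
Proof. by move=> r1; rewrite normrX exprn_ile1. Qed.

Lemma norm_subrX r q k : `|r| <= 1 -> `|q| <= 1 -> `|r ^+ k - q ^+ k| <= k%:R * `|r - q|.
Proof.
move=> r1 q1; elim: k => [|k IH]; first by rewrite !expr0 subrr normr0 mul0r.
have -> : r ^+ k.+1 - q ^+ k.+1 = r * (r ^+ k - q ^+ k) + (r - q) * q ^+ k.
  by rewrite !exprS; ring.
apply: le_trans (ler_normD _ _) _; rewrite -natr1 [leRHS]mulrDl mul1r !normrM.
apply: lerD; first by apply: le_trans IH; rewrite ler_piMl.
by rewrite ler_piMr// norm_expr_le1.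
Qed.

Lemma norm_subrX_taylor r q k : `|r| <= 1 -> `|q| <= 1 ->
  `|r ^+ k.+1 - q ^+ k.+1 - k.+1%:R * q ^+ k * (r - q)| <= k.+1%:R ^+ 2 * (r - q) ^+ 2.
Proof.
move=> r1 q1; elim: k => [|k IH].
  have -> : r ^+ 1 - q ^+ 1 - 1%:R * q ^+ 0 * (r - q) = 0 by ring.
  by rewrite normr0 mulr_ge0 ?sqr_ge0.
have -> : r ^+ k.+2 - q ^+ k.+2 - k.+2%:R * q ^+ k.+1 * (r - q) =
    q * (r ^+ k.+1 - q ^+ k.+1 - k.+1%:R * q ^+ k * (r - q)) +
    (r - q) * (r ^+ k.+1 - q ^+ k.+1).
  by rewrite -[k.+2%:R]natr1 !(exprS _ k.+1) (exprS q k); ring.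
apply: le_trans (ler_normD _ _) _; rewrite !normrM.
apply: (@le_trans _ _ (k.+1%:R ^+ 2 * (r - q) ^+ 2 + k.+1%:R * (r - q) ^+ 2)).
  apply: lerD; first by apply: le_trans IH; rewrite ler_piMl.
  have -> : (r - q) ^+ 2 = `|r - q| ^+ 2 by rewrite real_normK ?num_real.
  rewrite expr2 mulrCA ler_wpM2l//; exact: norm_subrX.
rewrite -mulrDl ler_wpM2r ?sqr_ge0// -[k.+2%:R]natr1.
have : 0 <= k.+1%:R :> R by rewrite ler0n.
by move: (k.+1%:R : R) => z z0; nra.
Qed.

End powers.

Section cavity_model.
Context {R : realType} (p N : nat) (beta h q : R) (i : 'I_N).
Hypotheses (hp : (2 <= p)%N) (hq : 0 <= q <= 1).
Local Notation J := (option (multi_index p N)).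
Local Notation S := (config N).
Local Notation spin := (spin R).

Definition cavity_std : R := beta * Num.sqrt (p%:R / 2) * q `^ ((p%:R - 1) / 2).

Definition cavity_coef (o : J) (s : S) : R :=
  match o with
  | Some t => beta * u_coef R p N * \prod_(k < p) spin s (tnth (val t) k)
  | None => cavity_std * spin s i
  end.

Definition cavity_dir (o : J) : option bool :=
  match o with
  | Some t => if i \in val (val t) then Some true else None
  | None => Some false
  end.

Definition field_term (s : S) : R := h * \sum_x spin s x.

Local Notation X := (path_field cavity_coef field_term cavity_dir).

Lemma path_field1 (x : J -> R) s :
  X 1 x s = - hamiltonian beta h (fun t => x (Some t)) s.
Proof.
rewrite /hamiltonian opprK /path_field; congr (_ + _).
rewrite sum_option/= {1}/coef/= subrr sqrtr0 mul0r mulr0 add0r mulr_sumr.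
apply: eq_bigr => t _; rewrite /coef/=.
by case: ifP => _; rewrite ?sqrtr1 mul1r mulrCA mulrA; ring.
Qed.

Lemma cavity_std_sqr : cavity_std ^+ 2 = beta ^+ 2 * (p%:R / 2) * q ^+ p.-1.
Proof.
have [q0 q1] := andP hq.
rewrite /cavity_std !exprMn sqr_sqrtr ?divr_ge0 ?ler0n//; congr (_ * _).
have p1 : p%:R - 1 = p.-1%:R :> R by rewrite -{1}(prednK (ltnW hp)) -natr1 addrK.
rewrite p1 -[LHS]powR_mulrn ?powR_ge0// -powRrM divfK ?pnatr_eq0//.
by rewrite powR_mulrn.
Qed.

(** The kernel with the agreement at [i] factored out. The indicator [x != i] kills the sets through
    [i], so what is left is a symmetric sum of degree [p - 1] that ignores the spins at [i]. *)
Definition cavity_gamma (s s' : S) : R :=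
  beta ^+ 2 * u_coef R p N ^+ 2 *
    \sum_(A : {set 'I_N} | #|A| == p.-1) \prod_(x in A) ((x != i)%:R * agree s s' x)
  - cavity_std ^+ 2.

Lemma cavity_kernelE s s' : kernel cavity_coef cavity_dir s s' =
  agree s s' i * cavity_gamma s s'.
Proof.
have signE o : dir_sign cavity_dir o * (cavity_coef o s * cavity_coef o s') =
    match o with
    | Some t => (i \in [set x in val (val t)]%SET)%:R * (beta ^+ 2 * u_coef R p N ^+ 2 *
       \prod_(x in [set x in val (val t)]%SET) agree s s' x)
    | None => - (cavity_std ^+ 2 * agree s s' i)
    end.
  case: o => [t|]; last by rewrite /dir_sign/= expr1 /agree; ring.
  rewrite -prod_multi_index big_split/= inE /dir_sign/=.
  by case: ifP => _; rewrite ?mul0r// expr0 !mul1r; ring.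
rewrite /kernel; under eq_bigr do rewrite signE.
rewrite sum_option (sum_multi_index p (fun A => (i \in A)%:R * (beta ^+ 2 * u_coef R p N ^+ 2 *
       \prod_(x in A) agree s s' x))).
rewrite /cavity_gamma mulrBr [LHS]addrC (mulrC (cavity_std ^+ 2)); congr (_ - _).
rewrite [RHS]mulrCA [X in _ = _ * X]mulr_sumr.
transitivity (beta ^+ 2 * u_coef R p N ^+ 2 *
  \sum_(A : {set 'I_N} | (#|A| == p) && (i \in A)) \prod_(x in A) agree s s' x).
  rewrite mulr_sumr [RHS]big_mkcondr; apply: eq_bigr => A _.
  by case: (i \in A); rewrite /= ?mul1r ?mul0r.
congr (_ * _).
rewrite [RHS](bigID (fun A : {set 'I_N} => i \notin A))/= [X in _ = _ + X]big1 ?addr0; last first.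
  move=> A /andP[_]; rewrite negbK => iA.
  by rewrite (bigD1 i)//= eqxx !mul0r mulr0.
(* A set of size [p] through [i] is [i] added to a set of size [p - 1] avoiding it. *)
rewrite (reindex_onto (fun A : {set 'I_N} => i |: A)%SET (fun A => A :\ i)%SET)/=; last first.
  by move=> A /andP[_ iA]; rewrite finset.setD1K.
apply: eq_big => [A|A /andP[/andP[_ _] /eqP iA]].
  rewrite finset.setU11 andbT; case: (boolP (i \in A)) => iA /=.
    rewrite andbF; apply/negP => /andP[_ /eqP e].
    by have := finset.setD11 i (i |: A)%SET; rewrite e iA.
  by rewrite finset.setU1K// eqxx !andbT cardsU1 iA add1n -{1}(prednK (ltnW hp)) eqSS.
have iA' : i \notin A by rewrite -iA finset.setD11.
rewrite big_setU1//=; congr (_ * _); apply: eq_bigr => x xA.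
by rewrite (_ : x != i) ?mul1r//; apply: contraNneq iA' => <-.
Qed.

Lemma kernel_cst : forall s s', kernel cavity_coef cavity_dir s s =
  kernel cavity_coef cavity_dir s' s'.
Proof.
move=> s s'; rewrite !cavity_kernelE !agree_diag; congr (_ * (_ * _ - _)).
by apply: eq_bigr => A _; apply: eq_bigr => x _; rewrite !agree_diag.
Qed.

Hypothesis N_gt0 : (0 < N)%N.

(** Written so that [(p-1)!] can join the symmetric sum and [N ^ (p-1)] normalise it; the prefactor
    [p / 2] that remains is the one in the variance of the cavity field. *)
Lemma u_coef_sqr : u_coef R p N ^+ 2 = p%:R / 2 * (p.-1`!%:R / N%:R ^+ p.-1).
Proof.
rewrite /u_coef sqr_sqrtr; last by rewrite divr_ge0 ?mulr_ge0 ?exprn_ge0 ?ler0n.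
have N0 : N%:R != 0 :> R by rewrite pnatr_eq0 -lt0n.
rewrite -{1}(prednK (ltnW hp)) factS natrM prednK; last exact: ltnW.
by field; rewrite expf_neq0.
Qed.

Lemma cavity_gamma_approx s s' :
  `|cavity_gamma s s' - beta ^+ 2 * (p%:R / 2) * (cavity_overlap i s s' ^+ p.-1 - q ^+ p.-1)|
    <= beta ^+ 2 * (p%:R / 2) * p.-1%:R ^+ 2 / N%:R.
Proof.
have N0 : 0 < N%:R :> R by rewrite ltr0n.
rewrite /cavity_gamma cavity_std_sqr u_coef_sqr.
pose y x : R := (x != i)%:R * agree s s' x.
have y1 x : `|y x| <= 1.
  by rewrite /y normrM norm_agree mulr1 normr_nat lern1 leq_b1.
have ey : \sum_x y x = N%:R * cavity_overlap i s s'.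
  rewrite /cavity_overlap mulrA divff ?gt_eqF// mul1r [RHS]big_mkcond.
  by apply: eq_bigr => x _; rewrite /y; case: (x != i); rewrite ?mul1r ?mul0r.
have := elementary_symmetric_power p.-1 y1; rewrite ey exprMn.
set E := \sum_(A | _) _; set r := cavity_overlap i s s' ^+ p.-1; set F := p.-1`!%:R.
move=> bnd; have Nk : 0 < N%:R ^+ p.-1 :> R by rewrite exprn_gt0.
have -> : beta ^+ 2 * (p%:R / 2 * (F / N%:R ^+ p.-1)) * E - beta ^+ 2 * (p%:R / 2) * q ^+ p.-1 -
    beta ^+ 2 * (p%:R / 2) * (r - q ^+ p.-1) =
    beta ^+ 2 * (p%:R / 2) * ((F * E - N%:R ^+ p.-1 * r) / N%:R ^+ p.-1).
  by field; rewrite gt_eqF.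
have bp : 0 <= beta ^+ 2 * (p%:R / 2) by rewrite mulr_ge0 ?sqr_ge0 ?divr_ge0 ?ler0n.
rewrite normrM (ger0_norm bp) -mulrA ler_wpM2l// normrM normfV (ger0_norm (ltW Nk)).
rewrite ler_pdivrMr//; apply: le_trans bnd _; rewrite -[leRHS]mulrA ler_wpM2l ?sqr_ge0//.
have -> : p.-1 = p.-2.+1 by rewrite prednK// -ltnS prednK// ltnW.
by rewrite /= exprS mulrA mulVf ?mul1r// gt_eqF.
Qed.

(** A bound of order one, uniform over configurations; it enters only the exponent of the Gronwall
    factor. *)
Lemma norm_cavity_gamma_le s s' : `|cavity_gamma s s'| <= beta ^+ 2 * p%:R.
Proof.
have N0 : 0 < N%:R :> R by rewrite ltr0n.
have [q0 q1] := andP hq.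
rewrite /cavity_gamma cavity_std_sqr u_coef_sqr.
pose y x : R := (x != i)%:R * agree s s' x.
have y1 x : `|y x| <= 1.
  by rewrite /y normrM norm_agree mulr1 normr_nat lern1 leq_b1.
have bp : 0 <= beta ^+ 2 * (p%:R / 2) by rewrite mulr_ge0 ?sqr_ge0 ?divr_ge0 ?ler0n.
have Nk : 0 < N%:R ^+ p.-1 :> R by rewrite exprn_gt0.
apply: le_trans (ler_normB _ _) _.
have -> : beta ^+ 2 * p%:R = beta ^+ 2 * (p%:R / 2) + beta ^+ 2 * (p%:R / 2) by field.
apply: lerD; last first.
  rewrite normrM (ger0_norm bp) ler_piMr// norm_expr_le1//.
  by rewrite ger0_norm.
set E := \sum_(A | _) _; set F := p.-1`!%:R.
have bnd : `|F * E| <= N%:R ^+ p.-1 by exact: elementary_symmetric_le.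
have -> : beta ^+ 2 * (p%:R / 2 * (F / N%:R ^+ p.-1)) * E =
    beta ^+ 2 * (p%:R / 2) * (F * E / N%:R ^+ p.-1) by ring.
rewrite normrM (ger0_norm bp) ler_piMr//.
by rewrite normrM normfV (ger0_norm (ltW Nk)) ler_pdivrMr// mul1r.
Qed.

Lemma norm_kernel_le s s' : `|kernel cavity_coef cavity_dir s s'| <= beta ^+ 2 * p%:R.
Proof. by rewrite cavity_kernelE normrM norm_agree mul1r norm_cavity_gamma_le. Qed.

End cavity_model.

(** * The spin at the site once its couplings are off *)

Section flips.
Context {R : realType} {N : nat} (i : 'I_N).
Local Notation spin := (spin R).
Local Notation S := (config N).

Definition flip_site (s : S) : S := [ffun x => if x == i then ~~ s x else s x].

Lemma flip_siteK : involutive flip_site.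
Proof. by move=> s; apply/ffunP => x; rewrite !ffunE; case: eqP => // _; rewrite negbK. Qed.

Lemma spin_flip_self s : spin (flip_site s) i = - spin s i.
Proof. by rewrite /Defs.spin ffunE eqxx; case: (s i); rewrite ?expr0 ?expr1 ?opprK. Qed.

Lemma spin_flip_other s x : x != i -> spin (flip_site s) x = spin s x.
Proof. by move=> /negbTE xi; rewrite /Defs.spin ffunE xi. Qed.

Context {L : finType}.
Implicit Types (f g : {ffun L -> S} -> R) (l : L).

Definition flip l (s : {ffun L -> S}) : {ffun L -> S} :=
  [ffun k => if k == l then flip_site (s k) else s k].

Lemma flipK l : involutive (flip l).
Proof.
move=> s; apply/ffunP => k; rewrite !ffunE; case: eqP => // _; exact: flip_siteK.
Qed.

(** Not depending on the spin at [i] of replica [l], expressed through the only nontrivial move of a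
    two-valued spin. *)
Definition flip_inv l f := forall s, f (flip l s) = f s.

Lemma sum_flip_odd l f : (forall s, f (flip l s) = - f s) -> \sum_s f s = 0.
Proof.
move=> fodd; have : \sum_s f s = - \sum_s f s.
  rewrite {1}(reindex_inj (inv_inj (flipK l))) -sumrN.
  by apply: eq_bigr => s _; rewrite fodd.
by move/eqP; rewrite -addr_eq0 -mulr2n mulrn_eq0/= => /eqP.
Qed.

(** Given everything else the spin [e] has weight [expR (c * e)], which equals [ch + e * sh] because
    [e] is 1 or -1. Terms odd in [e] sum to zero, so inserting [e] exchanges [ch] for [sh], and the
    ratio is [tanh c]. *)
Lemma avg_flip (s0 : S) (X V : S -> R) (c : R) l f :
  (forall s, X s = V s + c * spin s i) -> (forall s, V (flip_site s) = V s) ->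
  flip_inv l f -> avg X (fun s => f s * spin (s l) i) = tanh c * avg X f.
Proof.
move=> XV Vflip finv; rewrite !(avg_gibbsE s0) mulrCA; congr (_ * _).
pose m (s : {ffun L -> S}) := f s * expR (V (s l) + \sum_(k | k != l) X (s k)).
pose e (s : {ffun L -> S}) := spin (s l) i.
pose ch := (expR c + expR (- c)) / 2; pose sh := (expR c - expR (- c)) / 2.
have m_inv s : m (flip l s) = m s.
  rewrite /m finv ffunE eqxx Vflip; congr (_ * expR (_ + _)).
  by apply: eq_bigr => k /negbTE kl; rewrite ffunE kl.
have e_odd s : e (flip l s) = - e s by rewrite /e ffunE eqxx spin_flip_self.
have e2 s : e s * e s = 1 by exact: spin_sqr.
have fE s : f s * expR (\sum_k X (s k)) = m s * (ch + e s * sh).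
  rewrite (bigD1 l)//= XV addrAC expRD mulrA; congr (_ * _).
  rewrite /e /ch /sh /Defs.spin; case: (s l i); rewrite ?expr0 ?expr1.
    by rewrite mulrN1; field.
  by rewrite mulr1; field.
have me0 : \sum_s m s * e s = 0.
  by apply: (@sum_flip_odd l) => s; rewrite m_inv e_odd mulrN.
have -> : \sum_s f s * spin (s l) i * expR (\sum_k X (s k)) = sh * \sum_s m s.
  transitivity (\sum_s (ch * (m s * e s) + sh * m s)).
    apply: eq_bigr => s _; rewrite mulrAC fE -[spin _ _]/(e s).
    transitivity (ch * (m s * e s) + sh * m s * (e s * e s)); first by ring.
    by rewrite e2 mulr1.
  by rewrite big_split/= -!mulr_sumr me0 mulr0 add0r.
have -> : \sum_s f s * expR (\sum_k X (s k)) = ch * \sum_s m s.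
  transitivity (\sum_s (ch * m s + sh * (m s * e s))).
    by apply: eq_bigr => s _; rewrite fE; ring.
  by rewrite big_split/= -!mulr_sumr me0 mulr0 addr0.
have ch0 : ch != 0.
  by rewrite /ch gt_eqF// divr_gt0// addr_gt0 ?expR_gt0.
have -> : tanh c = sh / ch.
  by rewrite /tanh /sh /ch; field; rewrite gt_eqF// addr_gt0 ?expR_gt0.
by rewrite mulrA divfK.
Qed.

End flips.

Section tanh_facts.
Context {R : realType}.

Lemma norm_tanh_le1 (c : R) : `|tanh c| <= 1.
Proof.
have a := expR_gt0 c; have b := expR_gt0 (- c).
have ab : 0 < expR c + expR (- c) by rewrite addr_gt0.
rewrite /tanh normrM normfV (ger0_norm (ltW ab)) ler_pdivrMr// mul1r.
by rewrite ler_norml; apply/andP; split; lra.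
Qed.

Lemma measurable_tanh : measurable_fun setT (@tanh R).
Proof.
apply: continuous_measurable_fun => x; rewrite /tanh.
have c1 : {for x, continuous (fun x : R => expR x)} by exact: continuous_expR.
have c2 : {for x, continuous (fun x : R => expR (- x))}.
  by apply: continuous_comp; [exact: opp_continuous|exact: continuous_expR].
apply: (@continuousM _ _ (fun y : R => expR y - expR (- y))
  (fun y : R => (expR y + expR (- y))^-1)); first exact: continuousB.
apply: continuousV; last exact: continuousD.
by rewrite gt_eqF// addr_gt0 ?expR_gt0.
Qed.

End tanh_facts.

Section cavity_zero.
Context {R : realType} (p N : nat) (beta h q : R) (i : 'I_N).
Local Notation J := (option (multi_index p N)).
Local Notation S := (config N).
Local Notation spin := (spin R).
Local Notation gauss := (normal_prob 0 1 : probability (measurableTypeR R) R).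
Local Notation b := (cavity_std p beta q).
Local Notation X := (path_field (@cavity_coef R p N beta q i) (@field_term R N h) (@cavity_dir p N i)).
Let s0 : S := [ffun=> false].

Definition cavity_free (x : J -> R) (s : S) : R :=
  \sum_(t : multi_index p N | i \notin val (val t)) x (Some t) * cavity_coef beta q i (Some t) s
  + h * \sum_(k | k != i) spin s k.

Lemma path_field0 x s : X 0 x s = cavity_free x s + (b * x None + h) * spin s i.
Proof.
rewrite /path_field /field_term /cavity_free sum_option/= {1}/coef/= subr0 sqrtr1 mul1r.
rewrite (bigD1 i)//= -addrA; rewrite (_ : \sum_j _ =
  \sum_(t : multi_index p N | i \notin val (val t)) x (Some t) * cavity_coef beta q i (Some t) s).
  by ring.
rewrite [RHS]big_mkcond; apply: eq_bigr => t _; rewrite /coef/=.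
by case: ifP => _; rewrite ?mul1r// sqrtr0 mul0r mulr0.
Qed.

Lemma cavity_free_flip x s : cavity_free x (flip_site i s) = cavity_free x s.
Proof.
congr (_ + _ * _); last by apply: eq_bigr => k ki; rewrite spin_flip_other.
apply: eq_bigr => t it; congr (_ * (_ * _)).
apply: eq_bigr => k _; rewrite spin_flip_other//.
by apply: contraNneq it => <-; exact: mem_tnth.
Qed.

Lemma avg0_flip (L : finType) x l (f : {ffun L -> S} -> R) : flip_inv i l f ->
  avg (X 0 x) (fun s => f s * spin (s l) i) = tanh (b * x None + h) * avg (X 0 x) f.
Proof.
by apply: (avg_flip s0); [exact: path_field0|exact: cavity_free_flip].
Qed.

(* All replicas see the same extra field, so at [t = 0] its value is irrelevant to
   functions that ignore the site [i]. *)
Lemma avg0_extra (L : finType) x y (f : {ffun L -> S} -> R) : (forall l, flip_inv i l f) ->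
  avg (X 0 (upd x None y)) f = avg (X 0 (upd x None 0)) f.
Proof.
move=> finv; pose F (y : R) := avg (X 0 (upd x None y)) f.
apply: (@is_derive_0_is_cst R F) => z.
have D := is_derive_avg_upd s0 (@cavity_coef R p N beta q i) (@field_term R N h) (@cavity_dir p N i)
  0 None x z f.
apply: (is_derive_eq D).
have someI : injective (@Some L) by move=> ? ? [].
have res_inv o : flip_inv i o (fun s : {ffun option L -> S} => f (restr Some s)).
  move=> s; case: o => [l|]; last first.
    by congr f; apply/ffunP => k; rewrite !ffunE.
  rewrite -(finv l (restr Some s)); congr f; apply/ffunP => k; rewrite !ffunE.
  by rewrite (inj_eq someI).
have tiltE (s : {ffun option L -> S}) : tilt (@cavity_coef R p N beta q i None) f s =
    b * (\sum_l f (restr Some s) * spin (s (Some l)) i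
      - #|L|%:R * (f (restr Some s) * spin (s None) i)).
  rewrite /tilt /= -mulr_sumr -mulr_sumr; ring.
rewrite (_ : avg _ _ = 0) ?mulr0//.
transitivity (b * (\sum_l avg (X 0 (upd x None z))
     (fun s : {ffun option L -> S} => f (restr Some s) * spin (s (Some l)) i)
  - #|L|%:R * avg (X 0 (upd x None z))
     (fun s : {ffun option L -> S} => f (restr Some s) * spin (s None) i))).
  rewrite -avg_sum -avgZ -avgB -avgZ; apply: eq_bigr => s _; congr (_ * _).
  exact: tiltE.
rewrite avg0_flip//; under eq_bigr do rewrite avg0_flip//.
set c := tanh _ * _; have -> : \sum_(l : L) c = #|L|%:R * c.
  by rewrite sumr_const -[LHS]mulr_natl.
by rewrite subrr mulr0.
Qed.

Context d (T : measurableType d) (P : probability T R).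
Context (xi : T -> cyl R (multi_index p N)) (xiG : iid_gaussian P xi).
Local Notation Q := (P \x gauss)%E.

Definition cavity_nu (t : R) (L : finType) (f : {ffun L -> S} -> R) : R :=
  nu_path Q (extend_field xi) (@cavity_coef R p N beta q i) (@field_term R N h) (@cavity_dir p N i) t f.

(** [a] gives the conditional mean of [g] as a function of the field at the site. As the average of
    [f] does not see the extra field, it depends on the disorder alone, and Fubini separates the
    two. *)
Lemma cavity_nu0_decouple (L : finType) (f g : {ffun L -> S} -> R) (a : R -> R) (C : R) :
  measurable_fun setT a -> (forall c, `|a c| <= C) ->
  (forall l, flip_inv i l f) ->
  (forall x, avg (X 0 x) (fun s => f s * g s) = a (b * x None + h) * avg (X 0 x) f) ->
  cavity_nu 0 (fun s => f s * g s) = (\int[gauss]_y a (b * y + h)) * cavity_nu 0 f.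
Proof.
move=> ma aC finv fg; pose x0 w := extend_field xi (w, 0).
pose G w := avg (X 0 (x0 w)) f.
have updE (z : T * measurableTypeR R) : extend_field xi z = upd (x0 z.1) None z.2.
  by apply/funext => -[j|].
have GE z : avg (X 0 (extend_field xi z)) f = G z.1.
  transitivity (avg (X 0 (upd (x0 z.1) None z.2)) f); first by rewrite -updE.
  have e0 : upd (x0 z.1) None 0 = x0 z.1 by apply/funext => -[j|].
  by rewrite (avg0_extra _ _ finv) e0.
have mx0 j : measurable_fun setT (fun w => x0 w j).
  by case: j => [j|] /=; [exact: xiG.1|exact: measurable_cst].
have mG : measurable_fun setT G.
  apply: (measurableT_comp (measurable_avg_path (@cavity_coef R p N beta q i) (@field_term R N h) (@cavity_dir p N i) 0 f)).
  exact: measurable_cyl.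
have GC w : `|G w| <= \sum_s `|f s| by exact: (avg_bound s0).
have mb : measurable_fun setT (fun y : R => a (b * y + h)).
  apply: (measurableT_comp ma); apply: continuous_measurable_fun => y.
  by apply: cvgD; [apply: cvgM; [exact: cvg_cst|exact: cvg_id]|exact: cvg_cst].
rewrite /cavity_nu /nu_path.
transitivity (\int[Q]_z (a (b * z.2 + h) * G z.1)).
  by apply: eq_Rintegral => z _; rewrite fg GE.
apply: (etrans (Rintegral_prod P mb mG (fun y => aC _) GC)).
congr (_ * _); apply: (etrans (esym (Rintegral_fst P mG GC))).
by apply: eq_Rintegral => z _; rewrite GE.
Qed.

End cavity_zero.

(** * Fourth moment of the overlap *)

Section elementary_inequalities.
Context {R : realFieldType}.
Implicit Types (a b m eta : R).

Lemma young31 a b : 0 <= a -> 0 <= b -> a ^+ 3 * b <= (3 * a ^+ 4 + b ^+ 4) / 4.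
Proof.
move=> a0 b0; have h : 0 <= (a - b) ^+ 2 * (3 * a ^+ 2 + 2 * a * b + b ^+ 2).
  by rewrite mulr_ge0 ?sqr_ge0// !addr_ge0 ?mulr_ge0 ?sqr_ge0.
have e : (3 * a ^+ 4 + b ^+ 4) / 4 - a ^+ 3 * b =
    (a - b) ^+ 2 * (3 * a ^+ 2 + 2 * a * b + b ^+ 2) / 4 by field.
by rewrite -subr_ge0 e divr_ge0.
Qed.

(** Absorbs the error [m * a^3] into a small multiple of the fourth power; [a <= 2] makes [4 - a^2]
    nonnegative after completing the square. *)
Lemma cube_small a m eta : 0 <= a <= 2 -> 0 <= m -> 0 < eta ->
  m * a ^+ 3 <= eta * a ^+ 4 + m ^+ 2 / eta.
Proof.
move=> /andP[a0 a2] m0 eta0.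
have e : eta * a ^+ 4 + m ^+ 2 / eta - m * a ^+ 3 =
  ((2 * eta * a ^+ 2 - m * a) ^+ 2 + m ^+ 2 * (4 - a ^+ 2)) / (4 * eta).
  by field; rewrite gt_eqF.
rewrite -subr_ge0 e divr_ge0 ?mulr_ge0 ?(ltW eta0)//.
rewrite addr_ge0 ?sqr_ge0// mulr_ge0 ?sqr_ge0// subr_ge0.
by rewrite (_ : 4 = 2 ^+ 2); [rewrite ler_pXn2r ?nnegrE|ring].
Qed.

(** For passing between the overlaps with and without the site. The factor 17/16 is close enough to
    1 for the coefficient of the fourth moment to stay below 4/5 in the end. *)
Lemma quartic_shift a b m : `|a| <= 2 -> 0 <= m <= 1 -> `|b - a| <= m ->
  b ^+ 4 <= 17 / 16 * a ^+ 4 + 289 * m ^+ 2.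
Proof.
move=> a2 /andP[m0 m1] ba.
have bam : `|b| <= `|a| + m.
  by rewrite -[b](subrK a) addrC (le_trans (ler_normD _ _))// lerD2l.
have -> : b ^+ 4 = `|b| ^+ 4 by rewrite -normrX ger0_norm// exprn_even_ge0.
have -> : a ^+ 4 = `|a| ^+ 4 by rewrite -normrX ger0_norm// exprn_even_ge0.
have h : `|b| ^+ 4 <= (`|a| + m) ^+ 4.
  by rewrite ler_pXn2r ?nnegrE// addr_ge0.
apply: le_trans h _; move: (normr_ge0 a) a2; move: `|a| => w w0 w2.
have h1 : 8 * (w ^+ 2 * m) <= w ^+ 4 / 16 + 256 * m ^+ 2.
  by have := sqr_ge0 (w ^+ 2 / 4 - 16 * m); lra.
have m2 := sqr_ge0 m.
have h2 : 4 * (w ^+ 3 * m) <= 8 * (w ^+ 2 * m).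
  have z0 : 0 <= w ^+ 2 * m by rewrite mulr_ge0 ?sqr_ge0.
  by have := ler_wpM2r z0 w2; lra.
have h3 : w ^+ 2 <= 4 by have := ler_pM w0 w0 w2 w2; lra.
have h4 : 6 * (w ^+ 2 * m ^+ 2) <= 24 * m ^+ 2 by have := ler_wpM2r m2 h3; lra.
have h5 : 4 * (w * m ^+ 3) <= 8 * m ^+ 2.
  have wm : w * m <= 2 by have := ler_pM w0 m0 w2 m1; lra.
  by have := ler_wpM2r m2 wm; lra.
have h6 : m ^+ 4 <= m ^+ 2.
  have mm : m ^+ 2 <= 1 by have := ler_pM m0 m0 m1 m1; lra.
  by have := ler_wpM2r m2 mm; lra.
have -> : (w + m) ^+ 4 = w ^+ 4 + 4 * (w ^+ 3 * m) + 6 * (w ^+ 2 * m ^+ 2) +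
  4 * (w * m ^+ 3) + m ^+ 4 by ring.
lra.
Qed.

Lemma cubic_shift a b m : 0 <= m <= 1 -> `|b - a| <= m ->
  2 * `|a ^+ 3 - b ^+ 3| <= a ^+ 4 / 16 + 406 * m ^+ 2.
Proof.
move=> /andP[m0 m1] ba.
have bam : `|b| <= `|a| + m.
  by rewrite -[b](subrK a) addrC (le_trans (ler_normD _ _))// lerD2l.
have -> : a ^+ 3 - b ^+ 3 = (a - b) * (a ^+ 2 + a * b + b ^+ 2) by ring.
rewrite normrM distrC.
have -> : a ^+ 4 = `|a| ^+ 4 by rewrite -normrX ger0_norm// exprn_even_ge0.
have h1 : `|a ^+ 2 + a * b + b ^+ 2| <= 5 * `|a| ^+ 2 + 3 * m ^+ 2.
  apply: le_trans (ler_normD _ _) _.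
  apply: le_trans (lerD (ler_normD _ _) (lexx _)) _; rewrite !normrX normrM.
  move: (normr_ge0 a) (normr_ge0 b) bam; move: `|a| `|b| => w z w0 z0 zw.
  have : z ^+ 2 <= (w + m) ^+ 2 by rewrite ler_pXn2r ?nnegrE// addr_ge0.
  have : w * z <= w * (w + m) by rewrite ler_wpM2l.
  by have := sqr_ge0 (w - m); have := sqr_ge0 w; have := sqr_ge0 m; lra.
apply: (@le_trans _ _ (2 * (m * (5 * `|a| ^+ 2 + 3 * m ^+ 2)))).
  by rewrite ler_wpM2l// ler_pM.
move: (`|a|) => w.
have h2 : 10 * (m * w ^+ 2) <= w ^+ 4 / 16 + 400 * m ^+ 2.
  by have := sqr_ge0 (w ^+ 2 / 4 - 20 * m); lra.
have h3 : m * m ^+ 2 <= m ^+ 2 by have := ler_wpM2r (sqr_ge0 m) m1; lra.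
lra.
Qed.

End elementary_inequalities.

Section pairs.
Context {R : realType} {S : finType}.

(** Replicas indexed by [bool]: under the averages any two distinct replicas can be renamed to
    these, so the moments of all pairs become one quantity. *)
Definition pair_fun (F : S -> S -> R) (s : {ffun bool -> S}) : R := F (s true) (s false).

Definition pair_inj {L : finType} (l l' : L) (b : bool) : L := if b then l else l'.

Lemma pair_injP {L : finType} (l l' : L) : l != l' -> injective (pair_inj l l').
Proof. by move=> ll' [] [] //= e; move: ll'; rewrite e eqxx. Qed.

Lemma pair_funE {L : finType} (l l' : L) (F : S -> S -> R) (s : {ffun L -> S}) :
  F (s l) (s l') = pair_fun F (restr (pair_inj l l') s).
Proof. by rewrite /pair_fun !ffunE. Qed.

End pairs.

Section moments.
Context {R : realType} (p N : nat) (beta h q : R).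
Hypotheses (hp : (2 <= p)%N) (hq : 0 <= q <= 1) (N_gt0 : (0 < N)%N).
Context d (T : measurableType d) (P : probability T R).
Context (xi : T -> cyl R (multi_index p N)) (xiG : iid_gaussian P xi).
Local Notation S := (config N).
Local Notation gauss := (normal_prob 0 1 : probability (measurableTypeR R) R).
Local Notation b := (cavity_std p beta q).
Local Notation m := (N%:R^-1 : R).
Local Notation nu i := (cavity_nu beta h q i P xi).
Local Notation kern i := (kernel (@cavity_coef R p N beta q i) (@cavity_dir p N i)).
Let s0 : S := [ffun=> false].

Definition gibbs_nu (L : finType) (f : {ffun L -> S} -> R) : R :=
  \int[P]_w avg (fun s => - hamiltonian beta h (xi w) s) f.

Definition extG := iid_gaussian_extend xiG.

Lemma measurable_avg_hamiltonian (L : finType) (f : {ffun L -> S} -> R) :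
  measurable_fun setT (fun w => avg (fun s => - hamiltonian beta h (xi w) s) f).
Proof.
apply: measurable_avg => s; rewrite /hamiltonian.
under eq_fun do rewrite opprK.
apply: measurable_funD => //; apply: measurable_funM => //.
by apply: measurable_sum => t; apply: measurable_funM => //; exact: xiG.1.
Qed.

(** At [t = 1] the replacing field has coefficient zero, so the paths of all sites end at the same
    Gibbs average. *)
Lemma cavity_nu1 i (L : finType) (f : {ffun L -> S} -> R) : nu i 1 f = gibbs_nu f.
Proof.
rewrite /gibbs_nu /cavity_nu /nu_path.
have mG := measurable_avg_hamiltonian f.
have GC w : `|avg (fun s => - hamiltonian beta h (xi w) s) f| <= \sum_s `|f s|.
  exact: (avg_bound s0).
apply: etrans (Rintegral_fst P mG GC).
have XE z : path_field (@cavity_coef R p N beta q i) (field_term h) (@cavity_dir p N i) 1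
    (extend_field xi z) = (fun s => - hamiltonian beta h (xi z.1) s).
  by apply/funext => s; exact: path_field1.
by apply: eq_Rintegral => z _; rewrite XE.
Qed.

Section cavity_nu_linearity.
Context (i : 'I_N) (t : R) {L : finType}.
Implicit Types f g : {ffun L -> S} -> R.

Lemma cavity_nuD f g : nu i t (fun s => f s + g s) = nu i t f + nu i t g.
Proof. exact: (nuD extG s0). Qed.

Lemma cavity_nuB f g : nu i t (fun s => f s - g s) = nu i t f - nu i t g.
Proof. exact: (nuB extG s0). Qed.

Lemma cavity_nuZ c f : nu i t (fun s => c * f s) = c * nu i t f.
Proof. exact: (nuZ extG s0). Qed.

Lemma cavity_nu_sum (I : finType) (f : I -> {ffun L -> S} -> R) :
  nu i t (fun s => \sum_j f j s) = \sum_j nu i t (f j).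
Proof. exact: (nu_sum extG s0). Qed.

Lemma cavity_nu_le f g : (forall s, f s <= g s) -> nu i t f <= nu i t g.
Proof. exact: (nu_le extG s0). Qed.

Lemma cavity_nu_ge0 f : (forall s, 0 <= f s) -> 0 <= nu i t f.
Proof. exact: (nu_ge0 extG s0). Qed.

Lemma cavity_nu_norm_le f g : (forall s, `|f s| <= g s) -> `|nu i t f| <= nu i t g.
Proof. exact: (nu_norm_le extG s0). Qed.

Lemma cavity_nu_cst c : nu i t (fun _ : {ffun L -> S} => c) = c.
Proof. exact: (nu_cst _ _ s0). Qed.

Lemma eq_cavity_nu f g : (forall s, f s = g s) -> nu i t f = nu i t g.
Proof. by move=> /funext ->. Qed.

Lemma cavity_nu_pair (l l' : L) (F : S -> S -> R) : l != l' ->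
  nu i t (fun s : {ffun L -> S} => F (s l) (s l')) = nu i t (pair_fun F).
Proof.
move=> ll'; apply: etrans (nu_restr _ _ s0 _ _ _ _ _ (pair_injP ll')).
by apply: eq_nu => s; exact: pair_funE.
Qed.

End cavity_nu_linearity.

(** The factor of [nu_gronwall] for two replicas: charge mass 10 times the uniform kernel bound
    [beta^2 p]. *)
Definition growth : R := expR (10 * (beta ^+ 2 * p%:R)).

Lemma growth_ge1 : 1 <= growth.
Proof.
have : 0 <= 10 * (beta ^+ 2 * p%:R) by rewrite mulr_ge0// mulr_ge0 ?sqr_ge0 ?ler0n.
by rewrite -ler_expR expR0.
Qed.

Lemma cavity_nu_gronwall i (f : {ffun bool -> S} -> R) t : (forall s, 0 <= f s) ->
  0 <= t <= 1 -> nu i t f <= growth * nu i 1 f.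
Proof.
move=> f0 t01.
have := nu_gronwall extG s0 (field_term h) (kernel_cst beta q i hp) f0 (norm_kernel_le beta i hp hq N_gt0) t01.
rewrite card_bool (_ : 2 * 2%:R ^+ 2 + 2%:R = 10 :> R); last by ring.
exact.
Qed.

(** [kappa1] is the Lipschitz constant of the kernel in the overlap deviation; [kappa2] is the
    constant of its [1/N] error and later also bounds the quadratic Taylor remainder. *)
Definition kappa1 : R := beta ^+ 2 * (p%:R / 2) * p.-1%:R.
Definition kappa2 : R := beta ^+ 2 * (p%:R / 2) * p.-1%:R ^+ 2.

Definition dev (i : 'I_N) (s s' : S) : R := cavity_overlap i s s' - q.

Lemma norm_dev_le2 i s s' : `|dev i s s'| <= 2.
Proof.
have [q0 q1] := andP hq.
apply: le_trans (ler_normB _ _) _; rewrite (_ : 2 = 1 + 1)//.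
by rewrite lerD// ?norm_cavity_overlap// ger0_norm.
Qed.

Lemma norm_kernel_dev i s s' : `|kern i s s'| <= kappa1 * `|dev i s s'| + kappa2 * m.
Proof.
have [q0 q1] := andP hq.
rewrite cavity_kernelE// normrM norm_agree mul1r.
have h1 := cavity_gamma_approx beta i hp hq N_gt0 s s'.
have h2 : `|cavity_overlap i s s' ^+ p.-1 - q ^+ p.-1| <= p.-1%:R * `|dev i s s'|.
  by apply: norm_subrX; rewrite ?norm_cavity_overlap// ger0_norm.
rewrite -[cavity_gamma _ _ _ _ _ _](subrK (beta ^+ 2 * (p%:R / 2) *
  (cavity_overlap i s s' ^+ p.-1 - q ^+ p.-1))).
apply: le_trans (ler_normD _ _) _; rewrite [leRHS]addrC lerD//.
have bp : 0 <= beta ^+ 2 * (p%:R / 2) by rewrite mulr_ge0 ?sqr_ge0 ?divr_ge0 ?ler0n.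
by rewrite normrM (ger0_norm bp) /kappa1 -mulrA ler_wpM2l.
Qed.

Section site_moment.
Variable i : 'I_N.
Local Notation x := (dev i).
Let fourth t := nu i t (pair_fun (fun s s' => `|x s s'| ^+ 4)).

Hypothesis small : 20 * kappa1 * growth <= 5 / 8.
Hypothesis kappa2_gt0 : 0 < kappa2.
Hypothesis qE : \int[gauss]_y (tanh (b * y + h) ^+ 2) = q.

Lemma m01 : 0 <= m <= 1.
Proof. by rewrite invr_ge0 ler0n/= invf_le1 ?ltr0n// ler1n. Qed.

Lemma kappa1_ge0 : 0 <= kappa1.
Proof.
have bp : 0 <= beta ^+ 2 * (p%:R / 2) by rewrite mulr_ge0 ?sqr_ge0 ?divr_ge0 ?ler0n.
by rewrite /kappa1 mulr_ge0.
Qed.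

Lemma dev_flip_inv l : flip_inv i l (pair_fun (fun s s' => x s s' ^+ 3)).
Proof.
move=> s; rewrite /pair_fun /dev /cavity_overlap; congr ((_ * _ - _) ^+ _).
apply: eq_bigr => k ki; rewrite /agree /flip !ffunE.
by case: ifP => _; case: ifP => _; rewrite ?spin_flip_other.
Qed.

Lemma measurable_tanh_affine k : measurable_fun setT (fun y : R => tanh (b * y + h) ^+ k).
Proof.
apply: measurable_funX; apply: (measurableT_comp measurable_tanh).
apply: continuous_measurable_fun => y.
by apply: cvgD; [apply: cvgM; [exact: cvg_cst|exact: cvg_id]|exact: cvg_cst].
Qed.

(** At [t = 0] both spins at [i] see the same field, so their product has conditional mean
    [tanh ^ 2], which [qE] averages to [q]. The cube of the deviation omits the site and factors
    out. *)
Lemma site_moment_zero :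
  nu i 0 (fun s => pair_fun (fun s s' => x s s' ^+ 3) s * pair_fun (fun s s' => agree s s' i - q) s) = 0.
Proof.
rewrite (cavity_nu0_decouple xiG (a := fun c => tanh c ^+ 2 - q) (C := 1 + 1)).
- rewrite RintegralB//.
  + rewrite Rintegral_cst// (_ : fine _ = 1).
      by rewrite mulr1 qE subrr mul0r.
    exact: (congr1 fine (@probability_setT _ _ _ gauss)).
  + apply: (@bounded_integrable _ _ (measurableTypeR R) gauss _ 1).
      exact: measurable_tanh_affine.
    by move=> y; rewrite norm_expr_le1// norm_tanh_le1.
  + exact: finite_measure_integrable_cst.
- apply: measurable_funB => //; apply: measurable_funX; exact: measurable_tanh.
- have [q0 q1] := andP hq.
  move=> c; apply: le_trans (ler_normB _ _) _; rewrite lerD//.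
    by rewrite norm_expr_le1// norm_tanh_le1.
  by rewrite ger0_norm.
- exact: dev_flip_inv.
- move=> y; set F := pair_fun _.
  have e1 : avg (path_field (@cavity_coef R p N beta q i) (field_term h) (@cavity_dir p N i) 0 y)
     (fun s => F s * spin R (s true) i) =
     tanh (b * y None + h) * avg (path_field (@cavity_coef R p N beta q i) (field_term h) (@cavity_dir p N i) 0 y) F.
    by apply: avg0_flip; exact: dev_flip_inv.
  have e2 : avg (path_field (@cavity_coef R p N beta q i) (field_term h) (@cavity_dir p N i) 0 y)
     (fun s => F s * spin R (s true) i * spin R (s false) i) =
     tanh (b * y None + h) * (tanh (b * y None + h) * avg (path_field (@cavity_coef R p N beta q i) (field_term h) (@cavity_dir p N i) 0 y) F).
    (* Second use of [avg0_flip], for the other replica; the first spin is now part of the invariant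
       function. *)
    rewrite -e1; apply: (@avg0_flip R p N beta h q i _ y false (fun s => F s * spin R (s true) i)).
    move=> s; have -> : F (flip i false s) = F s by exact: dev_flip_inv.
    congr (_ * _).
    by rewrite /flip ffunE.
  transitivity (avg (path_field (@cavity_coef R p N beta q i) (field_term h) (@cavity_dir p N i) 0 y)
     (fun s => F s * spin R (s true) i * spin R (s false) i - q * F s)).
    by congr avg; apply/funext => s; rewrite /pair_fun /agree; ring.
  by rewrite avgB avgZ e2; ring.
Qed.

(** Charge mass 10 and the bound 2 on (agreement - q) put [20 * kappa1 * growth], at most 5/8, in
    front of the fourth moment. Young's inequality reduces a product over two pairs of replicas to
    that single moment, all pairs being equivalent. The [1/N] part of the kernel costs another 1/32,
    hence 21/32. *)
Lemma site_moment :
  `|nu i 1 (fun s => pair_fun (fun s s' => x s s' ^+ 3) s * pair_fun (fun s s' => agree s s' i - q) s)|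
  <= 21 / 32 * fourth 1 + 12800 * kappa2 ^+ 2 * growth * m ^+ 2.
Proof.
have alg1 (k1 k2 e F A m2 : R) : k1 * F <= k1 * A -> k2 * (e * F) <= k2 * (e * A) ->
  2 * (k1 / 4 * (3 * F + F) + k2 * (e * F + m2)) <= 2 * (k1 * A + k2 * (e * A + m2)).
  by move=> *; lra.
have alg2 (k1 k2 e u u' z m2 : R) :
  k1 * (u ^+ 3 * u') <= k1 * ((3 * u ^+ 4 + u' ^+ 4) / 4) ->
  k2 * (z * u ^+ 3) <= k2 * (e * u ^+ 4 + m2) ->
  u ^+ 3 * 2 * (k1 * u' + k2 * z) <=
    2 * (k1 / 4 * (3 * u ^+ 4 + u' ^+ 4) + k2 * (e * u ^+ 4 + m2)).
  by move=> *; lra.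
have alg3 (F k k2 g m2 : R) : 20 * k * g * F <= 5 / 8 * F ->
  20 * k * g * F + 20 * (640^-1) * F + 20 * (640 * k2 * g) * m2 <=
  21 / 32 * F + 12800 * k2 * g * m2.
  by move=> *; lra.
(* Chosen so that [20 * kappa2 * eta * growth] is 20/640, that is 1/32. *)
pose eta := (640 * kappa2 * growth)^-1.
have g1 := growth_ge1; have k1 := kappa1_ge0; have [m0 m1] := andP m01.
have g0 : 0 < growth := expR_gt0 _.
have eta0 : 0 < eta.
  have c0 : 0 < 640 :> R by rewrite ltr0n.
  by rewrite /eta invr_gt0; exact: (mulr_gt0 (mulr_gt0 c0 kappa2_gt0) g0).
have [q0 q1] := andP hq.
set f := fun s => _.
have fourth_ge0 t : 0 <= fourth t by apply: cavity_nu_ge0 => s; rewrite exprn_ge0.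
have fourth_le t : 0 <= t <= 1 -> fourth t <= growth * fourth 1.
  by move=> t01; apply: cavity_nu_gronwall => // s; rewrite exprn_ge0.
pose c := 2 * (kappa1 * (growth * fourth 1) + kappa2 * (eta * (growth * fourth 1) + m ^+ 2 / eta)).
have bd t o o' : 0 < t < 1 -> o' != o ->
    nu i t (fun s => `|base f s| * `|kern i (s o) (s o')|) <= c.
  move=> /andP[t0 t1] oo'; have t01 : 0 <= t <= 1 by rewrite !ltW.
  pose l := Some (Some true); pose l' := Some (Some false).
  have ll' : l != l' by [].
  have oo : o != o' by rewrite eq_sym.
  pose M s : R := 2 * (kappa1 / 4 * (3 * `|x (s l) (s l')| ^+ 4 + `|x (s o) (s o')| ^+ 4)
    + kappa2 * (eta * `|x (s l) (s l')| ^+ 4 + m ^+ 2 / eta)).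
  apply: (@le_trans _ _ (nu i t M)).
    apply: cavity_nu_le => s.
    have -> : base f s = x (s l) (s l') ^+ 3 * (agree (s l) (s l') i - q).
      by rewrite /base /f /pair_fun !ffunE.
    have n2 : `|agree (s l) (s l') i - q| <= 2.
      apply: le_trans (ler_normB _ _) _; rewrite norm_agree (_ : 2 = 1 + 1)//.
      by rewrite lerD2l ger0_norm.
    have kb := norm_kernel_dev i (s o) (s o').
    have x2 : 0 <= `|x (s l) (s l')| <= 2 by rewrite normr_ge0 norm_dev_le2.
    rewrite /M normrM normrX.
    move: n2 kb (normr_ge0 (x (s l) (s l'))) (normr_ge0 (x (s o) (s o'))) x2.
    move: `|agree _ _ _ - q| (normr_ge0 (agree (s l) (s l') i - q)) `|kern _ _ _|
      (normr_ge0 (kern i (s o) (s o'))) `|x (s l) (s l')| `|x (s o) (s o')|.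
    move=> z z0 k k0 u u' z2 ku u0 u'0 u2.
    have y1 := young31 u0 u'0.
    have y2 := cube_small u2 m0 eta0.
    have u3 : 0 <= u ^+ 3 by rewrite exprn_ge0.
    apply: (@le_trans _ _ (u ^+ 3 * 2 * (kappa1 * u' + kappa2 * m))).
      by apply: ler_pM => //; [rewrite mulr_ge0|rewrite ler_wpM2l].
    exact: alg2 (ler_wpM2l k1 y1) (ler_wpM2l (ltW kappa2_gt0) y2).
  rewrite /M cavity_nuZ cavity_nuD cavity_nuZ cavity_nuD cavity_nuZ cavity_nuZ cavity_nuD
    !cavity_nuZ cavity_nu_cst.
  rewrite (cavity_nu_pair i t (fun s s' => `|x s s'| ^+ 4) ll').
  rewrite (cavity_nu_pair i t (fun s s' => `|x s s'| ^+ 4) oo) -/(fourth t).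
  have ft := fourth_le t t01.
  have h1 := ler_wpM2l k1 ft.
  have h2 := ler_wpM2l (ltW kappa2_gt0) (ler_wpM2l (ltW eta0) ft).
  exact: alg1 h1 h2.
have := nu_mvt extG s0 (kernel_cst beta q i hp) bd (t := 1).
rewrite ler01 lexx => /(_ isT); rewrite -[nu_path _ _ _ _ _ 1 _]/(nu i 1 f).
rewrite -[nu_path _ _ _ _ _ 0 _]/(nu i 0 f) site_moment_zero subr0 card_bool.
move=> /le_trans; apply.
have e1 : kappa2 * eta * growth = 640^-1 by rewrite /eta; field; rewrite !gt_eqF.
have e2 : kappa2 / eta = 640 * kappa2 ^+ 2 * growth by rewrite /eta invrK; ring.
have -> : (2 * 2%:R ^+ 2 + 2%:R) * c = 20 * kappa1 * growth * fourth 1 +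
    20 * (kappa2 * eta * growth) * fourth 1 + 20 * (kappa2 / eta) * m ^+ 2.
  by rewrite /c; ring.
rewrite e1 e2; exact: alg3 (ler_wpM2r (fourth_ge0 1) small).
Qed.

End site_moment.

End moments.

Lemma quartic_sum (R : realFieldType) (a r : R) : (a + r) ^+ 4 <= 8 * a ^+ 4 + 8 * r ^+ 4.
Proof.
have h1 : (a + r) ^+ 2 <= 2 * (a ^+ 2 + r ^+ 2) by have := sqr_ge0 (a - r); lra.
have h2 := ler_pM (sqr_ge0 (a + r)) (sqr_ge0 (a + r)) h1 h1.
by have := sqr_ge0 (a ^+ 2 - r ^+ 2); lra.
Qed.

Section fourth_moments.
Context {R : realType} (p N : nat) (beta h q : R).
Hypotheses (hp : (2 <= p)%N) (hq : 0 <= q <= 1) (N_gt0 : (0 < N)%N).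
Context d (T : measurableType d) (P : probability T R).
Context (xi : T -> cyl R (multi_index p N)) (xiG : iid_gaussian P xi).
Local Notation S := (config N).
Local Notation gauss := (normal_prob 0 1 : probability (measurableTypeR R) R).
Local Notation b := (cavity_std p beta q).
Local Notation m := (N%:R^-1 : R).
Local Notation nu i := (cavity_nu beta h q i P xi).
Local Notation kern i := (kernel (@cavity_coef R p N beta q i) (@cavity_dir p N i)).
Local Notation growth := (growth p beta).
Local Notation kappa1 := (kappa1 p beta).
Local Notation kappa2 := (kappa2 p beta).
Hypothesis small : 20 * kappa1 * growth <= 5 / 8.
Hypothesis kappa2_gt0 : 0 < kappa2.
Hypothesis qE : \int[gauss]_y (tanh (b * y + h) ^+ 2) = q.

Definition fdev (s s' : S) : R := full_overlap s s' - q.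

Lemma fdev_sub i s s' : `|dev q i s s' - fdev s s'| <= m.
Proof.
rewrite /dev /fdev (full_overlapE i).
set a := cavity_overlap i s s'; set g := agree s s' i.
have -> : a - q - (a + g / N%:R - q) = - (g * m) by ring.
by rewrite normrN normrM norm_agree mul1r ger0_norm ?invr_ge0 ?ler0n.
Qed.

Lemma norm_fdev_le2 s s' : `|fdev s s'| <= 2.
Proof.
have [q0 q1] := andP hq.
apply: le_trans (ler_normB _ _) _; rewrite (_ : 2 = 1 + 1)//.
by rewrite lerD// ?norm_full_overlap// ger0_norm.
Qed.

Lemma fdevE s s' : fdev s s' = m * \sum_i (agree s s' i - q).
Proof.
by rewrite sumrB sumr_const card_ord mulrBr -[q *+ N]mulr_natl mulKf// pnatr_eq0 -lt0n.
Qed.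

(** The factor 5 inverts [1 - 4/5] when the fourth moment is absorbed. *)
Definition moment_cst : R := 5 * (12800 * kappa2 ^+ 2 * growth + 600).

Local Notation X4 := (pair_fun (fun s s' : S => `|fdev s s'| ^+ 4)).
Local Notation i0 := (Ordinal N_gt0).

Lemma moment_cst_ge0 : 0 <= moment_cst.
Proof.
have g0 : 0 <= growth by exact: expR_ge0.
have c1 : 0 <= 12800 :> R by rewrite ler0n.
have c2 : 0 <= 600 :> R by rewrite ler0n.
have c3 : 0 <= 5 :> R by rewrite ler0n.
exact: (mulr_ge0 c3 (addr_ge0 (mulr_ge0 (mulr_ge0 c1 (sqr_ge0 kappa2)) g0) c2)).
Qed.

Lemma dev_fourth_le i :
  nu i 1 (pair_fun (fun s s' => `|dev q i s s'| ^+ 4)) <= 17 / 16 * gibbs_nu beta h P xi X4 + 289 * m ^+ 2.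
Proof.
rewrite -(cavity_nu1 beta h q xiG i X4).
rewrite -(cavity_nuZ beta h q xiG i 1 (17 / 16) X4).
rewrite -[X in _ + X](cavity_nu_cst beta h q P xi i 1 (L := bool)).
rewrite -(cavity_nuD beta h q xiG).
apply: (cavity_nu_le _ _ _ xiG) => s; rewrite /pair_fun.
have e4 (x : R) : `|x| ^+ 4 = x ^+ 4 by rewrite -normrX ger0_norm// exprn_even_ge0.
rewrite !e4; apply: quartic_shift; [exact: norm_fdev_le2|exact: m01|exact: fdev_sub].
Qed.

(** Exchanging the full overlap for the cavity one in [site_moment] turns 21/32 into
    [21/32 * 17/16 + 1/16], still below 4/5; likewise [21/32 * 289 + 406] is below 600. *)
Lemma site_contribution i :
  nu i 1 (pair_fun (fun s s' => fdev s s' ^+ 3 * (agree s s' i - q))) <=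
  4 / 5 * gibbs_nu beta h P xi X4 + (12800 * kappa2 ^+ 2 * growth + 600) * m ^+ 2.
Proof.
have [q0 q1] := andP hq.
have alg (F a k m2 : R) : F <= 17 / 16 * a + 289 * m2 -> 0 <= a -> 0 <= m2 ->
   21 / 32 * F + k * m2 + (a / 16 + 406 * m2) <= 4 / 5 * a + (k + 600) * m2.
  by move=> *; lra.
have sm := site_moment hp hq N_gt0 xiG i small kappa2_gt0 qE.
have dl := dev_fourth_le i.
have a0 : 0 <= gibbs_nu beta h P xi X4.
  rewrite -(cavity_nu1 beta h q xiG i X4).
  by apply: (cavity_nu_ge0 _ _ _ xiG) => s; rewrite exprn_ge0.
apply: le_trans (alg _ _ (12800 * kappa2 ^+ 2 * growth) _ dl a0 (sqr_ge0 m)).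
pose f (s : {ffun bool -> S}) := pair_fun (fun s s' => dev q i s s' ^+ 3) s *
  pair_fun (fun s s' => agree s s' i - q) s.
apply: (@le_trans _ _ (nu i 1 f + (gibbs_nu beta h P xi X4 / 16 + 406 * m ^+ 2))); last first.
  by rewrite lerD2r; apply: le_trans sm; exact: ler_norm.
rewrite -(cavity_nu1 beta h q xiG i X4) mulrC.
rewrite -(cavity_nuZ beta h q xiG i 1 (16^-1) X4).
rewrite -[X in _ + (_ + X)](cavity_nu_cst beta h q P xi i 1 (L := bool)).
rewrite -!(cavity_nuD beta h q xiG).
apply: (cavity_nu_le _ _ _ xiG) => s; rewrite /f /pair_fun.
have e4 (x : R) : `|x| ^+ 4 = x ^+ 4 by rewrite -normrX ger0_norm// exprn_even_ge0.
rewrite e4 mulrC (mulrC (16^-1)).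
have cs := cubic_shift (m01 N_gt0) (fdev_sub i (s true) (s false)).
set u := fdev _ _ in cs *; set w := dev _ _ _ _ in cs *; set g := agree _ _ _.
have n2 : `|g - q| <= 2.
  apply: le_trans (ler_normB _ _) _; rewrite norm_agree (_ : 2 = 1 + 1)//.
  by rewrite lerD2l ger0_norm.
have -> : (g - q) * u ^+ 3 = w ^+ 3 * (g - q) + (g - q) * (u ^+ 3 - w ^+ 3) by ring.
rewrite lerD2l; apply: le_trans (ler_norm _) _; rewrite normrM.
by apply: le_trans cs; rewrite ler_wpM2r.
Qed.

(** Self-consistency: the fourth moment is at most 4/5 of itself plus a term of order [1/N^2]. Being
    a real number, it can be absorbed on the left. *)
Lemma fourth_moment : gibbs_nu beta h P xi X4 <= moment_cst * m ^+ 2.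
Proof.
have alg (a c : R) : a <= 4 / 5 * a + c -> a <= 5 * c by move=> *; lra.
rewrite /moment_cst -mulrA; apply: alg.
have e : gibbs_nu beta h P xi X4 =
    m * \sum_i nu i 1 (pair_fun (fun s s' => fdev s s' ^+ 3 * (agree s s' i - q))).
  rewrite -(cavity_nu1 beta h q xiG i0 X4).
  transitivity (m * nu i0 1 (fun s => \sum_i pair_fun (fun s s' => fdev s s' ^+ 3 * (agree s s' i - q)) s)).
    rewrite -(cavity_nuZ beta h q xiG); apply: eq_cavity_nu => s.
    rewrite /pair_fun -mulr_sumr mulrCA -fdevE -exprSr.
    by rewrite -normrX ger0_norm// exprn_even_ge0.
  apply: (congr1 (fun z => m * z)).
  apply: (etrans (cavity_nu_sum beta h q xiG i0 1
    (fun i => pair_fun (fun s s' => fdev s s' ^+ 3 * (agree s s' i - q))))).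
  apply: eq_bigr => i _.
  exact: etrans (cavity_nu1 beta h q xiG i0 _) (esym (cavity_nu1 beta h q xiG i _)).
have N0 : 0 < N%:R :> R by rewrite ltr0n.
rewrite [leLHS]e ler_pdivrMl//.
apply: le_trans (ler_sum _ (fun i _ => site_contribution i)) _.
rewrite sumr_const card_ord -[leLHS]mulr_natl; exact: lexx.
Qed.

Definition rate : R := (Num.sqrt N%:R)^-1.

Lemma rate_sqr : rate ^+ 2 = m.
Proof. by rewrite /rate exprVn sqr_sqrtr ?ler0n. Qed.

Lemma rate_gt0 : 0 < rate.
Proof. by rewrite /rate invr_gt0 sqrtr_gt0 ltr0n. Qed.

Lemma rate_le1 : rate <= 1.
Proof.
have [_ m1] := andP (m01 (R := R) N_gt0).
by rewrite -(@ler_pXn2r _ 2)// ?nnegrE ?(ltW rate_gt0)// rate_sqr expr1n.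
Qed.

(* The shift by [rate] absorbs the errors of order [1/N] and makes lower moments follow
   from the fourth one, since then [rate <= vdev]. *)
Definition vdev i (s s' : S) : R := `|dev q i s s'| + rate.

Lemma vdev_ge_rate i s s' : rate <= vdev i s s'.
Proof. by rewrite lerDr. Qed.

Lemma vdev_ge0 i s s' : 0 <= vdev i s s'.
Proof. exact: le_trans (ltW rate_gt0) (vdev_ge_rate i s s'). Qed.

Lemma m_le_rate : m <= rate.
Proof. by rewrite -rate_sqr expr2 ler_piMr ?rate_le1// ltW// rate_gt0. Qed.

Lemma norm_dev_vdev i s s' : `|dev q i s s'| <= vdev i s s'.
Proof. by rewrite lerDl ltW// rate_gt0. Qed.

Lemma norm_fdev_vdev i s s' : `|fdev s s'| <= vdev i s s'.
Proof.
rewrite -[fdev s s'](subrK (dev q i s s')) addrC (le_trans (ler_normD _ _))//.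
by rewrite lerD2l distrC (le_trans (fdev_sub i s s'))// m_le_rate.
Qed.

Definition kappa : R := kappa1 + kappa2.

Lemma norm_kernel_vdev i s s' : `|kern i s s'| <= kappa * vdev i s s'.
Proof.
apply: le_trans (norm_kernel_dev beta hp hq N_gt0 i s s') _.
rewrite /kappa mulrDl lerD//; rewrite ler_wpM2l//.
- exact: kappa1_ge0.
- exact: norm_dev_vdev.
- exact: ltW.
- exact: le_trans m_le_rate (vdev_ge_rate i s s').
Qed.

(** The 8 comes from separating the shift by [rate] in the fourth power, [growth] from moving to an
    arbitrary time, and 289 from passing to the cavity overlap. *)
Definition vdev_cst : R := 8 * (growth * (2 * moment_cst + 289) + 1).

Lemma vdev_moment i t k : 0 <= t <= 1 -> (k <= 4)%N ->
  nu i t (pair_fun (fun s s' => vdev i s s' ^+ k)) <= vdev_cst * rate ^+ k.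
Proof.
move=> t01 k4; have r0 := rate_gt0.
have alg (F a g c m2 : R) : F <= 17 / 16 * a + 289 * m2 -> a <= c * m2 -> 0 <= c * m2 ->
    0 <= g -> 8 * (g * F) + 8 * m2 <= 8 * (g * (2 * c + 289) + 1) * m2.
  move=> h1 h2 h3 g0; have h4 : F <= (2 * c + 289) * m2 by lra.
  by have := ler_wpM2l g0 h4; lra.
have x4 : nu i t (pair_fun (fun s s' => vdev i s s' ^+ 4)) <= vdev_cst * rate ^+ 4.
  have r4 : rate ^+ 4 = m ^+ 2 by rewrite -rate_sqr -exprM.
  have cm0 : 0 <= moment_cst * m ^+ 2 by rewrite mulr_ge0 ?sqr_ge0 ?moment_cst_ge0.
  have g0 : 0 <= growth by exact: expR_ge0.
  rewrite r4; apply: le_trans (alg _ _ _ _ _ (dev_fourth_le i) fourth_moment cm0 g0).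
  have gr : nu i t (pair_fun (fun s s' => `|dev q i s s'| ^+ 4)) <=
      growth * nu i 1 (pair_fun (fun s s' => `|dev q i s s'| ^+ 4)).
    by apply: (cavity_nu_gronwall beta h hp hq N_gt0 xiG) => // s; rewrite exprn_ge0.
  apply: (@le_trans _ _ (8 * nu i t (pair_fun (fun s s' => `|dev q i s s'| ^+ 4)) + 8 * m ^+ 2));
    last by rewrite lerD2r ler_wpM2l ?ler0n.
  rewrite -(cavity_nuZ beta h q xiG).
  rewrite -[X in _ + X](cavity_nu_cst beta h q P xi i t (L := bool)).
  rewrite -(cavity_nuD beta h q xiG).
  apply: (cavity_nu_le _ _ _ xiG) => s; rewrite /pair_fun /vdev -r4.
  exact: quartic_sum.
have rk : 0 < rate ^+ (4 - k) by rewrite exprn_gt0.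
rewrite -(ler_pM2l rk) -(cavity_nuZ beta h q xiG).
have -> : rate ^+ (4 - k) * (vdev_cst * rate ^+ k) = vdev_cst * rate ^+ 4.
  by rewrite mulrCA -exprD subnK.
apply: le_trans x4; apply: (cavity_nu_le _ _ _ xiG) => s; rewrite /pair_fun.
rewrite -[in leRHS](subnK k4) exprD ler_wpM2r ?exprn_ge0 ?vdev_ge0//.
by rewrite lerXn2r ?nnegrE ?vdev_ge0 ?(ltW r0)// vdev_ge_rate.
Qed.

End fourth_moments.

(** * Second moment of the mixed differences *)

Section mixed_difference.
Context {R : realType} {S : finType} {L : finType}.
Variables (a a' c c' : L).
Implicit Types (F : S -> S -> R) (s : {ffun L -> S}).

(** The pattern of [Delta] for arbitrary replica labels, since the generator relabels the old
    replicas. As a second difference it is blind to constants. *)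
Definition mixed_diff F s : R :=
  F (s a) (s c) - F (s a) (s c') - F (s a') (s c) + F (s a') (s c').

End mixed_difference.

Section cavity_spins.
Context {R : realType} (p N : nat) (beta h q : R) (i : 'I_N).
Context d (T : measurableType d) (P : probability T R).
Context (xi : T -> cyl R (multi_index p N)) (xiG : iid_gaussian P xi).
Local Notation S := (config N).
Local Notation gauss := (normal_prob 0 1 : probability (measurableTypeR R) R).
Local Notation b := (cavity_std p beta q).
Local Notation X := (path_field (@cavity_coef R p N beta q i) (@field_term R N h) (@cavity_dir p N i)).
Local Notation nu := (cavity_nu beta h q i P xi).
Context {L : finType}.
Implicit Types (f : {ffun L -> S} -> R) (s : {ffun L -> S}) (r : seq L).
Local Notation eps s l := (spin R (s l) i).

Lemma flip_inv_spin l k s : l != k -> eps (flip i l s) k = eps s k.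
Proof. by move=> lk; rewrite /flip ffunE eq_sym (negbTE lk). Qed.

Lemma avg0_spins x f r : uniq r -> (forall l, flip_inv i l f) ->
  avg (X 0 x) (fun s => f s * \prod_(l <- r) eps s l) =
  tanh (b * x None + h) ^+ size r * avg (X 0 x) f.
Proof.
move=> ur finv; elim: r ur => [_|l r IH /= /andP[lr ur]].
  by rewrite mul1r; congr avg; apply/funext => s; rewrite big_nil mulr1.
rewrite exprS -mulrA -(IH ur).
rewrite -(@avg0_flip R p N beta h q i L x l); last first.
  move=> s; rewrite finv; congr (_ * _); apply: eq_big_seq => k kr.
  by apply: flip_inv_spin; apply: contraNneq lr => ->.
by congr avg; apply/funext => s; rewrite big_cons mulrA mulrAC.
Qed.

Variables (a a' c c' : L).
Hypothesis uniq4 : uniq [:: a; a'; c; c'].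

(* [m d] is the mean of a product of two spins of the same replica ([d = 1]) or of
   two distinct replicas ([d = 0]). *)
Lemma avg0_four_spins x f (k l o o' : L) : k != l -> o != o' -> (forall l, flip_inv i l f) ->
  let t := tanh (b * x None + h) in
  let m (d : bool) : R := if d then 1 else t ^+ 2 in
  avg (X 0 x) (fun s => f s * (eps s k * eps s l * (eps s o * eps s o'))) =
  m (k \in [:: o; o']) * m (l \in [:: o; o']) * avg (X 0 x) f.
Proof.
move=> kl oo' finv t m.
have red r : uniq r -> (forall s, eps s k * eps s l * (eps s o * eps s o') = \prod_(j <- r) eps s j) ->
    avg (X 0 x) (fun s => f s * (eps s k * eps s l * (eps s o * eps s o'))) = t ^+ size r * avg (X 0 x) f.
  by move=> ur e; rewrite -avg0_spins//; congr avg; apply/funext => s; rewrite e.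
have red2 j j' : j != j' -> (forall s, eps s k * eps s l * (eps s o * eps s o') = eps s j * eps s j') ->
    avg (X 0 x) (fun s => f s * (eps s k * eps s l * (eps s o * eps s o'))) = t ^+ 2 * avg (X 0 x) f.
  move=> jj' e; apply: (red [:: j; j']) => [|s]; first by rewrite /= inE jj'.
  by rewrite big_cons big_seq1.
have red0 : (forall s, eps s k * eps s l * (eps s o * eps s o') = 1) ->
    avg (X 0 x) (fun s => f s * (eps s k * eps s l * (eps s o * eps s o'))) = avg (X 0 x) f.
  by move=> e; rewrite (red [::])//= ?mul1r// => s; rewrite big_nil.
have sq s j : eps s j * eps s j = 1 by exact: spin_sqr.
rewrite !inE /m; case: (eqVneq k o) => [ko|ko]; [|case: (eqVneq k o') => [ko'|ko']];
  (case: (eqVneq l o) => [lo|lo]; [|case: (eqVneq l o') => [lo'|lo']]) => /=.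
- by rewrite ko lo eqxx in kl.
- by rewrite !mul1r; apply: red0 => s; rewrite ko lo' mulrACA !sq mulr1.
- by rewrite mul1r; apply: (red2 l o') => // s; rewrite ko mulrACA sq mul1r.
- by rewrite !mul1r; apply: red0 => s; rewrite ko' lo (mulrC (eps s o')) mulrACA !sq mulr1.
- by rewrite ko' lo' eqxx in kl.
- by rewrite mul1r; apply: (red2 l o) => // s; rewrite ko' (mulrC (eps s o)) mulrACA sq mul1r.
- by rewrite mulr1; apply: (red2 k o') => // s; rewrite lo -mulrA [X in _ * X]mulrA sq mul1r.
- rewrite mulr1; apply: (red2 k o) => // s.
  by rewrite lo' -mulrA (mulrC (eps s o)) [X in _ * X]mulrA sq mul1r.
- rewrite -exprD; apply: (red [:: k; l; o; o']) => [|s].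
    by rewrite /= !inE !negb_or kl ko ko' lo lo' oo'.
  by rewrite !big_cons big_nil mulr1 !mulrA.
Qed.

Local Notation E s := ((eps s a - eps s a') * (eps s c - eps s c')).

Lemma avg0_mixed x f : (forall l, flip_inv i l f) -> avg (X 0 x) (fun s => f s * E s) = 0.
Proof.
move=> finv; have := uniq4; rewrite /= !inE !negb_or andbT => /and3P[/and3P[aa' ac ac'] /andP[a'c a'c'] cc'].
have two k l : k != l -> avg (X 0 x) (fun s => f s * (eps s k * eps s l)) =
    tanh (b * x None + h) ^+ 2 * avg (X 0 x) f.
  move=> kl; rewrite -(@avg0_spins _ _ [:: k; l])//= ?inE ?kl//.
  by congr avg; apply/funext => s; rewrite !big_cons big_nil mulr1.
transitivity (avg (X 0 x) (fun s => f s * (eps s a * eps s c) - f s * (eps s a * eps s c')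
   - f s * (eps s a' * eps s c) + f s * (eps s a' * eps s c'))).
  by congr avg; apply/funext => s; ring.
by rewrite avgD !avgB !two//; ring.
Qed.

(** Spins square to 1, so the square is [4 (1 - eps_a eps_a') (1 - eps_c eps_c')]. The two factors
    involve distinct replicas, each with conditional mean [1 - tanh^2]. *)
Lemma avg0_mixed_sqr x f : (forall l, flip_inv i l f) ->
  avg (X 0 x) (fun s => f s * E s ^+ 2) =
  4 * (1 - tanh (b * x None + h) ^+ 2) ^+ 2 * avg (X 0 x) f.
Proof.
move=> finv; have := uniq4; rewrite /= !inE !negb_or andbT => /and3P[/and3P[aa' ac ac'] /andP[a'c a'c'] cc'].
have e r : uniq r -> avg (X 0 x) (fun s => f s * \prod_(l <- r) eps s l) =
    tanh (b * x None + h) ^+ size r * avg (X 0 x) f by move=> ur; exact: avg0_spins.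
transitivity (avg (X 0 x) (fun s => 4 * (f s - f s * \prod_(l <- [:: a; a']) eps s l
   - f s * \prod_(l <- [:: c; c']) eps s l + f s * \prod_(l <- [:: a; a'; c; c']) eps s l))).
  congr avg; apply/funext => s; rewrite !big_cons !big_nil.
  have sq j : eps s j ^+ 2 = 1 by rewrite expr2; exact: spin_sqr.
  transitivity (f s * ((eps s a ^+ 2 + eps s a' ^+ 2 - 2 * (eps s a * eps s a')) *
    (eps s c ^+ 2 + eps s c' ^+ 2 - 2 * (eps s c * eps s c')))); first by ring.
  by rewrite !sq; ring.
by rewrite avgZ avgD !avgB !e//= ?inE ?aa' ?cc'//; ring.
Qed.

Local Notation delta k o o' := ((k \in [:: o; o'])%:R : R).

(** By [avg0_four_spins] the alternating sum factors into a difference over [a, a'] times one over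
    [c, c']. Each vanishes unless exactly one of its two replicas lies in the pair, so the pair must
    join the two groups. *)
Lemma avg0_mixed_pair x f o o' : o != o' -> (forall l, flip_inv i l f) ->
  avg (X 0 x) (fun s => f s * (E s * (eps s o * eps s o'))) =
  (1 - tanh (b * x None + h) ^+ 2) ^+ 2 *
    ((delta a o o' - delta a' o o') * (delta c o o' - delta c' o o')) * avg (X 0 x) f.
Proof.
move=> oo' finv; have := uniq4; rewrite /= !inE !negb_or andbT => /and3P[/and3P[aa' ac ac'] /andP[a'c a'c'] cc'].
transitivity (avg (X 0 x) (fun s => f s * (eps s a * eps s c * (eps s o * eps s o'))
  - f s * (eps s a * eps s c' * (eps s o * eps s o'))
  - f s * (eps s a' * eps s c * (eps s o * eps s o'))
  + f s * (eps s a' * eps s c' * (eps s o * eps s o')))).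
  by congr avg; apply/funext => s; ring.
rewrite avgD !avgB !avg0_four_spins//.
have mE (k : bool) t : (if k then 1 else t) = t + k%:R * (1 - t) :> R by case: k => /=; ring.
by rewrite !mE !inE; ring.
Qed.

(** The form in which the factor [1 - 2 q + q4] arises: each of the two differences of spins in [E]
    contributes [1 - tanh^2]. *)
Definition spin_spread : R := \int[gauss]_y (1 - tanh (b * y + h) ^+ 2) ^+ 2.

Lemma spread_bound (y : R) : 0 <= 1 - tanh y ^+ 2 <= 1.
Proof.
rewrite subr_ge0 lerBlDr lerDl sqr_ge0 andbT.
by rewrite -[tanh y ^+ 2]ger0_norm ?sqr_ge0// norm_expr_le1// norm_tanh_le1.
Qed.

Lemma norm_spread_le1 (y : R) : `|(1 - tanh y ^+ 2) ^+ 2| <= 1.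
Proof. by have /andP[t0 t1] := spread_bound y; rewrite norm_expr_le1// ger0_norm. Qed.

Lemma measurable_spread : measurable_fun setT (fun y : R => (1 - tanh y ^+ 2) ^+ 2).
Proof.
apply: measurable_funX; apply: measurable_funB => //; apply: measurable_funX.
exact: measurable_tanh.
Qed.

Lemma nu0_mixed f : (forall l, flip_inv i l f) -> nu 0 (fun s => f s * E s) = 0.
Proof.
move=> finv; rewrite (cavity_nu0_decouple xiG (a := fun=> 0) (C := 0))//.
- by rewrite Rintegral_cst// mul0r mul0r.
- by move=> _; rewrite normr0.
- by move=> x; rewrite avg0_mixed// mul0r.
Qed.

Lemma nu0_mixed_sqr f : (forall l, flip_inv i l f) ->
  nu 0 (fun s => f s * E s ^+ 2) = 4 * spin_spread * nu 0 f.
Proof.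
move=> finv.
rewrite (cavity_nu0_decouple xiG (a := fun y => 4 * (1 - tanh y ^+ 2) ^+ 2) (C := 4))//.
- congr (_ * _); rewrite RintegralZl//.
  apply: (@bounded_integrable _ _ (measurableTypeR R) gauss _ 1).
    apply: (measurableT_comp measurable_spread); apply: continuous_measurable_fun => y.
    by apply: cvgD; [apply: cvgM; [exact: cvg_cst|exact: cvg_id]|exact: cvg_cst].
  by move=> y; exact: norm_spread_le1.
- by apply: measurable_funM => //; exact: measurable_spread.
- by move=> y; rewrite normrM ger0_norm// ler_piMr// norm_spread_le1.
- by move=> x; exact: avg0_mixed_sqr.
Qed.

Lemma nu0_mixed_pair f o o' : o != o' -> (forall l, flip_inv i l f) ->
  nu 0 (fun s => f s * (E s * (eps s o * eps s o'))) =
  spin_spread * ((delta a o o' - delta a' o o') * (delta c o o' - delta c' o o')) * nu 0 f.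
Proof.
move=> oo' finv.
set D := _ * (delta c _ _ - _).
rewrite (cavity_nu0_decouple xiG (a := fun y => D * (1 - tanh y ^+ 2) ^+ 2) (C := `|D|))//.
- rewrite [spin_spread * D]mulrC; congr (_ * _); rewrite RintegralZl//.
  apply: (@bounded_integrable _ _ (measurableTypeR R) gauss _ 1).
    apply: (measurableT_comp measurable_spread); apply: continuous_measurable_fun => y.
    by apply: cvgD; [apply: cvgM; [exact: cvg_cst|exact: cvg_id]|exact: cvg_cst].
  by move=> y; exact: norm_spread_le1.
- by apply: measurable_funM => //; exact: measurable_spread.
- by move=> y; rewrite normrM ler_piMr// norm_spread_le1.
- by move=> x; rewrite avg0_mixed_pair// [D * _]mulrC.
Qed.

End cavity_spins.

Lemma prod3_le (R : realFieldType) (x y z : R) : 0 <= x -> 0 <= y -> 0 <= z ->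
  x * y * z <= x ^+ 3 + y ^+ 3 + z ^+ 3.
Proof.
move=> x0 y0 z0; have x3 : 0 <= x ^+ 3 := exprn_ge0 _ x0.
have y3 : 0 <= y ^+ 3 := exprn_ge0 _ y0; have z3 : 0 <= z ^+ 3 := exprn_ge0 _ z0.
have : 0 <= (x + y + z) * ((x - y) ^+ 2 + (y - z) ^+ 2 + (z - x) ^+ 2).
  by rewrite mulr_ge0 ?addr_ge0 ?sqr_ge0.
by lra.
Qed.

Lemma cube_sum4_le (R : realFieldType) (x y z w : R) : 0 <= x -> 0 <= y -> 0 <= z -> 0 <= w ->
  (x + y + z + w) ^+ 3 <= 16 * (x ^+ 3 + y ^+ 3 + z ^+ 3 + w ^+ 3).
Proof.
move=> x0 y0 z0 w0.
have cube2 (u v : R) : 0 <= u -> 0 <= v -> (u + v) ^+ 3 <= 4 * (u ^+ 3 + v ^+ 3).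
  move=> u0 v0; have : 0 <= (u + v) * (u - v) ^+ 2 by rewrite mulr_ge0 ?addr_ge0 ?sqr_ge0.
  by lra.
have := cube2 _ _ (addr_ge0 x0 y0) (addr_ge0 z0 w0).
have := cube2 _ _ x0 y0; have := cube2 _ _ z0 w0.
by rewrite !addrA; lra.
Qed.

Section mixed_sums.
Context {R : realType} {S : finType} {L : finType}.
Variables (a a' c c' : L).
Implicit Types (F G : S -> S -> R) (s : {ffun L -> S}).

Definition mixed_sum F s : R :=
  F (s a) (s c) + F (s a) (s c') + F (s a') (s c) + F (s a') (s c').

Local Notation md := (mixed_diff a a' c c').

Lemma mixed_diffB F G s : md (fun x y => F x y - G x y) s = md F s - md G s.
Proof. by rewrite /mixed_diff; ring. Qed.

Lemma mixed_diffZ k F s : md (fun x y => k * F x y) s = k * md F s.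
Proof. by rewrite /mixed_diff; ring. Qed.

Lemma mixed_diff_shift k F s : md (fun x y => F x y - k) s = md F s.
Proof. by rewrite /mixed_diff; ring. Qed.

Lemma norm_mixed_diff F G s : (forall x y, `|F x y| <= G x y) -> `|md F s| <= mixed_sum G s.
Proof.
move=> FG; rewrite /mixed_diff /mixed_sum.
by do 3 (apply: le_trans (ler_normD _ _) _; apply: lerD; rewrite ?normrN//).
Qed.

Lemma mixed_sum_ge0 F s : (forall x y, 0 <= F x y) -> 0 <= mixed_sum F s.
Proof. by move=> F0; rewrite /mixed_sum !addr_ge0. Qed.

Lemma mixed_sum_sqr_le F s : (forall x y, 0 <= F x y) ->
  mixed_sum (fun x y => F x y ^+ 2) s <= mixed_sum F s ^+ 2.
Proof.
move=> F0; rewrite /mixed_sum.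
move: (F0 (s a) (s c)) (F0 (s a) (s c')) (F0 (s a') (s c)) (F0 (s a') (s c')).
move: (F (s a) (s c)) (F (s a) (s c')) (F (s a') (s c)) (F (s a') (s c')) => u v w z u0 v0 w0 z0.
rewrite -subr_ge0.
have -> : (u + v + w + z) ^+ 2 - (u ^+ 2 + v ^+ 2 + w ^+ 2 + z ^+ 2) =
  2 * (u * v + u * w + u * z + v * w + v * z + w * z) by ring.
by rewrite mulr_ge0// !addr_ge0// mulr_ge0.
Qed.

End mixed_sums.

Section charge_sum.
Context {R : realType}.

Definition r1 : 'I_4 := @Ordinal 4 0 isT.
Definition r2 : 'I_4 := @Ordinal 4 1 isT.
Definition r3 : 'I_4 := @Ordinal 4 2 isT.
Definition r4 : 'I_4 := @Ordinal 4 3 isT.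

Lemma sum_I4 (F : 'I_4 -> R) : \sum_k F k = F r1 + F r2 + F r3 + F r4.
Proof.
rewrite !big_ord_recr big_ord0 /= add0r.
by congr (F _ + F _ + F _ + F _); exact: val_inj.
Qed.

Local Notation old k := (Some (Some k)).
Local Notation delta k o o' := ((old k \in [:: o; o'])%:R : R).

(** Only pairs of old replicas survive, one from each group. Each occurs in both orders with charge
    1/2, so its total coefficient is 1 up to sign. *)
Lemma sum_charge2_mixed (G : option (option 'I_4) -> option (option 'I_4) -> R) :
  (forall o o', G o o' = G o' o) ->
  \sum_o \sum_(o' | o' != o) charge2 o o' *
    ((delta r1 o o' - delta r2 o o') * (delta r3 o o' - delta r4 o o') * G o o') =
  G (old r1) (old r3) - G (old r1) (old r4) - G (old r2) (old r3) + G (old r2) (old r4).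
Proof.
move=> GC.
under eq_bigr do (rewrite big_mkcond/= !sum_option !sum_I4).
rewrite !sum_option !sum_I4 /=.
rewrite !(mulr0, mul0r, addr0, add0r, subrr, subr0, sub0r, mulr1, mul1r).
have c2 k l : charge2 (old k) (old l) = 1 / 2 :> R by rewrite /charge2/= mul1r.
rewrite !c2 (GC (old r3) (old r1)) (GC (old r3) (old r2)) (GC (old r4) (old r1)) (GC (old r4) (old r2)).
by field.
Qed.

End charge_sum.

Section off_site.
Context {R : realType} (p N : nat) (beta q : R) (i : 'I_N).
Local Notation S := (config N).
Implicit Types (F : S -> S -> R).

Lemma cavity_overlap_flip (L : finType) (l k k' : L) (s : {ffun L -> S}) :
  cavity_overlap i (flip i l s k) (flip i l s k') = cavity_overlap i (s k) (s k') :> R.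
Proof.
congr (_ * _); apply: eq_bigr => x xi; rewrite /agree /flip !ffunE.
by case: ifP => _; case: ifP => _; rewrite ?spin_flip_other.
Qed.

Lemma cavity_gamma_flip (L : finType) (l k k' : L) (s : {ffun L -> S}) :
  cavity_gamma p beta q i (flip i l s k) (flip i l s k') = cavity_gamma p beta q i (s k) (s k').
Proof.
congr (_ * _ - _); apply: eq_bigr => A _; apply: eq_bigr => x _.
case: (eqVneq x i) => [->|xi]; first by rewrite !mul0r.
rewrite /agree /flip !ffunE.
by case: ifP => _; case: ifP => _; rewrite ?spin_flip_other.
Qed.

Lemma cavity_gammaC s s' : cavity_gamma p beta q i s s' = cavity_gamma p beta q i s' s.
Proof.
congr (_ * _ - _); apply: eq_bigr => A _; apply: eq_bigr => x _.
by rewrite agreeC.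
Qed.

End off_site.

Section second_moment.
Context {R : realType} (p N : nat) (beta h q : R).
Hypotheses (hp : (2 <= p)%N) (hq : 0 <= q <= 1) (N_gt0 : (0 < N)%N).
Context d (T : measurableType d) (P : probability T R).
Context (xi : T -> cyl R (multi_index p N)) (xiG : iid_gaussian P xi).
Local Notation S := (config N).
Local Notation gauss := (normal_prob 0 1 : probability (measurableTypeR R) R).
Local Notation b := (cavity_std p beta q).
Local Notation nu i := (cavity_nu beta h q i P xi).
Local Notation growth := (growth p beta).
Local Notation kappa1 := (kappa1 p beta).
Local Notation kappa2 := (kappa2 p beta).
Local Notation kappa := (kappa p beta).
Local Notation Cv := (vdev_cst p beta).
Local Notation r := (rate N : R).
Hypothesis small : 20 * kappa1 * growth <= 5 / 8.
Hypothesis kappa2_gt0 : 0 < kappa2.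
Hypothesis qE : \int[gauss]_y (tanh (b * y + h) ^+ 2) = q.

Section fixed_site.
Variable i : 'I_N.
Local Notation v := (vdev q i).

Section vdev_products.
Context {L : finType}.
Implicit Types (l : L) (s : {ffun L -> S}).

Lemma nu_vdev (t : R) l l' k : 0 <= t <= 1 -> l != l' -> (k <= 4)%N ->
  nu i t (fun s : {ffun L -> S} => v (s l) (s l') ^+ k) <= Cv * r ^+ k.
Proof.
move=> t01 ll' k4; rewrite (cavity_nu_pair beta h q P xi i t (fun x y => v x y ^+ k) ll').
exact: (vdev_moment hp hq N_gt0 xiG small kappa2_gt0 qE).
Qed.

Variables (a a' c c' : L).
Hypothesis uniq4 : uniq [:: a; a'; c; c'].
Local Notation V := (mixed_sum a a' c c' v).

Let pairs_neq : [/\ a != c, a != c', a' != c & a' != c'].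
Proof.
have := uniq4; rewrite /= !inE !negb_or andbT.
by move=> /and3P[/and3P[_ ac ac'] /andP[a'c a'c'] _].
Qed.

Lemma vsum_ge0 s : 0 <= V s.
Proof. by apply: mixed_sum_ge0 => x y; exact: vdev_ge0. Qed.

Lemma nu_vsum (t : R) : 0 <= t <= 1 -> nu i t V <= 4 * (Cv * r).
Proof.
have alg (x y z w B : R) : x <= B -> y <= B -> z <= B -> w <= B -> x + y + z + w <= 4 * B.
  by move=> *; lra.
move=> t01; have [ac ac' a'c a'c'] := pairs_neq.
have n1 l l' : l != l' -> nu i t (fun s : {ffun L -> S} => v (s l) (s l')) <= Cv * r.
  by move=> ll'; have := nu_vdev t01 ll' (k := 1) isT; rewrite expr1.
rewrite /mixed_sum 3!(cavity_nuD beta h q xiG).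
exact: alg (n1 _ _ ac) (n1 _ _ ac') (n1 _ _ a'c) (n1 _ _ a'c').
Qed.

Lemma nu_vsum_cube (t : R) : 0 <= t <= 1 -> nu i t (fun s => V s ^+ 3) <= 64 * (Cv * r ^+ 3).
Proof.
have alg (x y z w B : R) : x <= B -> y <= B -> z <= B -> w <= B -> 16 * (x + y + z + w) <= 64 * B.
  by move=> *; lra.
move=> t01; have [ac ac' a'c a'c'] := pairs_neq.
have n3 l l' (ll' : l != l') := nu_vdev t01 ll' (k := 3) isT.
apply: (@le_trans _ _ (nu i t (fun s : {ffun L -> S} => 16 * mixed_sum a a' c c' (fun x y => v x y ^+ 3) s))).
  apply: (cavity_nu_le _ _ _ xiG) => s; apply: cube_sum4_le; exact: vdev_ge0.
rewrite (cavity_nuZ beta h q xiG) /mixed_sum 3!(cavity_nuD beta h q xiG).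
exact: alg (n3 _ _ ac) (n3 _ _ ac') (n3 _ _ a'c) (n3 _ _ a'c').
Qed.

Lemma nu_vsum_sqr_vdev (t : R) l l' : 0 <= t <= 1 -> l != l' ->
  nu i t (fun s => V s ^+ 2 * v (s l) (s l')) <= 129 * (Cv * r ^+ 3).
Proof.
have alg (x y B : R) : x <= 64 * B -> y <= B -> x + x + y <= 129 * B by move=> *; lra.
move=> t01 ll'.
apply: (@le_trans _ _ (nu i t (fun s => V s ^+ 3 + V s ^+ 3 + v (s l) (s l') ^+ 3))).
  apply: (cavity_nu_le _ _ _ xiG) => s; rewrite expr2.
  by apply: prod3_le; rewrite ?vsum_ge0 ?vdev_ge0.
rewrite !(cavity_nuD beta h q xiG).
exact: alg (nu_vsum_cube t01) (nu_vdev t01 ll' (k := 3) isT).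
Qed.

(** A product of three deviations is at most the sum of their cubes, each of order [rate ^ 3], which
    is the size of error allowed in the end. *)
Lemma nu_vsum_vdev2 (t : R) l l' k k' : 0 <= t <= 1 -> l != l' -> k != k' ->
  nu i t (fun s => V s * v (s l) (s l') * v (s k) (s k')) <= 66 * (Cv * r ^+ 3).
Proof.
have alg (x y z B : R) : x <= 64 * B -> y <= B -> z <= B -> x + y + z <= 66 * B by move=> *; lra.
move=> t01 ll' kk'.
apply: (@le_trans _ _ (nu i t (fun s => V s ^+ 3 + v (s l) (s l') ^+ 3 + v (s k) (s k') ^+ 3))).
  by apply: (cavity_nu_le _ _ _ xiG) => s; apply: prod3_le; rewrite ?vsum_ge0 ?vdev_ge0.
rewrite !(cavity_nuD beta h q xiG).
exact: alg (nu_vsum_cube t01) (nu_vdev t01 ll' (k := 3) isT) (nu_vdev t01 kk' (k := 3) isT).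
Qed.

End vdev_products.

End fixed_site.

End second_moment.

(** * Second-order expansion at one site *)

Section expansion.
Context {R : realType} (p N : nat) (beta h q : R).
Hypotheses (hp : (2 <= p)%N) (hq : 0 <= q <= 1) (N_gt0 : (0 < N)%N).
Context d (T : measurableType d) (P : probability T R).
Context (xi : T -> cyl R (multi_index p N)) (xiG : iid_gaussian P xi).
Local Notation S := (config N).
Local Notation gauss := (normal_prob 0 1 : probability (measurableTypeR R) R).
Local Notation b := (cavity_std p beta q).
Local Notation m := (N%:R^-1 : R).
Local Notation nu i := (cavity_nu beta h q i P xi).
Local Notation growth := (growth p beta).
Local Notation kappa1 := (kappa1 p beta).
Local Notation kappa2 := (kappa2 p beta).
Local Notation kappa := (kappa p beta).
Local Notation Cv := (vdev_cst p beta).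
Local Notation r := (rate N : R).
Hypothesis small : 20 * kappa1 * growth <= 5 / 8.
Hypothesis kappa2_gt0 : 0 < kappa2.
Hypothesis qE : \int[gauss]_y (tanh (b * y + h) ^+ 2) = q.
Let s0 : S := [ffun=> false].

Local Notation spread := (spin_spread p beta h q).
(** The derivative at [q] of [beta^2 (p/2) r^(p-1)], the leading part of [cavity_gamma] as a
    function of the overlap [r]. *)
Definition slope : R := kappa1 * q ^+ p.-2.

Local Notation md := (mixed_diff r1 r2 r3 r4).
Local Notation D := (md (@full_overlap R N)).

Section fixed_site.
Variable i : 'I_N.
Local Notation v := (vdev q i).
Local Notation V := (mixed_sum r1 r2 r3 r4 v).
Local Notation E := (md (fun x y => agree x y i : R)).
Local Notation Dm := (md (dev q i)).
Local Notation gam := (cavity_gamma p beta q i).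
Local Notation gen := (generator (@cavity_coef R p N beta q i) (@cavity_dir p N i)).

Lemma mixed_agreeE (L : finType) (a a' c c' : L) (s : {ffun L -> S}) :
  mixed_diff a a' c c' (fun x y => agree x y i : R) s =
  (spin R (s a) i - spin R (s a') i) * (spin R (s c) i - spin R (s c') i).
Proof. by rewrite /mixed_diff /agree; ring. Qed.

Lemma norm_mixed_agree (L : finType) (a a' c c' : L) (s : {ffun L -> S}) :
  `|mixed_diff a a' c c' (fun x y => agree x y i : R) s| <= 4.
Proof.
apply: le_trans (@norm_mixed_diff _ _ _ _ _ _ _ _ (fun _ _ => 1) _ _) _ => [x y|].
  by rewrite norm_agree.
by rewrite /mixed_sum (_ : 4 = 1 + 1 + 1 + 1 :> R)//; ring.
Qed.

Lemma norm_mixed_dev (L : finType) (a a' c c' : L) (s : {ffun L -> S}) :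
  `|mixed_diff a a' c c' (dev q i) s| <= mixed_sum a a' c c' v s.
Proof. by apply: norm_mixed_diff => x y; exact: norm_dev_vdev. Qed.

Lemma norm_mixed_overlap s : `|D s| <= V s.
Proof.
have -> : D s = md (fdev q) s by rewrite -(mixed_diff_shift _ _ _ _ q).
by apply: norm_mixed_diff => x y; exact: norm_fdev_vdev.
Qed.

(** Isolates the site's own share of [D]. Multiplied by [E] it gives [m * E^2], the source of the
    inhomogeneous term of the equation. *)
Lemma mixed_overlapE s : D s = Dm s + m * E s.
Proof.
rewrite -mixed_diffZ /mixed_diff !(full_overlapE i) /dev; ring.
Qed.

Lemma mixed_dev_flip_inv (L : finType) (a a' c c' : L) l :
  flip_inv i l (mixed_diff a a' c c' (dev q i)).
Proof. by move=> s; rewrite /mixed_diff /dev !cavity_overlap_flip. Qed.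

Lemma base_mixed (L : finType) (a a' c c' : L) (F : S -> S -> R) s :
  base (mixed_diff a a' c c' F) s =
  mixed_diff (Some (Some a)) (Some (Some a')) (Some (Some c)) (Some (Some c')) F s.
Proof. by rewrite /base /mixed_diff !ffunE. Qed.

Lemma baseM (L : finType) (f g : {ffun L -> S} -> R) s :
  base (fun s => f s * g s) s = base f s * base g s.
Proof. by []. Qed.

Lemma nu_base t (L : finType) (f : {ffun L -> S} -> R) : nu i t (base f) = nu i t f.
Proof.
have someI (A : Type) : injective (@Some A) by move=> ? ? [].
apply: etrans (nu_restr _ _ s0 _ _ _ t f (@someI L)).
exact: (nu_restr _ _ s0 _ _ _ t (fun s => f (restr Some s)) (@someI _)).
Qed.

Lemma kappa_ge0 : 0 <= kappa.
Proof. by rewrite addr_ge0 ?kappa1_ge0// ltW. Qed.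

(** Order zero is enough, because this quantity will be multiplied by [1/N]. The 16 bounds [E^2] and
    36 is the charge mass for four replicas. *)
Lemma mixed_agree_sqr :
  `|nu i 1 (fun s => E s ^+ 2) - 4 * spread| <= 36 * (16 * (kappa * (Cv * r))).
Proof.
have c16 : 0 <= 16 :> R by rewrite ler0n.
have z0 : nu i 0 (fun s => E s ^+ 2) = 4 * spread.
  have := @nu0_mixed_sqr R p N beta h q i d T P xi xiG _ r1 r2 r3 r4 isT (fun=> 1) (fun _ _ => erefl).
  rewrite (cavity_nu_cst beta h q P xi i 0 (L := 'I_4)) mulr1 => <-.
  by apply: eq_cavity_nu => s; rewrite mul1r mixed_agreeE.
rewrite -z0.
have := nu_mvt (extG xiG) s0 (kernel_cst beta q i hp) (f := fun s => E s ^+ 2)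
  (b := 16 * (kappa * (Cv * r))) _ (t := 1).
rewrite card_ord (_ : 2 * 4%:R ^+ 2 + 4%:R = 36 :> R); last by ring.
apply; last by rewrite ler01 lexx.
move=> t o o' /andP[t0 t1] oo'; have t01 : 0 <= t <= 1 by rewrite !ltW.
apply: (@le_trans _ _ (nu i t (fun s => 16 * (kappa * v (s o) (s o'))))).
  apply: (cavity_nu_le _ _ _ xiG) => s; apply: ler_pM => //; last exact: norm_kernel_vdev.
  rewrite /base normrX (_ : 16 = 4 ^+ 2); last by ring.
  by rewrite lerXn2r ?nnegrE// norm_mixed_agree.
rewrite !(cavity_nuZ beta h q xiG) ler_wpM2l// ler_wpM2l ?kappa_ge0//.
have ne : o != o' by rewrite eq_sym.
by have := nu_vdev hp hq N_gt0 xiG small kappa2_gt0 qE i t01 ne (k := 1) isT; rewrite expr1.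
Qed.

Lemma mixed_dev_agree_zero : nu i 0 (fun s => Dm s * E s) = 0.
Proof.
rewrite -[RHS](@nu0_mixed R p N beta h q i d T P xi xiG _ r1 r2 r3 r4 isT Dm).
  by apply: eq_cavity_nu => s; rewrite mixed_agreeE.
by move=> l; exact: mixed_dev_flip_inv.
Qed.

(** 36 and 78 are the charge masses for four and six replicas, 4 bounds [E], and each of the two
    kernels contributes [kappa] times a deviation; with [Dm] this makes three deviations. *)
Lemma mixed_dev_agree_second_order :
  `|nu i 1 (fun s => Dm s * E s) - nu i 0 (fun s => Dm s * E s) - nu i 0 (gen (fun s => Dm s * E s))|
  <= 78 * (36 * (4 * kappa ^+ 2 * (66 * (Cv * r ^+ 3)))).
Proof.
have k0 := kappa_ge0.
have c4 : 0 <= 4 * kappa ^+ 2 by rewrite mulr_ge0 ?sqr_ge0 ?ler0n.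
have := nu_second_order (extG xiG) s0 (B := @field_term R N h) (kernel_cst beta q i hp) (f := fun s => Dm s * E s)
  (b := 4 * kappa ^+ 2 * (66 * (Cv * r ^+ 3))).
rewrite !card_option card_ord (_ : 2 * 4%:R ^+ 2 + 4%:R = 36 :> R); last by ring.
rewrite (_ : 2 * 6%:R ^+ 2 + 6%:R = 78 :> R); last by ring.
apply => t o1 o1' o o' /andP[t0 t1] oo1 oo; have t01 : 0 <= t <= 1 by rewrite !ltW.
pose e (k : 'I_4) := Some (Some (Some (Some k))).
pose W := mixed_sum (e r1) (e r2) (e r3) (e r4) v.
apply: (@le_trans _ _ (nu i t (fun s => 4 * kappa ^+ 2 *
    (W s * v (s (Some (Some o1))) (s (Some (Some o1'))) * v (s o) (s o'))))).
  apply: (cavity_nu_le _ _ _ xiG) => s.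
  have -> : 4 * kappa ^+ 2 * (W s * v (s (Some (Some o1))) (s (Some (Some o1'))) * v (s o) (s o')) =
      W s * 4 * (kappa * v (s (Some (Some o1))) (s (Some (Some o1')))) * (kappa * v (s o) (s o')) by ring.
  apply: ler_pM; rewrite ?mulr_ge0//; last exact: norm_kernel_vdev.
  apply: ler_pM => //; last exact: norm_kernel_vdev.
  rewrite {1}/base baseM normrM; apply: ler_pM => //.
    by rewrite base_mixed -/(base _ _) base_mixed norm_mixed_dev.
  exact: norm_mixed_agree.
rewrite (cavity_nuZ beta h q xiG) ler_wpM2l//.
apply: (nu_vsum_vdev2 hp hq N_gt0 xiG small kappa2_gt0 qE i) => //.
  by rewrite !(inj_eq (@Some_inj _)) eq_sym.
by rewrite eq_sym.
Qed.

(** At [t = 0] the factors [gam] ignore the spins at the site, so each term of the generator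
    decouples by [nu0_mixed_pair]. The charge sum then rebuilds from [gam] the alternating pattern
    that defines [Dm], and the fresh replicas disappear. *)
Lemma mixed_generator : nu i 0 (gen (fun s => Dm s * E s)) = spread * nu i 0 (fun s => Dm s * md gam s).
Proof.
pose old (k : 'I_4) := Some (Some k).
pose delta k o o' : R := (old k \in [:: o; o'])%:R.
pose dd o o' := (delta r1 o o' - delta r2 o o') * (delta r3 o o' - delta r4 o o').
pose F (s : {ffun option (option 'I_4) -> S}) o o' := base Dm s * gam (s o) (s o').
pose G o o' := nu i 0 (fun s => F s o o').
have Fflip o o' l : flip_inv i l (fun s => F s o o').
  move=> s; rewrite /F cavity_gamma_flip !base_mixed; congr (_ * _).
  exact: mixed_dev_flip_inv.
pose H s (o o' : option (option 'I_4)) := F s o o' *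
   ((spin R (s (old r1)) i - spin R (s (old r2)) i) * (spin R (s (old r3)) i - spin R (s (old r4)) i) *
   (spin R (s o) i * spin R (s o') i)).
have genE s : gen (fun s => Dm s * E s) s = \sum_o \sum_o' (o' != o)%:R * charge2 o o' * H s o o'.
  rewrite (generatorE s0 (kernel_cst beta q i hp)) baseM [base E s]base_mixed mixed_agreeE mulr_sumr.
  apply: eq_bigr => o _; rewrite mulr_sumr big_mkcond; apply: eq_bigr => o' _.
  case: (o' != o); rewrite ?mul1r ?mul0r// cavity_kernelE// /H /F /agree.
  rewrite -/(old r1) -/(old r2) -/(old r3) -/(old r4); ring.
have -> : nu i 0 (gen (fun s => Dm s * E s)) =
    \sum_o \sum_o' (o' != o)%:R * charge2 o o' * nu i 0 (fun s => H s o o').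
  apply: etrans (eq_cavity_nu _ _ _ _ _ _ _ genE) _.
  rewrite (cavity_nu_sum beta h q xiG i 0); apply: eq_bigr => o _.
  rewrite (cavity_nu_sum beta h q xiG i 0); apply: eq_bigr => o' _.
  by rewrite (cavity_nuZ beta h q xiG i 0).
transitivity (spread * \sum_o \sum_(o' | o' != o) charge2 o o' * (dd o o' * G o o')).
  rewrite mulr_sumr; apply: eq_bigr => o _; rewrite mulr_sumr [RHS]big_mkcond; apply: eq_bigr => o' _.
  case: (boolP (o' != o)) => oo'; rewrite ?mul0r// mul1r.
  have ne : o != o' by rewrite eq_sym.
  rewrite /H (@nu0_mixed_pair R p N beta h q i d T P xi xiG _ (old r1) (old r2) (old r3) (old r4) isT
    (fun s => F s o o') o o' ne (Fflip o o')).
  rewrite -/(G o o') -/(delta r1 o o') -/(delta r2 o o')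
    -/(delta r3 o o') -/(delta r4 o o') -/(dd o o'); ring.
apply: (congr1 (fun z => spread * z)).
have GC o o' : G o o' = G o' o.
  by apply: eq_cavity_nu => s; rewrite /F cavity_gammaC.
rewrite (sum_charge2_mixed GC) /G -!(cavity_nuB beta h q xiG) -(cavity_nuD beta h q xiG).
rewrite -(nu_base 0 (fun s => Dm s * md gam s)); apply: eq_cavity_nu => s.
rewrite baseM [X in _ = _ * X]base_mixed /F /mixed_diff; ring.
Qed.

(** Two errors are collected: the [1/N] left by non-injective tuples and the quadratic Taylor
    remainder. Both fit under [v ^ 2] because [1/N = rate ^ 2]. *)
Lemma gamma_linear s s' : `|gam s s' - slope * dev q i s s'| <= kappa2 * v s s' ^+ 2.
Proof.
have [q0 q1] := andP hq.
have bp : 0 <= beta ^+ 2 * (p%:R / 2) by rewrite mulr_ge0 ?sqr_ge0 ?divr_ge0 ?ler0n.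
have p1 : p.-1 = p.-2.+1 by rewrite prednK// -ltnS prednK// ltnW.
have h1 := cavity_gamma_approx beta i hp hq N_gt0 s s'.
have h2 : `|cavity_overlap i s s' ^+ p.-1 - q ^+ p.-1 - p.-1%:R * q ^+ p.-2 * dev q i s s'| <=
    p.-1%:R ^+ 2 * dev q i s s' ^+ 2.
  by rewrite p1; apply: norm_subrX_taylor; rewrite ?norm_cavity_overlap// ger0_norm.
have h3 := ler_wpM2l bp h2.
have -> : gam s s' - slope * dev q i s s' =
  (gam s s' - beta ^+ 2 * (p%:R / 2) * (cavity_overlap i s s' ^+ p.-1 - q ^+ p.-1)) +
  beta ^+ 2 * (p%:R / 2) *
   (cavity_overlap i s s' ^+ p.-1 - q ^+ p.-1 - p.-1%:R * q ^+ p.-2 * dev q i s s').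
  rewrite /slope -[kappa1]/(beta ^+ 2 * (p%:R / 2) * p.-1%:R); ring.
apply: le_trans (ler_normD _ _) _.
apply: (@le_trans _ _ (kappa2 * m + kappa2 * dev q i s s' ^+ 2)).
  apply: lerD; first exact: h1.
  by rewrite normrM (ger0_norm bp) -[kappa2]/(beta ^+ 2 * (p%:R / 2) * p.-1%:R ^+ 2) -[leRHS]mulrA.
rewrite -mulrDr ler_wpM2l ?(ltW kappa2_gt0)// /vdev -(rate_sqr N).
rewrite (sqrrD `|_|) [leRHS]addrAC -normrX (ger0_norm (sqr_ge0 _)) [leLHS]addrC lerDl.
by rewrite mulrn_wge0// mulr_ge0// ltW// rate_gt0.
Qed.

Lemma mixed_gamma_linear :
  `|nu i 0 (fun s => Dm s * md gam s) - slope * nu i 0 (fun s => Dm s ^+ 2)|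
  <= kappa2 * (64 * (Cv * r ^+ 3)).
Proof.
rewrite -(cavity_nuZ beta h q xiG) -(cavity_nuB beta h q xiG).
apply: (@le_trans _ _ (nu i 0 (fun s => kappa2 * V s ^+ 3))); last first.
  rewrite (cavity_nuZ beta h q xiG) ler_wpM2l ?(ltW kappa2_gt0)//.
  apply: (nu_vsum_cube hp hq N_gt0 xiG small kappa2_gt0 qE i) => //.
  by rewrite lexx ler01.
apply: (cavity_nu_norm_le _ _ _ xiG) => s.
have -> : Dm s * md gam s - slope * Dm s ^+ 2 = Dm s * md (fun x y => gam x y - slope * dev q i x y) s.
  by rewrite mixed_diffB mixed_diffZ; ring.
rewrite normrM exprS mulrCA; apply: ler_pM => //; first exact: norm_mixed_dev.
apply: le_trans (norm_mixed_diff _ _ _ _ _ gamma_linear) _.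
have -> : mixed_sum r1 r2 r3 r4 (fun x y => kappa2 * v x y ^+ 2) s =
   kappa2 * mixed_sum r1 r2 r3 r4 (fun x y => v x y ^+ 2) s by rewrite /mixed_sum; ring.
rewrite ler_wpM2l ?(ltW kappa2_gt0)//; apply: mixed_sum_sqr_le => x y; exact: vdev_ge0.
Qed.

(** The expansion produces [Dm ^ 2] at time 0, while the equation is to be closed at time 1; the
    exchange costs one kernel, hence a third deviation. *)
Lemma mixed_dev_sqr_mvt :
  `|nu i 1 (fun s => Dm s ^+ 2) - nu i 0 (fun s => Dm s ^+ 2)| <= 36 * (kappa * (129 * (Cv * r ^+ 3))).
Proof.
have := nu_mvt (extG xiG) s0 (B := @field_term R N h) (kernel_cst beta q i hp) (f := fun s => Dm s ^+ 2)
  (b := kappa * (129 * (Cv * r ^+ 3))) _ (t := 1).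
rewrite card_ord (_ : 2 * 4%:R ^+ 2 + 4%:R = 36 :> R); last by ring.
apply; last by rewrite ler01 lexx.
move=> t o o' /andP[t0 t1] oo'; have t01 : 0 <= t <= 1 by rewrite !ltW.
pose e (k : 'I_4) := Some (Some k).
pose W := mixed_sum (e r1) (e r2) (e r3) (e r4) v.
apply: (@le_trans _ _ (nu i t (fun s => kappa * (W s ^+ 2 * v (s o) (s o'))))).
  apply: (cavity_nu_le _ _ _ xiG) => s; rewrite mulrCA; apply: ler_pM => //; last exact: norm_kernel_vdev.
  rewrite -[base _ s]/(base Dm s ^+ 2) base_mixed normrX lerXn2r ?nnegrE ?vsum_ge0//.
  exact: norm_mixed_dev.
rewrite (cavity_nuZ beta h q xiG) ler_wpM2l ?kappa_ge0//.
apply: (nu_vsum_sqr_vdev hp hq N_gt0 xiG small kappa2_gt0 qE i) => //.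
by rewrite eq_sym.
Qed.

Lemma mixed_dev_sqr_overlap :
  `|nu i 1 (fun s => Dm s ^+ 2) - nu i 1 (fun s => D s ^+ 2)| <= 32 * (Cv * r ^+ 3).
Proof.
have c8 : 0 <= 8 :> R by rewrite ler0n.
have [m0 _] := andP (m01 (R := R) N_gt0).
rewrite -(cavity_nuB beta h q xiG).
apply: (@le_trans _ _ (nu i 1 (fun s => 8 * m * V s))); last first.
  rewrite (cavity_nuZ beta h q xiG).
  have -> : 32 * (Cv * r ^+ 3) = 8 * m * (4 * (Cv * r)) by rewrite -(rate_sqr N); ring.
  rewrite ler_wpM2l ?mulr_ge0//.
  apply: (nu_vsum hp hq N_gt0 xiG small kappa2_gt0 qE i) => //.
  by rewrite lexx ler01.
apply: (cavity_nu_norm_le _ _ _ xiG) => s.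
have -> : Dm s ^+ 2 - D s ^+ 2 = - (m * E s * (Dm s + D s)) by rewrite (mixed_overlapE s); ring.
have -> : 8 * m * V s = m * 4 * (V s + V s) by ring.
rewrite normrN normrM; apply: ler_pM => //.
  by rewrite normrM (ger0_norm m0) ler_wpM2l// norm_mixed_agree.
by apply: le_trans (ler_normD _ _) _; rewrite lerD ?norm_mixed_dev ?norm_mixed_overlap.
Qed.

End fixed_site.

End expansion.

(** * The equation for the second moment, averaged over the sites *)

Section assembly.
Context {R : realType} (p N : nat) (beta h q : R).
Hypotheses (hp : (2 <= p)%N) (hq : 0 <= q <= 1) (N_gt0 : (0 < N)%N).
Context d (T : measurableType d) (P : probability T R).
Context (xi : T -> cyl R (multi_index p N)) (xiG : iid_gaussian P xi).
Local Notation S := (config N).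
Local Notation gauss := (normal_prob 0 1 : probability (measurableTypeR R) R).
Local Notation b := (cavity_std p beta q).
Local Notation m := (N%:R^-1 : R).
Local Notation nu i := (cavity_nu beta h q i P xi).
Local Notation growth := (growth p beta).
Local Notation kappa1 := (kappa1 p beta).
Local Notation kappa2 := (kappa2 p beta).
Local Notation kappa := (kappa p beta).
Local Notation Cv := (vdev_cst p beta).
Local Notation r := (rate N : R).
Hypothesis small : 20 * kappa1 * growth <= 5 / 8.
Hypothesis kappa2_gt0 : 0 < kappa2.
Hypothesis qE : \int[gauss]_y (tanh (b * y + h) ^+ 2) = q.

Local Notation spread := (spin_spread p beta h q).
Local Notation slope := (slope p beta q).
Local Notation md := (mixed_diff r1 r2 r3 r4).
Local Notation D := (md (@full_overlap R N)).
Local Notation E i := (md (fun x y => agree x y i : R)).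
Local Notation i0 := (Ordinal N_gt0).

Lemma spread01 : 0 <= spread <= 1.
Proof.
have I1 (g : R -> R) : measurable_fun setT g -> (forall y, `|g y| <= 1) ->
    gauss.-integrable setT (EFin \o g).
  by move=> mg g1; apply: (@bounded_integrable _ _ (measurableTypeR R) gauss _ 1).
have mS : measurable_fun setT (fun y : R => (1 - tanh (b * y + h) ^+ 2) ^+ 2).
  apply: (measurableT_comp measurable_spread); apply: continuous_measurable_fun => y.
  by apply: cvgD; [apply: cvgM; [exact: cvg_cst|exact: cvg_id]|exact: cvg_cst].
apply/andP; split.
  by apply: Rintegral_ge0 => y _; exact: sqr_ge0.
rewrite -[leRHS](_ : \int[gauss]_y 1 = 1); last first.
  rewrite Rintegral_cst// mul1r.
  exact: (congr1 fine (@probability_setT _ _ _ gauss)).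
apply: le_Rintegral => //.
- by apply: I1 => // y; exact: norm_spread_le1.
- by apply: I1 => // y; rewrite normr1.
- by move=> y _; apply: le_trans (norm_spread_le1 _); exact: ler_norm.
Qed.

Lemma slope_ge0 : 0 <= slope.
Proof. by have [q0 _] := andP hq; exact: mulr_ge0 (kappa1_ge0 p beta) (exprn_ge0 _ q0). Qed.

(** Keeps the denominator [1 - spread * slope] at least 1/2. It follows from the smallness used for
    the fourth moment, as [growth >= 1] while [spread] and [q] are at most 1. *)
Lemma spread_slope_le : spread * slope <= 1 / 2.
Proof.
have alg (k g : R) : 20 * k * g <= 5 / 8 -> k <= k * g -> k <= 1 / 2 by move=> *; lra.
have k1 : kappa1 <= 1 / 2.
  by apply: alg small _; rewrite ler_peMr ?kappa1_ge0 ?growth_ge1.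
have [w0 w1] := andP spread01; have [q0 q1] := andP hq.
apply: le_trans k1; apply: le_trans (ler_piMl slope_ge0 w1) _.
by rewrite -[slope]/(kappa1 * q ^+ p.-2) ler_piMr ?kappa1_ge0// exprn_ile1.
Qed.

Definition second_cst : R :=
  78 * (36 * (4 * kappa ^+ 2 * (66 * Cv))) + kappa2 * (64 * Cv) +
  slope * (36 * (kappa * (129 * Cv)) + 32 * Cv) + 36 * (16 * (kappa * Cv)).

Lemma site_expansion i :
  `|nu i 1 (fun s => D s * E i s) - spread * slope * nu i 1 (fun s => D s ^+ 2) - 4 * spread * m|
  <= second_cst * r ^+ 3.
Proof.
(* Here [B] and [g] are the average of [Dm * E] at time 1 and of its generator at time 0, [a0] pairs
   [Dm] with [gam] at time 0, [b0] and [b1] are [Dm ^ 2] at times 0 and 1, [x] and [G] are [D ^ 2]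
   and [E ^ 2] at time 1; the [e]s are the matching errors. *)
have alg (A B G g a0 b0 b1 x w c mm e1 e2 e5 e6 e7 : R) : A = B + mm * G ->
    `|B - 0 - g| <= e2 -> g = w * a0 -> `|a0 - c * b0| <= e5 -> `|b1 - b0| <= e6 ->
    `|b1 - x| <= e7 -> `|G - 4 * w| <= e1 -> 0 <= w <= 1 -> 0 <= c -> 0 <= mm ->
    `|A - w * c * x - 4 * w * mm| <= e2 + e5 + c * (e6 + e7) + mm * e1.
  move=> -> hB gE ha hb hx hG /andP[w0 w1] c0 mm0; rewrite gE in hB.
  have -> : B + mm * G - w * c * x - 4 * w * mm = (B - 0 - w * a0) + w * (a0 - c * b0) +
     w * (c * ((b0 - b1) + (b1 - x))) + mm * (G - 4 * w) by ring.
  apply: le_trans (ler_normD _ _) _; apply: lerD; last by rewrite normrM (ger0_norm mm0) ler_wpM2l.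
  apply: le_trans (ler_normD _ _) _; apply: lerD; last first.
    rewrite normrM (ger0_norm w0); apply: le_trans (ler_piMl (normr_ge0 _) w1) _.
    rewrite normrM (ger0_norm c0) ler_wpM2l//; apply: le_trans (ler_normD _ _) _.
    by rewrite lerD// distrC.
  apply: le_trans (ler_normD _ _) _; apply: lerD => //.
  by rewrite normrM (ger0_norm w0); apply: le_trans (ler_piMl (normr_ge0 _) w1) ha.
have [m0 _] := andP (m01 (R := R) N_gt0).
have eA : nu i 1 (fun s => D s * E i s) = nu i 1 (fun s => md (dev q i) s * E i s) + m * nu i 1 (fun s => E i s ^+ 2).
  rewrite -(cavity_nuZ beta h q xiG) -(cavity_nuD beta h q xiG); apply: eq_cavity_nu => s.
  by rewrite (mixed_overlapE q i s); ring.
have h2 := mixed_dev_agree_second_order hp hq N_gt0 xiG small kappa2_gt0 qE i.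
rewrite (mixed_dev_agree_zero beta h q xiG i) in h2.
have := alg _ _ _ _ _ _ _ _ _ _ _ _ _ _ _ _ eA h2
  (mixed_generator beta h q hp xiG i)
  (mixed_gamma_linear hp hq N_gt0 xiG small kappa2_gt0 qE i)
  (mixed_dev_sqr_mvt hp hq N_gt0 xiG small kappa2_gt0 qE i)
  (mixed_dev_sqr_overlap hp hq N_gt0 xiG small kappa2_gt0 qE i)
  (mixed_agree_sqr hp hq N_gt0 xiG small kappa2_gt0 qE i) spread01 slope_ge0 m0.
move/le_trans; apply; rewrite le_eqVlt; apply/orP; left; apply/eqP.
by rewrite /second_cst -(rate_sqr N); ring.
Qed.

Lemma mixed_overlap_sum s : D s = m * \sum_i E i s.
Proof.
rewrite /mixed_diff /full_overlap -!mulrBr -mulrDr -!sumrB -big_split; congr (_ * _).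
Qed.

(** Averaged over the sites, [D * E i] becomes [D ^ 2], and [site_expansion] reads
    [x (1 - w c) = 4 w / N] up to its error. The factor 2 bounds the inverse of [1 - w c]. *)
Lemma mixed_overlap_second_moment :
  `|gibbs_nu beta h P xi (fun s => D s ^+ 2) - 4 * spread * m / (1 - spread * slope)|
  <= 2 * (second_cst * r ^+ 3).
Proof.
have alg (x w c mm e : R) : `|x - w * c * x - 4 * w * mm| <= e -> w * c <= 1 / 2 ->
    `|x - 4 * w * mm / (1 - w * c)| <= 2 * e.
  move=> xe wc; have d0 : 0 < 1 - w * c by lra.
  have -> : x - 4 * w * mm / (1 - w * c) = (x - w * c * x - 4 * w * mm) / (1 - w * c).
    by field; rewrite gt_eqF.
  have e0 : 0 <= e := le_trans (normr_ge0 _) xe.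
  rewrite normrM normfV (ger0_norm (ltW d0)) ler_pdivrMr//; apply: le_trans xe _.
  have : 0 <= e * (1 / 2 - w * c) by rewrite mulr_ge0// subr_ge0.
  by lra.
have avgB (Y : 'I_N -> R) (x u w mm : R) : mm * N%:R = 1 -> x = mm * \sum_i Y i ->
    x - u - w = mm * \sum_i (Y i - u - w).
  move=> mN xS; rewrite !sumrB !sumr_const card_ord -[u *+ N]mulr_natl -[w *+ N]mulr_natl xS.
  transitivity (mm * \sum_i Y i - mm * N%:R * u - mm * N%:R * w); last by ring.
  by rewrite mN !mul1r.
apply: alg; last exact: spread_slope_le.
set x := gibbs_nu _ _ _ _ _.
have N0 : 0 < N%:R :> R by rewrite ltr0n.
have mN : m * N%:R = 1 by rewrite mulVf// gt_eqF.
have xE i : nu i 1 (fun s => D s ^+ 2) = x by exact: cavity_nu1.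
have xS : x = m * \sum_i nu i 1 (fun s => D s * E i s).
  rewrite -(xE i0).
  transitivity (m * nu i0 1 (fun s => \sum_i D s * E i s)).
    rewrite -(cavity_nuZ beta h q xiG); apply: eq_cavity_nu => s.
    by rewrite -mulr_sumr mulrCA -mixed_overlap_sum expr2.
  apply: (congr1 (fun z => m * z)).
  apply: (etrans (cavity_nu_sum beta h q xiG i0 1 (fun i s => D s * E i s))).
  apply: eq_bigr => i _.
  exact: etrans (cavity_nu1 beta h q xiG i0 _) (esym (cavity_nu1 beta h q xiG i _)).
rewrite (avgB _ _ (spread * slope * x) (4 * spread * m) _ mN xS).
rewrite normrM ger0_norm ?invr_ge0 ?ler0n// ler_pdivrMl//.
apply: le_trans (ler_norm_sum _ _ _) _.
have site i : `|nu i 1 (fun s => D s * E i s) - spread * slope * x - 4 * spread * m| <=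
    second_cst * r ^+ 3.
  by rewrite -(xE i); exact: site_expansion.
apply: le_trans (ler_sum _ (fun i _ => site i)) _.
by rewrite sumr_const card_ord -[leLHS]mulr_natl.
Qed.

Local Notation Dk := (md (fun x y => full_overlap x y ^+ p.-1 : R)).

(** In the factored difference of squares, [Dk - y * D] is a mixed difference of Taylor remainders,
    hence quadratic in the deviations, and [Dk + y * D] is linear in them. Subtracting [q ^ (p-1)]
    inside a mixed difference changes nothing. *)
Lemma mixed_power_linear :
  `|gibbs_nu beta h P xi (fun s => Dk s ^+ 2) -
    (p.-1%:R * q ^+ p.-2) ^+ 2 * gibbs_nu beta h P xi (fun s => D s ^+ 2)|
  <= 2 * p.-1%:R ^+ 3 * (64 * (Cv * r ^+ 3)).
Proof.
have [q0 q1] := andP hq.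
have p1 : p.-1 = p.-2.+1 by rewrite prednK// -ltnS prednK// ltnW.
have k0 : 0 <= p.-1%:R :> R by rewrite ler0n.
rewrite -!(cavity_nu1 beta h q xiG i0) -(cavity_nuZ beta h q xiG) -(cavity_nuB beta h q xiG).
set y := p.-1%:R * q ^+ p.-2.
have y0 : 0 <= y by rewrite mulr_ge0// exprn_ge0.
have yk : y <= p.-1%:R by rewrite ler_piMr// exprn_ile1.
pose V := mixed_sum (L := 'I_4) r1 r2 r3 r4 (vdev q i0).
have qn : `|q| <= 1 by rewrite ger0_norm.
apply: (@le_trans _ _ (nu i0 1 (fun s => 2 * p.-1%:R ^+ 3 * V s ^+ 3))); last first.
  rewrite (cavity_nuZ beta h q xiG) ler_wpM2l ?mulr_ge0 ?exprn_ge0//.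
  apply: (nu_vsum_cube hp hq N_gt0 xiG small kappa2_gt0 qE i0) => //.
  by rewrite lexx ler01.
apply: (cavity_nu_norm_le _ _ _ xiG) => s.
have V0 : 0 <= V s by exact: vsum_ge0.
have -> : Dk s ^+ 2 - y ^+ 2 * D s ^+ 2 = (Dk s - y * D s) * (Dk s + y * D s) by ring.
have -> : 2 * p.-1%:R ^+ 3 * V s ^+ 3 = (p.-1%:R ^+ 2 * V s ^+ 2) * (p.-1%:R * V s + p.-1%:R * V s) by ring.
have DV : `|D s| <= V s by exact: norm_mixed_overlap.
rewrite normrM; apply: ler_pM => //.
- have -> : Dk s - y * D s = md (fun x z => full_overlap x z ^+ p.-1 - q ^+ p.-1 - y * fdev q x z) s.
    by rewrite /mixed_diff /fdev; ring.
  apply: le_trans (@norm_mixed_diff _ _ _ _ _ _ _ _ (fun x z => p.-1%:R ^+ 2 * vdev q i0 x z ^+ 2) _ _) _ => [x z|].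
    apply: (@le_trans _ _ (p.-1%:R ^+ 2 * fdev q x z ^+ 2)).
      by rewrite /y p1; apply: norm_subrX_taylor => //; exact: norm_full_overlap.
    rewrite ler_wpM2l ?sqr_ge0// -[fdev q x z ^+ 2]ger0_norm ?sqr_ge0// normrX.
    by rewrite lerXn2r ?nnegrE ?vdev_ge0// norm_fdev_vdev.
  have -> : mixed_sum r1 r2 r3 r4 (fun x z => p.-1%:R ^+ 2 * vdev q i0 x z ^+ 2) s =
     p.-1%:R ^+ 2 * mixed_sum r1 r2 r3 r4 (fun x z => vdev q i0 x z ^+ 2) s by rewrite /mixed_sum; ring.
  by rewrite ler_wpM2l ?sqr_ge0//; apply: mixed_sum_sqr_le => x z; exact: vdev_ge0.
- apply: le_trans (ler_normD _ _) _; apply: lerD; last first.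
    by rewrite normrM (ger0_norm y0); apply: ler_pM.
  rewrite -(mixed_diff_shift _ _ _ _ (q ^+ p.-1)).
  apply: le_trans (@norm_mixed_diff _ _ _ _ _ _ _ _ (fun x z => p.-1%:R * vdev q i0 x z) _ _) _ => [x z|].
    apply: le_trans (norm_subrX _ (norm_full_overlap N_gt0 _ _) qn) _.
    by rewrite ler_wpM2l// norm_fdev_vdev.
  by rewrite /V /mixed_sum !mulrDr.
Qed.

Definition expansion_cst : R := 2 * p.-1%:R ^+ 3 * (64 * Cv) + 2 * p.-1%:R ^+ 2 * second_cst.

Lemma mixed_power_second_moment :
  `|gibbs_nu beta h P xi (fun s => Dk s ^+ 2) -
    (p.-1%:R * q ^+ p.-2) ^+ 2 * (4 * spread * m / (1 - spread * slope))|
  <= expansion_cst * r ^+ 3.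
Proof.
have [q0 q1] := andP hq.
have alg (A x z y k e1 e2 : R) : `|A - y ^+ 2 * x| <= e1 -> `|x - z| <= e2 -> 0 <= y <= k ->
    `|A - y ^+ 2 * z| <= e1 + k ^+ 2 * e2.
  move=> h1 h2 /andP[y0 yk].
  have -> : A - y ^+ 2 * z = (A - y ^+ 2 * x) + y ^+ 2 * (x - z) by ring.
  apply: le_trans (ler_normD _ _) _; apply: lerD => //; rewrite normrM (ger0_norm (sqr_ge0 _)).
  apply: ler_pM => //; first exact: sqr_ge0.
  by rewrite lerXn2r ?nnegrE// (le_trans y0 yk).
have := alg _ _ _ _ p.-1%:R _ _ mixed_power_linear mixed_overlap_second_moment.
rewrite mulr_ge0 ?exprn_ge0 ?ler0n//= ler_piMr ?ler0n ?exprn_ile1// => /(_ isT) /le_trans; apply.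
rewrite le_eqVlt; apply/orP; left; apply/eqP.
by rewrite /expansion_cst; ring.
Qed.

End assembly.

Lemma nu_gibbs_nu (R : realType) (p N : nat) (beta h : R) d (T : measurableType d)
    (P : probability T R) (g : multi_index p N -> {RV P >-> R}) n (f : replicas N n -> R) :
  iid_gaussian P (fun w t => g t w : R) ->
  nu beta h g f = (gibbs_nu beta h P (fun w t => g t w : R) f)%:E.
Proof.
move=> gG; pose s0 : config N := [ffun=> false].
rewrite /nu unlock /gibbs_nu /Rintegral fineK.
  apply: eq_integral => w _; congr EFin.
  rewrite (avg_gibbsE s0) card_ord /gibbs /partition_function.
  by congr (_ * _); apply: eq_bigr => s _; rewrite [in RHS]sumrN.
apply: integrable_fin_num => //.
apply: (bounded_integrable P (C := \sum_s `|f s|)).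
  exact: (measurable_avg_hamiltonian beta h gG).
by move=> w; exact: (avg_bound s0).
Qed.

(** Since [kappa1 <= p^2 beta_p^2 / 2] and [growth <= expR (16 beta_p^2 p)], the left side is at
    most [10 p^2 beta_p^2 expR (16 beta_p^2 p)], which the equation for [beta_p] makes 10/16. *)
Lemma small_coupling (R : realType) (p : nat) (beta beta_p : R) : (2 <= p)%N ->
  8 * p%:R ^+ 2 * beta_p ^+ 2 * expR (16 * beta_p ^+ 2 * p%:R) = 1 / 2 ->
  0 < beta -> beta < beta_p -> 20 * kappa1 p beta * growth p beta <= 5 / 8.
Proof.
move=> hp bpE b0 bbp.
have p0 : 0 <= p%:R :> R by rewrite ler0n.
have p1 : p.-1%:R <= p%:R :> R by rewrite ler_nat leq_pred.
have bb : beta ^+ 2 <= beta_p ^+ 2.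
  by rewrite lerXn2r ?nnegrE ?ltW// (lt_trans b0 bbp).
have b2 := sqr_ge0 beta.
have h1 : growth p beta <= expR (16 * beta_p ^+ 2 * p%:R).
  rewrite /growth ler_expR mulrA ler_wpM2r//.
  apply: (@le_trans _ _ (16 * beta ^+ 2)); last by rewrite ler_wpM2l.
  by rewrite ler_wpM2r// ler_nat.
have h2 : kappa1 p beta <= p%:R ^+ 2 * beta_p ^+ 2 / 2.
  rewrite /kappa1 (_ : p%:R ^+ 2 * beta_p ^+ 2 / 2 = beta_p ^+ 2 * (p%:R / 2) * p%:R); last by ring.
  apply: ler_pM => //; first by rewrite mulr_ge0// divr_ge0.
  by rewrite ler_wpM2r// divr_ge0.
have h3 := ler_pM (kappa1_ge0 p beta) (expR_ge0 _) h2 h1.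
have alg (k g u e : R) : k * g <= u / 2 * e -> 8 * u * e = 1 / 2 -> 20 * k * g <= 5 / 8.
  by move=> *; lra.
by apply: alg h3 _; rewrite mulrA.
Qed.

Unset Implicit Arguments.

Theorem proposition5p1 (R : realType) (p : nat) (hp : (2 <= p)%N)
  (h beta beta_p : R) (h_gt0 : 0 < h)
  (beta_p_gt0 : 0 < beta_p)
  (beta_pE : 8 * p%:R ^+ 2 * beta_p ^+ 2 * expR (16 * beta_p ^+ 2 * p%:R) = 1 / 2)
  (beta_gt0 : 0 < beta) (beta_lt : beta < beta_p)
  (dY : measure_display) (TY : measurableType dY) (PY : probability TY R)
  (Y : {RV PY >-> R}) (hY : std_gaussian Y)
  (q : R) (hq : 0 <= q <= 1)
  (qE : q%:E = 'E_PY[fun w =>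
     (tanh (beta * Num.sqrt (p%:R / 2) * q `^ ((p%:R - 1) / 2) * Y w + h) ^+ 2)%R]%E)
  (q4 : R)
  (q4E : q4%:E = 'E_PY[fun w =>
     (tanh (beta * Num.sqrt (p%:R / 2) * q `^ ((p%:R - 1) / 2) * Y w + h) ^+ 4)%R]%E) :
  exists K : R, forall N : nat, (p <= N)%N ->
    forall (d : measure_display) (T : measurableType d) (P : probability T R)
      (g : multi_index p N -> {RV P >-> R}),
    (forall t, std_gaussian (g t)) -> mutually_independent g ->
    (`| nu beta h g (fun s : replicas N 4 => Delta R p.-1 s ^+ 2)%R
        - (4 * (p%:R - 1) ^+ 2 * q ^+ (2 * (p - 2)) * (1 - 2 * q + q4)
           / (N%:R * (1 - p%:R * (p%:R - 1) / 2 * q ^+ (p - 2)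
                            * (1 - 2 * q + q4) * beta ^+ 2)))%:E |
     <= (K / N%:R `^ (3 / 2))%:E)%E.
Proof.
(* All dependence on [N] in the error has been put into [rate ^ 3], so this constant serves every
   [N]. *)
exists (expansion_cst p beta q) => N pN d T P g gG indep.
have small := small_coupling hp beta_pE beta_gt0 beta_lt.
have N_gt0 : (0 < N)%N by apply: leq_trans pN; exact: leq_trans hp.
have p_gt1 : (0 < p.-1)%N by case: (p) hp => [|[]].
have k2 : 0 < kappa2 p beta.
  by rewrite /kappa2 !mulr_gt0 ?exprn_gt0 ?invr_gt0 ?ltr0n// (ltnW hp).
pose gauss : probability (measurableTypeR R) R := normal_prob 0 1.
(* The moments of [Y] are transported to integrals against [gauss], the form in which the cavity
   field produces them. *)
have tanhE k (E : R) : E%:E = 'E_PY[fun w =>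
     (tanh (beta * Num.sqrt (p%:R / 2) * q `^ ((p%:R - 1) / 2) * Y w + h) ^+ k)%R]%E ->
    \int[gauss]_y (tanh (cavity_std p beta q * y + h) ^+ k) = E.
  move=> eE; apply: EFin_inj; rewrite eE; symmetry.
  apply: (std_gaussian_integral (C := 1) hY (measurable_tanh_affine p beta h q k)).
  by move=> y; rewrite norm_expr_le1// norm_tanh_le1.
have q2 := tanhE 2 q qE; have q4' := tanhE 4 q4 q4E.
have I k : gauss.-integrable setT (EFin \o (fun y => tanh (cavity_std p beta q * y + h) ^+ k)).
  apply: (bounded_integrable gauss (C := 1) (measurable_tanh_affine p beta h q k)).
  by move=> y; rewrite norm_expr_le1// norm_tanh_le1.
have wE : spin_spread p beta h q = 1 - 2 * q + q4.
  pose th k y : R := tanh (cavity_std p beta q * y + h) ^+ k.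
  have one : \int[gauss]_y (1 : R) = 1.
    rewrite Rintegral_cst// mul1r.
    exact: (congr1 fine (@probability_setT _ _ _ gauss)).
  have I1 : gauss.-integrable setT (EFin \o (fun=> 1 : R)) by exact: finite_measure_integrable_cst.
  have I2 : gauss.-integrable setT (EFin \o (fun y => 2 * th 2 y)) by exact: integrableZl (I 2).
  transitivity (\int[gauss]_y (1 - 2 * th 2 y + th 4 y)).
    by apply: eq_Rintegral => y _; rewrite /th; ring.
  have I12 : gauss.-integrable setT (EFin \o (fun y => 1 - 2 * th 2 y)) by exact: (integrableB measurableT I1 I2).
  have I3 : gauss.-integrable setT (EFin \o th 2) := I 2.
  have I4 : gauss.-integrable setT (EFin \o th 4) := I 4.
  rewrite RintegralD// RintegralB// RintegralZl//.
  by congr (_ - 2 * _ + _).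
have xiG := iid_gaussian_of_independent gG indep.
rewrite (nu_gibbs_nu beta h _ xiG) -EFinB abse_EFin lee_fin.
have := mixed_power_second_moment hp hq N_gt0 xiG small k2 q2.
have p1 : p%:R - 1 = p.-1%:R :> R by rewrite -{1}(prednK (ltnW hp)) -natr1 addrK.
(* The power 3/2 of [N] is three factors of [rate]. *)
have rE : (N%:R `^ (3 / 2))^-1 = rate N ^+ 3 :> R.
  by rewrite /rate exprVn -powR12_sqrt ?ler0n// -powR_mulrn ?powR_ge0// -powRrM mulrC.
rewrite wE rE.
have -> : (p.-1%:R * q ^+ p.-2) ^+ 2 *
    (4 * (1 - 2 * q + q4) / N%:R / (1 - (1 - 2 * q + q4) * slope p beta q)) =
  4 * (p%:R - 1) ^+ 2 * q ^+ (2 * (p - 2)) * (1 - 2 * q + q4)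
           / (N%:R * (1 - p%:R * (p%:R - 1) / 2 * q ^+ (p - 2)
                            * (1 - 2 * q + q4) * beta ^+ 2)).
  rewrite p1 subn2 mulnC exprM invfM /slope /kappa1.
  have -> : (1 - 2 * q + q4) * (beta ^+ 2 * (p%:R / 2) * p.-1%:R * q ^+ p.-2) =
    p%:R * p.-1%:R / 2 * q ^+ p.-2 * (1 - 2 * q + q4) * beta ^+ 2 by ring.
  ring.
exact.
Qed.
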